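(* Fix an integer $k\ge 1$ (for $k=1$, either of the two models below). There exist constants $s_0>0$, $c_1>0$, $c_2>0$ such that for all $0<s<s_0$, \[ \exp\!\left(-2\lambda_k s^{-1}+c_1 s^{-1/2}\right)\;\le\;\mathbf{P}(\text{indefinite growth})\;\le\;\exp\!\left(-2\lambda_k s^{-1}+c_2 s^{-1/2}\left(\log s^{-1}\right)^{5/2}\right), \] where $\lambda_k=\frac{\pi^2}{3k(k+1)}$. For the $k=1$ Frobse model the upper bound holds with $\left(\log s^{-1}\right)^{5/2}$ replaced by $\log s^{-1}$.
   Context: Local $k$-percolation on $\mathbb{Z}^2$. Let $s>0$ and $q=e^{-s}$. The initial configuration is random: the origin is active with probability $1-q$ and empty with probability $q$; every other site is, independently, occupied with probability $1-q$ and empty with probability $q$. Active sites remain active forever, and the set of active sites is enlarged by repeatedly applying the growth rules below (the final set of active sites is the smallest set containing the initially active sites that is closed under the rules). For $k\ge2$, with $N_k(x)=\{x+(v,0),\,x+(0,v): v\in\mathbb{Z},\,1\le |v|\le k-1\}$: an occupied site becomes active if some active site lies within $\ell^1$-distance $k$ of it; an empty site $x$ becomes active if at least $k$ sites of $N_k(x)$ are active. For $k=1$ there are two models. Modified model: an occupied site becomes active if some active site lies within $\ell^\infty$-distance $1$; an empty site $x$ becomes active if at least one of $x\pm(0,1)$ and at least one of $x\pm(1,0)$ are active. Frobse model: an occupied site becomes active if some active site lies within $\ell^1$-distance $1$; an empty site $x$ becomes active if for some $\varepsilon,\delta\in\{\pm1\}$ the sites $x+(\varepsilon,0)$, $x+(0,\delta)$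 and the corner site $x+(\varepsilon,\delta)$ are all active. ''Indefinite growth'' is the event that every site of $\mathbb{Z}^2$ eventually becomes active; $\mathbf{P}$ is the probability measure of the initial configuration. *)

(* Defs.v *)
From HB Require Import structures.
From mathcomp Require Import all_boot all_order all_algebra.
From mathcomp Require Import all_classical all_reals all_analysis.
Set Implicit Arguments. Unset Strict Implicit. Unset Printing Implicit Defensive.
Import Order.TTheory GRing.Theory Num.Theory.
Local Open Scope ring_scope.
Local Open Scope classical_set_scope.

Definition site := (int * int)%type.

(* A configuration: [w x = true] means x is occupied (for x <> 0), and for the
   origin, [w 0 = true] means the origin is (initially) active.
   [w x = false] means x is empty. *)
Definition config := site -> bool.

Definition l1dist (x y : site) : int := `|x.1 - y.1| + `|x.2 - y.2|.
Definition linfdist (x y : site) : int := Num.max `|x.1 - y.1| `|x.2 - y.2|.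

Definition inNk (k : nat) (x y : site) : Prop :=
  (y.2 = x.2 /\ 1 <= `|y.1 - x.1| <= (k%:Z - 1)) \/
  (y.1 = x.1 /\ 1 <= `|y.2 - x.2| <= (k%:Z - 1)).

Inductive model := LocalK of nat | Modified1 | Frobse1.

Definition valid_model (m : model) : Prop :=
  match m with LocalK k => (2 <= k)%N | _ => True end.

Definition model_k (m : model) : nat :=
  match m with LocalK k => k | _ => 1%N end.

Definition occupied_rule (m : model) (S : set site) (x : site) : Prop :=
  match m with
  | LocalK k => exists y, S y /\ l1dist x y <= k%:Z
  | Modified1 => exists y, S y /\ linfdist x y <= 1
  | Frobse1 => exists y, S y /\ l1dist x y <= 1
  end.

Definition empty_rule (m : model) (S : set site) (x : site) : Prop :=
  match m with
  | LocalK k => exists l : seq site,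
      [/\ uniq l, size l = k, (forall y, y \in l -> inNk k x y)
        & (forall y, y \in l -> S y)]
  | Modified1 =>
      (S (x.1, x.2 + 1) \/ S (x.1, x.2 - 1)) /\
      (S (x.1 + 1, x.2) \/ S (x.1 - 1, x.2))
  | Frobse1 => exists e d : int, (e = 1 \/ e = -1) /\ (d = 1 \/ d = -1) /\
      S (x.1 + e, x.2) /\ S (x.1, x.2 + d) /\ S (x.1 + e, x.2 + d)
  end.

Definition initially_active (w : config) : set site :=
  [set x | x = (0, 0) /\ w (0, 0) = true].

Definition closed_set (m : model) (w : config) (S : set site) : Prop :=
  (forall x, initially_active w x -> S x) /\
  (forall x, w x = true -> occupied_rule m S x -> S x) /\
  (forall x, w x = false -> empty_rule m S x -> S x).

Definition final_active (m : model) (w : config) : set site :=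
  [set x | forall S, closed_set m w S -> S x].

Definition indefinite_growth (m : model) (w : config) : Prop :=
  final_active m w = setT.

Definition iid_bernoulli_field (R : realType) (d : measure_display)
  (T : measurableType d) (P : probability T R) (X : T -> config) (p : R) : Prop :=
  (forall x, measurable [set t | X t x = true]) /\
  (forall (l : seq site) (b : config), uniq l ->
     P [set t | forall x, x \in l -> X t x = b x] =
     (\prod_(x <- l) (if b x then p else 1 - p))%:E).

Definition lambda_k (R : realType) (k : nat) : R :=
  pi ^+ 2 / (3 * k%:R * (k%:R + 1)).

(* Main.v *)
(** Let [g z] be the exponential rate, per line, of having no [k] consecutive missed lines when
    each line is missed with probability [u = exp (- z)]: it solves
    [\sum_(j < k) (1 - u) u^j exp (g z)^(j+1) = 1].  Its graph is the curve [z = hh (- y)],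
    [g z = hh y], where [hh y = ln ((1 + v + .. + v^k) / (1 + .. + v^(k-1)))] and [v = exp (- y)];
    hence [g] is convex, and its integral over the positive reals is a dilogarithm value,
    [lambda_k].

    Upper bound: under indefinite growth every rectangle containing the origin has an occupied
    site outside of it but within [k] of it.  Moving the sides along a grid whose step at [x]
    is about [s^(1/2) min (x, 1/s)] gives a list of [O (s^(-1/2) ln (1/s))] directions such that the
    block of lines crossed by each step has no [k] consecutive missed lines.  Sites that lie
    on two lines of the construction cost a bounded factor per step; the remaining lines are
    independent, and by convexity of [g] a potential bounds the product of the block
    probabilities by [exp (- 2 lambda_k / s)] up to the error term.  A union bound over the
    lists of directions concludes.

    Lower bound: a square grows into the quadrant, column [x] being searched below height
    [x - k] and row [y] left of [y - k]; this has probability [exp (- 2 lambda_k / s)] up to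
    powers of [s].  To gain the factor [exp (c s^(-1/2))], a run of [k] missed columns ending
    at [x], with [x] between [1/s] and [2/s], is forgiven when column [x] has an occupied site
    between the heights [x - k] and [x + s^(-1/2)]: the rows up to that height can be filled
    first, for which they are searched on a range shorter by [O (s^(-1/2))], at the cost of a
    constant factor.  This has conditional probability of order [s^(1/2)] at each of [1/s]
    columns. *)
Require Import Defs.
From HB Require Import structures.
From mathcomp Require Import all_boot all_order all_algebra.
From mathcomp Require Import all_classical all_reals all_analysis.
From mathcomp Require Import ring lra zify.
Set Implicit Arguments. Unset Strict Implicit. Unset Printing Implicit Defensive.
Import Order.TTheory GRing.Theory Num.Theory.
Import numFieldNormedType.Exports.
Local Open Scope ring_scope.
Local Open Scope classical_set_scope.

(** * Derivatives and the Basel sum *)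

(** The grid balances two losses in the upper bound. Moving the sides to grid positions changes the
    number of sites searched on a line by a factor [1 + O (s^(1/2))], hence the exponent
    [2 lambda_k / s] by [O (s^(-1/2))]. Each step costs a bounded factor for the choice of its
    direction, a bounded factor for the shared sites, and [k - 1] lines: a block of [n] lines has no
    [k] consecutive missed ones with probability at most [exp (- (n - (k - 1)) g)], and [g] can be
    as large as [ln (1/s)]. With [O (s^(-1/2) ln (1/s))] steps the total error is of order
    [s^(-1/2) ln (1/s)] for [k = 1], and [s^(-1/2) (ln (1/s))^2] for [k > 1], which is below the
    power [5/2] of the statement.

    In the lower bound, the obstacle to forgiving a column is that the site which repairs it may be
    too high to be reached, and may already be used by a row. Shortening the nearby rows removes
    both difficulties: they can be filled before the column, and they stop before it. *)

Section Deriv.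
Variable R : realType.
Implicit Types (f g : R -> R) (x a b : R).

Lemma dif_continuous f x a : is_derive x 1 f a -> {for x, continuous f}.
Proof.
move=> [df _]; apply/differentiable_continuous; exact/derivable1_diffP.
Qed.

Lemma dif_eq f g x a b : is_derive x 1 f a -> f =1 g -> a = b -> is_derive x 1 g b.
Proof. by move=> h /funext <- <-. Qed.

Lemma dif_cst (c : R) x : is_derive x 1 (fun _ : R => c) 0.
Proof. exact: is_derive_cst. Qed.

Lemma dif_id x : is_derive x 1 (fun y : R => y) 1.
Proof. exact: is_derive_id. Qed.

Lemma difD f g x a b : is_derive x 1 f a -> is_derive x 1 g b ->
  is_derive x 1 (fun y => f y + g y) (a + b).
Proof. exact: is_deriveD. Qed.

Lemma difN f x a : is_derive x 1 f a -> is_derive x 1 (fun y => - f y) (- a).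
Proof. exact: is_deriveN. Qed.

Lemma difB f g x a b : is_derive x 1 f a -> is_derive x 1 g b ->
  is_derive x 1 (fun y => f y - g y) (a - b).
Proof. exact: is_deriveB. Qed.

Lemma difM f g x a b : is_derive x 1 f a -> is_derive x 1 g b ->
  is_derive x 1 (fun y => f y * g y) (a * g x + f x * b).
Proof.
move=> hf hg; have := is_deriveM hf hg.
by move=> h; apply: dif_eq h _ _ => //; rewrite /GRing.scale/= addrC mulrC.
Qed.

Lemma difMl (c : R) f x a : is_derive x 1 f a ->
  is_derive x 1 (fun y => c * f y) (c * a).
Proof. by move=> h; have := is_deriveZ c h. Qed.

Lemma dif_comp f g x a b : is_derive x 1 g b -> is_derive (g x) 1 f a ->
  is_derive x 1 (fun y => f (g y)) (a * b).
Proof. by move=> hg hf; have := is_derive1_comp hf hg. Qed.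

Lemma dif_exp f x a : is_derive x 1 f a ->
  is_derive x 1 (fun y => expR (f y)) (expR (f x) * a).
Proof. by move=> hf; exact: (dif_comp hf (is_derive_expR _)). Qed.

Lemma dif_ln f x a : is_derive x 1 f a -> 0 < f x ->
  is_derive x 1 (fun y => ln (f y)) (a / f x).
Proof.
move=> hf fx0; apply: dif_eq (dif_comp hf (is_derive1_ln fx0)) _ _ => //.
by rewrite mulrC.
Qed.

Lemma dif_sum n (f : nat -> R -> R) (df : nat -> R) x :
  (forall i, is_derive x 1 (f i) (df i)) ->
  is_derive x 1 (fun y => \sum_(i < n) f i y) (\sum_(i < n) df i).
Proof.
move=> h; have := @is_derive_sum R R R n (fun i => f i) x 1 (fun i => df i) (fun i => h i).
by move=> H; apply: dif_eq H _ _ => // y; rewrite fct_sumE.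
Qed.

Lemma dif_pow n x : is_derive x 1 (fun y : R => y ^+ n) (n%:R * x ^+ n.-1).
Proof.
have := is_deriveX n (dif_id x) => h; apply: dif_eq h _ _ => //.
  by move=> y; elim: n => [|n IH]; rewrite ?expr0// !exprS -IH.
by rewrite /GRing.scale/= mulr1.
Qed.

Lemma mvt_oo f (df : R -> R) a b : a < b ->
  (forall x, a < x < b -> is_derive x 1 f (df x)) ->
  {within `[a, b], continuous f} ->
  exists c, a < c < b /\ f b - f a = df c * (b - a).
Proof.
move=> ab hd hc.
have hd' x : x \in `]a, b[%R -> is_derive x 1 f (df x) by rewrite in_itv/=; apply: hd.
have [c] := MVT ab hd' hc.
by rewrite in_itv/= => ? ?; exists c.
Qed.

Lemma mvt f (df : R -> R) a b : a < b ->
  (forall x, a <= x <= b -> is_derive x 1 f (df x)) ->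
  exists c, a < c < b /\ f b - f a = df c * (b - a).
Proof.
move=> ab hd; apply: mvt_oo => //.
  by move=> x /andP[ax xb]; apply: hd; rewrite !ltW.
apply: derivable_within_continuous => x; rewrite in_itv/= => hx.
by have [] := hd x hx.
Qed.

Lemma dif_ge0_le f (df : R -> R) a b : a <= b ->
  (forall x, a <= x <= b -> is_derive x 1 f (df x)) ->
  (forall x, a <= x <= b -> 0 <= df x) -> f a <= f b.
Proof.
rewrite le_eqVlt => /predU1P[->//|ab] hd h0.
have [c [/andP[ac cb] hc]] := mvt ab hd.
by rewrite -subr_ge0 hc mulr_ge0 ?h0 ?subr_ge0 ?ltW// ac.
Qed.

End Deriv.

(** * The Basel sum, from sums of [1 / sin^2] over equally spaced angles *)

Section Basel.
Variable R : realType.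
Implicit Type x : R.

Lemma sin_lt x : 0 <= x -> sin x <= x.
Proof.
move=> x0.
have := @dif_ge0_le R (fun y => y - sin y) (fun y => 1 - cos y) 0 x x0.
rewrite sin0 subr0 subr_ge0; apply => y _.
by rewrite subr_ge0 cos_le1.
Qed.

Lemma xcos_le_sin x : 0 <= x <= pi / 2 -> x * cos x <= sin x.
Proof.
move=> /andP[x0 xp].
have := @dif_ge0_le R (fun y => sin y - y * cos y)
   (fun y => cos y - (1 * cos y + y * (- sin y))) 0 x x0.
rewrite sin0 mul0r subr0 subr_ge0; apply => y /andP[y0 yx].
  by apply: difB; apply: difM.
rewrite mul1r opprD addrA subrr add0r mulrN opprK mulr_ge0// sin_ge0_pi// y0/=.
by rewrite (le_trans yx)// (le_trans xp)// ler_pdivrMr// ler_peMr// ?pi_ge0// ler1n.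
Qed.

Definition odd_angle m j : R := (j.*2.+1)%:R * pi / 2 ^+ m.+2.

Lemma odd_angle_lt m j : (j < 2 ^ m)%N -> 0 < odd_angle m j < pi / 2.
Proof.
move=> jm; rewrite /odd_angle; apply/andP; split.
  by rewrite divr_gt0// ?mulr_gt0// ?pi_gt0// ?exprn_gt0.
rewrite exprS invfM mulrA mulrAC.
have p2 : (0 : R) < 2 ^+ m.+1 by rewrite exprn_gt0.
rewrite ltr_pM2r ?invr_gt0// mulrAC -[ltRHS]mul1r ltr_pM2r ?pi_gt0//.
rewrite ltr_pdivrMr// mul1r.
by rewrite -natrX ltr_nat expnS; lia.
Qed.

Lemma inv_sin2_half x : sin (x / 2) != 0 -> cos (x / 2) != 0 ->
  (sin x) ^- 2 = ((sin (x / 2)) ^- 2 + (sin (pi / 2 - x / 2)) ^- 2) / 4.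
Proof.
move=> s0 c0; rewrite sinB sin_pihalf cos_pihalf mul1r mul0r subr0.
have -> : sin x = 2 * (sin (x / 2) * cos (x / 2)).
  have {1}-> : x = (x / 2) *+ 2 by rewrite -mulr_natr; field.
  by rewrite sin_mulr2n -mulr_natl mulrC [sin _ * _]mulrC mulrC.
have h := cos2Dsin2 (x / 2).
rewrite !exprMn.
move: s0 c0 h; set a := sin _; set b := cos _ => s0 c0 h.
have -> : a ^- 2 + b ^- 2 = (b ^+ 2 + a ^+ 2) / (a ^+ 2 * b ^+ 2) by field; rewrite s0 c0.
by rewrite h; field; rewrite s0 c0.
Qed.

(** By [inv_sin2_half], each angle splits into its half and the complement of its half, and these
    make up all the angles of the next level. Reversing the second half of the sum pairs them. *)
Lemma sum_inv_sin2 m : \sum_(0 <= j < 2 ^ m) (sin (odd_angle m j)) ^- 2 = 2 * 4 ^+ m.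
Proof.
elim: m => [|m IH].
  rewrite expn0 big_nat1 expr0 mulr1 /odd_angle/= double0 mul1r.
  have : cos (pi / 2 ^+ 2 *+ 2) = 0 :> R.
    by rewrite -[RHS]cos_pihalf; congr cos; rewrite -mulr_natr; field.
  rewrite cos_mulr2n cos2sin2 -mulr_natr => h.
  have -> : sin (pi / 2 ^+ 2) ^+ 2 = 2^-1 :> R by lra.
  by rewrite invrK.
have -> : 2 * 4 ^+ m.+1 = 4 * \sum_(0 <= j < 2 ^ m) sin (odd_angle m j) ^- 2.
  by rewrite IH exprS; ring.
rewrite expnS mul2n -addnn (@big_cat_nat _ _ _ (2 ^ m)) ?leq_addr//=.
rewrite -{2}[(2 ^ m)%N]add0n big_addn addnK.
rewrite [X in _ + X]big_nat_rev/= -big_split/= mulr_sumr.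
apply: eq_big_nat => j /andP[_ jm].
have /andP[x0 xp] := odd_angle_lt jm.
have half : odd_angle m.+1 j = odd_angle m j / 2.
  by rewrite /odd_angle (exprS _ m.+2) invfM; ring.
have halfc : odd_angle m.+1 (0 + 2 ^ m - j.+1 + 2 ^ m) = pi / 2 - odd_angle m j / 2.
  rewrite /odd_angle.
  have -> : ((0 + 2 ^ m - j.+1 + 2 ^ m).*2.+1 = 2 ^ m.+2 - j.*2.+1)%N.
    by rewrite !expnS; lia.
  rewrite natrB; last by rewrite !expnS; lia.
  rewrite natrX (exprS _ m.+2).
  have : (2 : R) ^+ m.+2 != 0 by rewrite expf_neq0.
  by move: (2 ^+ m.+2) => t t0; field.
have p2 : 0 < pi / 2 :> R by rewrite divr_gt0// pi_gt0.
rewrite (@inv_sin2_half (odd_angle m j)) ?half ?halfc.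
- by rewrite [RHS]mulrC mulfVK.
- rewrite gt_eqF// sin_gt0_pihalf//; apply/andP; split; lra.
- rewrite gt_eqF// cos_gt0_pihalf//; apply/andP; split; lra.
Qed.

(** These are [sin x <= x <= tan x], as [1 / sin^2 x - 1 = 1 / tan^2 x]. The gap of 1 per angle adds
    up to [2^m], against sums of order [4^m]. *)
Lemma inv_sq_bounds x : 0 < x < pi / 2 -> (sin x) ^- 2 - 1 <= x ^- 2 <= (sin x) ^- 2.
Proof.
move=> /andP[x0 xp]; have s0 : 0 < sin x by rewrite sin_gt0_pihalf// x0.
have c0 : 0 < cos x by rewrite cos_gt0_pihalf// xp andbT (lt_trans _ x0)// oppr_lt0; lra.
have s1 := sin_lt (ltW x0).
have xc : x * cos x <= sin x by rewrite xcos_le_sin// !ltW.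
have -> : x ^- 2 <= sin x ^- 2.
  by rewrite lef_pV2 ?posrE ?exprn_gt0// ler_sqr// nnegrE ltW.
rewrite andbT.
have -> : (sin x) ^- 2 - 1 = cos x ^+ 2 / sin x ^+ 2.
  by rewrite cos2sin2; field; rewrite gt_eqF.
rewrite ler_pdivrMr ?exprn_gt0// mulrC ler_pdivlMr ?exprn_gt0// -exprMn mulrC.
by rewrite ler_sqr// nnegrE ltW// mulr_gt0.
Qed.

Lemma sum_odd_inv_sq_bounds m :
  pi ^+ 2 / 8 * (1 - (2 ^+ m.+1)^-1) <=
  \sum_(0 <= j < 2 ^ m) (j.*2.+1%:R ^- 2 : R) <= pi ^+ 2 / 8.
Proof.
have p0 := pi_gt0 R.
have t0 : (0 : R) < 2 ^+ m.+2 by rewrite exprn_gt0.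
have e1 : \sum_(0 <= j < 2 ^ m) (odd_angle m j) ^- 2
   = (2 ^+ m.+2 / pi) ^+ 2 * \sum_(0 <= j < 2 ^ m) (j.*2.+1%:R ^- 2 : R).
  rewrite mulr_sumr; apply: eq_bigr => j _; rewrite /odd_angle.
  have j0 : (0 : R) < j.*2.+1%:R by rewrite ltr0n.
  move: (2 ^+ m.+2) t0 (pi) p0 (j.*2.+1%:R) j0 => t t0 p p0 y y0; field.
  by rewrite !gt_eqF.
have e2 : ((2 : R) ^+ m.+2) ^+ 2 = 16 * 4 ^+ m.
  by rewrite -exprM mulnC exprM -natrX (_ : (2 ^ 2)%N = 4%N)// !exprS; ring.
have h4 : (0 : R) < 4 ^+ m by rewrite exprn_gt0.
have u : \sum_(0 <= j < 2 ^ m) (odd_angle m j) ^- 2 <= 2 * 4 ^+ m.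
  rewrite -sum_inv_sin2; apply: ler_sum_nat => j /andP[_ /odd_angle_lt/inv_sq_bounds].
  by move=> /andP[].
have l : 2 * 4 ^+ m - 2 ^+ m <= \sum_(0 <= j < 2 ^ m) (odd_angle m j) ^- 2.
  have -> : (2 : R) ^+ m = \sum_(0 <= j < 2 ^ m) 1.
    by rewrite big_const_nat iter_addr subn0 addr0 natrX.
  rewrite -sum_inv_sin2 -sumrB; apply: ler_sum_nat => j /andP[_ /odd_angle_lt/inv_sq_bounds].
  by move=> /andP[].
move: u l; rewrite e1 expr_div_n e2.
set S := \sum_(0 <= _ < _) _ => u l.
have h2 : (2:R) ^+ m * 2 ^+ m = 4 ^+ m by rewrite -exprMn -natrM.
have hp : (0 : R) < 2 ^+ m by rewrite exprn_gt0.
rewrite -(ler_pM2l h4) (exprS 2 m) invfM.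
rewrite -[X in _ && X](ler_pM2l h4).
have u' : 16 * 4 ^+ m * S <= 2 * 4 ^+ m * pi ^+ 2.
  by rewrite -ler_pdivrMr ?exprn_gt0// mulrAC.
have l' : (2 * 4 ^+ m - 2 ^+ m) * pi ^+ 2 <= 16 * 4 ^+ m * S.
  by rewrite -ler_pdivlMr ?exprn_gt0// mulrAC.
have -> : 4 ^+ m * (pi ^+ 2 / 8 * (1 - 2^-1 * (2 ^+ m)^-1)) =
   (2 * 4 ^+ m - 2 ^+ m) * pi ^+ 2 / 16 :> R.
  by rewrite -h2; field; rewrite gt_eqF.
apply/andP; split; lra.
Qed.

End Basel.

(** * Partial sums of the logarithmic series *)

Section LogSeries.
Variable R : realType.
Implicit Types (x y a b : R) (N : nat).

Lemma le_eps (x y : R) : (forall e, 0 < e -> x <= y + e) -> x <= y.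
Proof. by move=> h; apply/ler_addgt0Pr => e e0; apply: h. Qed.

Lemma nat_large (x : R) : exists N : nat, x < N%:R.
Proof. by exists (Num.bound `|x|); apply: le_lt_trans (ler_norm _) (archi_boundP (normr_ge0 _)). Qed.

Lemma geom_sum_lt1 x N : x != 1 -> \sum_(i < N) x ^+ i = (1 - x ^+ N) / (1 - x).
Proof.
move=> x1; have h : 1 - x != 0 by rewrite subr_eq0 eq_sym.
apply: (mulfI h); rewrite mulrC [RHS]mulrC mulfVK//.
by rewrite -[1 - x ^+ N]opprB subrX1 -mulNr opprB mulrC.
Qed.

Lemma pow_small x e : 0 <= x < 1 -> 0 < e -> exists N, x ^+ N <= e.
Proof.
move=> /andP[x0 x1] e0.
have h : `|x| < 1 by rewrite ger0_norm.
have /cvgrPdist_le/(_ e e0)[N _ hN] := cvg_expr h.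
exists N; have := hN N (leqnn N); rewrite /= sub0r normrN ger0_norm// exprn_ge0//.
Qed.

Definition lnser N x : R := \sum_(i < N) x ^+ i.+1 / i.+1%:R.

Lemma dif_lnser N x : is_derive x 1 (lnser N) (\sum_(i < N) x ^+ i).
Proof.
apply: (@dif_sum R N (fun i y => y ^+ i.+1 / i.+1%:R) (fun i => x ^+ i)) => i.
apply: dif_eq (difM (dif_pow i.+1 x) (dif_cst (i.+1%:R^-1) x)) _ _ => //=.
by rewrite mulr0 addr0 mulrC mulrA mulVf// ?mul1r// pnatr_eq0.
Qed.

Lemma dif_ln1B x : x < 1 -> is_derive x 1 (fun y : R => ln (1 - y)) (- (1 - x)^-1).
Proof.
move=> x1; have h : is_derive x 1 (fun y : R => 1 - y) (0 - 1).
  by apply: difB.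
by apply: dif_eq (dif_ln h _) _ _ => //; rewrite ?subr_gt0// sub0r mulN1r.
Qed.

Lemma lnser_le N x : 0 <= x < 1 -> lnser N x <= - ln (1 - x).
Proof.
move=> /andP[x0 x1].
have := @dif_ge0_le R (fun y => - ln (1 - y) - lnser N y)
  (fun y => - - (1 - y)^-1 - \sum_(i < N) y ^+ i) 0 x x0.
rewrite subr0 ln1 oppr0 /lnser big1 ?subr0; last first.
  by move=> i _; rewrite expr0n/= mul0r.
rewrite subr_ge0; apply => y /andP[y0 yx].
  apply: difB; last exact: dif_lnser.
  by apply: difN; apply: dif_ln1B; apply: le_lt_trans x1.
have y1 := le_lt_trans yx x1.
rewrite opprK geom_sum_lt1 ?lt_eqF// mulrBl mul1r opprB addrC subrK.
by rewrite divr_ge0 ?exprn_ge0// subr_ge0 ltW.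
Qed.

(** With the coefficient [x^N / (1 - x)] frozen at the endpoint, the difference has derivative
    [x^N / (1 - x) - y^N / (1 - y)], nonnegative for [y <= x]. *)
Lemma le_lnser N x : 0 <= x < 1 -> - ln (1 - x) <= lnser N x + x ^+ N * (x / (1 - x)).
Proof.
move=> /andP[x0 x1].
have := @dif_ge0_le R (fun y => lnser N y + (x ^+ N / (1 - x)) * y + ln (1 - y))
  (fun y => \sum_(i < N) y ^+ i + (x ^+ N / (1 - x)) * 1 + - (1 - y)^-1) 0 x x0.
rewrite subr0 ln1 mulr0 [lnser N 0]/lnser big1 ?add0r; last first.
  by move=> i _; rewrite expr0n/= mul0r.
have -> : x ^+ N * (x / (1 - x)) = x ^+ N / (1 - x) * x by ring.
rewrite -[- ln _ <= _]subr_ge0 opprK; apply => y /andP[y0 yx].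
  apply: difD; last by apply: dif_ln1B; apply: le_lt_trans x1.
  by apply: difD; exact: dif_lnser.
have y1 := le_lt_trans yx x1.
rewrite geom_sum_lt1 ?lt_eqF// mulr1 mulrBl mul1r.
suff : y ^+ N / (1 - y) <= x ^+ N / (1 - x) by lra.
apply: ler_pM.
- exact: exprn_ge0.
- by rewrite invr_ge0 subr_ge0 ltW.
- by rewrite lerXn2r.
- by rewrite lef_pV2 ?posrE ?subr_gt0// lerD2l lerN2.
Qed.

Lemma lnser_mono N M x : 0 <= x -> (N <= M)%N -> lnser N x <= lnser M x.
Proof.
move=> x0 NM; rewrite /lnser -!(big_mkord xpredT (fun i => x ^+ i.+1 / i.+1%:R)).
rewrite (big_cat_nat (leq0n _) NM)/= lerDl sumr_ge0// => i _.
by rewrite divr_ge0// exprn_ge0.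
Qed.

Lemma le_lnser_eps x e : 0 <= x < 1 -> 0 < e ->
  exists N, forall M, (N <= M)%N -> - ln (1 - x) <= lnser M x + e.
Proof.
move=> /andP[x0 x1] e0; have x1' : 0 < 1 - x by rewrite subr_gt0.
have x01 : 0 <= x < 1 by rewrite x0.
have [N hN] := pow_small x01 (mulr_gt0 e0 x1').
exists N => M NM; apply: le_trans (le_lnser N _) _; first by rewrite x0.
apply: lerD; first exact: lnser_mono.
rewrite mulrA ler_pdivrMr//; apply: le_trans hN.
by rewrite ler_piMr ?exprn_ge0// ltW.
Qed.

End LogSeries.

(** * The dilogarithm *)

Section Dilog.
Variable R : realType.
Implicit Types (x y a b : R) (N : nat).

(** Terms of the dilogarithm series at [exp (- y)]; in this variable its derivative is the plain
    logarithm [- lgm]. *)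
Definition literm y n : R := expR (- (n.+1%:R * y)) / n.+1%:R ^+ 2.
Definition lisum N y : R := \sum_(0 <= i < N) literm y i.
Definition Li y : R := limn (fun N => lisum N y).

Lemma literm_ge0 y n : 0 <= literm y n.
Proof. by rewrite divr_ge0 ?expR_ge0// exprn_ge0. Qed.

Lemma lisum_mono y N M : (N <= M)%N -> lisum N y <= lisum M y.
Proof.
move=> NM; rewrite /lisum (big_cat_nat (leq0n _) NM)/= lerDl sumr_ge0// => i _.
exact: literm_ge0.
Qed.

Lemma literm_le0 y n : 0 <= y -> literm y n <= literm 0 n.
Proof.
move=> y0; rewrite /literm ler_wpM2r ?invr_ge0 ?exprn_ge0//.
by rewrite ler_expR mulr0 oppr0 oppr_le0 mulr_ge0.
Qed.

Lemma literm0 n : literm 0 n = n.+1%:R ^- 2.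
Proof. by rewrite /literm mulr0 oppr0 expR0 mul1r. Qed.

Lemma lisum0_bound N : lisum N 0 <= 2.
Proof.
suff h M : lisum M.+1 0 <= 2 - M.+1%:R^-1.
  by apply: le_trans (lisum_mono 0 (leqnSn N)) (le_trans (h N) _); rewrite gerBl.
elim: M => [|M IH]; first by rewrite /lisum big_nat1 literm0 expr1n invr1; lra.
rewrite /lisum big_nat_recr//= -/(lisum _ _) literm0.
apply: le_trans (lerD IH (lexx _)) _; rewrite -addrA lerD2l.
have p : (0 : R) < M.+1%:R by [].
rewrite -(natr1 M.+1); move: (M.+1%:R) p => t p.
have t1 : 0 < t + 1 by rewrite addr_gt0.
rewrite -subr_ge0.
have -> : - (t + 1)^-1 - (- t^-1 + (t + 1) ^- 2) = t^-1 * (t + 1) ^- 2.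
  by field; rewrite !gt_eqF.
by apply: divr_ge0; [rewrite invr_ge0 ltW|rewrite exprn_ge0// ltW].
Qed.

Lemma lisum_le0 N y : 0 <= y -> lisum N y <= lisum N 0.
Proof. by move=> y0; apply: ler_sum => i _; apply: literm_le0. Qed.

Lemma lisum_cvg y : 0 <= y -> cvgn (fun N => lisum N y).
Proof.
move=> y0; apply: nondecreasing_is_cvgn; first by move=> N M; apply: lisum_mono.
by exists 2 => _ [N _ <-]; apply: le_trans (lisum_le0 N y0) (lisum0_bound N).
Qed.

Lemma lisum_leL N y : 0 <= y -> lisum N y <= Li y.
Proof.
move=> y0; apply: (@nondecreasing_cvgn_le R (fun N => lisum N y)); last exact: lisum_cvg.
by move=> n m; apply: lisum_mono.
Qed.

Lemma Li_le y B : 0 <= y -> (forall N, lisum N y <= B) -> Li y <= B.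
Proof. by move=> y0 h; apply: limr_le; [exact: lisum_cvg|exact: nearW]. Qed.

Lemma Li_ge0 y : 0 <= y -> 0 <= Li y.
Proof. by move=> y0; apply: le_trans (lisum_leL 0 y0); rewrite /lisum big_geq. Qed.

Lemma Li_le0 y : 0 <= y -> Li y <= Li 0.
Proof.
by move=> y0; apply: Li_le => // N; apply: le_trans (lisum_le0 N y0) (lisum_leL N (lexx 0)).
Qed.

Lemma Li_decay y : 0 <= y -> Li y <= expR (- y) * 2.
Proof.
move=> y0; apply: Li_le => // N.
apply: le_trans (_ : expR (- y) * lisum N 0 <= _); last first.
  by rewrite ler_wpM2l ?expR_ge0// lisum0_bound.
rewrite mulr_sumr; apply: ler_sum => n _; rewrite literm0 /literm.
rewrite ler_wpM2r ?invr_ge0 ?exprn_ge0// ler_expR lerN2.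
by rewrite ler_peMl// ler1n.
Qed.

Lemma Li_eps y e : 0 <= y -> 0 < e -> exists N, forall M, (N <= M)%N -> Li y <= lisum M y + e.
Proof.
move=> y0 e0; apply: contrapT => h.
suff : Li y <= Li y - e by rewrite lerBrDr gerDl leNgt e0.
apply: Li_le => // N.
move/forallNP: h => /(_ N) /existsNP[M] /not_implyP[NM /negP]; rewrite -ltNge => hM.
by apply: le_trans (lisum_mono y NM) _; rewrite lerBrDr ltW.
Qed.

Lemma lisum_odd_even m : lisum (2 ^ m.+1) 0 =
  \sum_(0 <= j < 2 ^ m) (j.*2.+1%:R ^- 2 : R) + lisum (2 ^ m) 0 / 4.
Proof.
have H n : lisum n.*2 0 = \sum_(0 <= j < n) (j.*2.+1%:R ^- 2 : R) + lisum n 0 / 4.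
  elim: n => [|n IH]; first by rewrite /lisum !big_geq// mul0r addr0.
  rewrite doubleS /lisum !big_nat_recr//= -!/(lisum _ _) IH !literm0.
  have -> : n.*2.+2%:R = 2 * n.+1%:R :> R by rewrite -natrM; congr _%:R; lia.
  rewrite [(_ + _) / 4]mulrDl.
  have -> : (2 * n.+1%:R) ^- 2 = n.+1%:R ^- 2 / 4 :> R.
    by field; rewrite -[1]/(1%:R) -natrD pnatr_eq0.
  by rewrite -!addrA; congr (_ + _); rewrite addrCA.
by rewrite expnS mul2n.
Qed.

(** The odd terms add up to [pi^2 / 8] and the even ones to a quarter of the whole, so
    [Li 0 = pi^2 / 8 + Li 0 / 4]; both inequalities are proved on partial sums. *)
Lemma Li_0 : Li 0 = pi ^+ 2 / 6.
Proof.
have U : Li 0 <= pi ^+ 2 / 8 + Li 0 / 4.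
  apply: Li_le => // N; apply: le_trans (lisum_mono 0 (_ : N <= 2 ^ N.+1)%N) _.
    by apply: ltnW; apply: ltn_trans (ltnSn N) _; apply: ltn_expl.
  rewrite lisum_odd_even; apply: lerD; first by have /andP[] := sum_odd_inv_sq_bounds R N.
  by rewrite ler_pM2r ?invr_gt0//; apply: lisum_leL.
have p0 : 0 < pi ^+ 2 / 8 :> R by rewrite divr_gt0// exprn_gt0// pi_gt0.
have L : Li 0 <= 4 * (Li 0 - pi ^+ 2 / 8).
  apply: Li_le => // N; apply: le_eps => e e0.
  have [M hM] := nat_large (pi ^+ 2 / 8 / (e / 4)).
  set m := maxn N M.
  have h1 : lisum N 0 <= lisum (2 ^ m) 0.
    by apply: lisum_mono; apply: leq_trans (leq_maxl N M) (ltnW (ltn_expl _ _)).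
  have h2 := lisum_leL (2 ^ m.+1) (lexx 0).
  have /andP[h3 _] := sum_odd_inv_sq_bounds R m.
  have h4 : pi ^+ 2 / 8 * (2 ^+ m.+1)^-1 <= e / 4.
    rewrite ler_pdivrMr ?exprn_gt0// [e / 4 * _]mulrC -ler_pdivrMr ?divr_gt0//.
    apply: le_trans (ltW hM) _; rewrite -natrX ler_nat.
    apply: leq_trans (leq_maxr N M) _; rewrite -/m.
    by apply: leq_trans (leqnSn m) (ltnW (ltn_expl _ _)).
  move: h2; rewrite lisum_odd_even => h2.
  move: h1 h2 h3 h4; rewrite mulrBr mulr1; move: (pi ^+ 2 / 8) (lisum N 0) (lisum (2 ^ m) 0).
  move=> p a b; set c := \sum_(_ <= _ < _) _; move: (p / _) (Li 0) => d l; lra.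
by move: U L {p0}; move: (pi ^+ 2) (Li 0) => p l; lra.
Qed.

Lemma Li_cvg0 e : 0 < e -> exists2 d, 0 < d & forall y, 0 <= y <= d -> Li 0 - Li y <= e.
Proof.
move=> e0; have e2 : 0 < e / 2 by rewrite divr_gt0.
have [N hN] := Li_eps (lexx 0) e2.
exists (e / 2 / N.+1%:R); first by rewrite divr_gt0.
move=> y /andP[y0 yd].
have := hN N (leqnn N); have := lisum_leL N y0.
suff : lisum N 0 - lisum N y <= e / 2 by lra.
apply: le_trans (_ : N%:R * y <= _); last first.
  move: yd; rewrite ler_pdivlMr// mulrC; apply: le_trans.
  by rewrite ler_wpM2r// ler_nat.
rewrite /lisum -sumrB -[N in N%:R]subn0 mulr_natl -sumr_const_nat.
apply: ler_sum => n _; rewrite literm0 /literm -{1}[_ ^- 2]mul1r -mulrBl.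
rewrite ler_pdivrMr ?exprn_gt0//.
have h := expR_ge1Dx (- (n.+1%:R * y)).
have h2 : n.+1%:R * y <= y * n.+1%:R ^+ 2.
  by rewrite mulrC ler_wpM2l// expr2 ler_peMl// ler1n.
lra.
Qed.

Definition lgm y : R := - ln (1 - expR (- y)).

Lemma expRN_01 y : 0 < y -> 0 <= expR (- y) < 1.
Proof. by move=> y0; rewrite expR_ge0 expR_lt1 oppr_lt0. Qed.

Lemma lnser_expRE y N : lnser N (expR (- y)) = \sum_(0 <= n < N) expR (- (n.+1%:R * y)) / n.+1%:R.
Proof.
rewrite big_mkord; apply: eq_bigr => i _; congr (_ / _).
by rewrite -expRM_natl mulrN.
Qed.

(** Termwise convexity of the exponential: each difference lies between the tangent slopes at [b]
    and at [a], and these slopes sum to the logarithmic series. *)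
Lemma Li_bracket a b : 0 < a -> a < b ->
  (b - a) * lgm b <= Li a - Li b <= (b - a) * lgm a.
Proof.
move=> a0 ab; have b0 := lt_trans a0 ab; have ba : 0 < b - a by rewrite subr_gt0.
have key N : (b - a) * lnser N (expR (- b)) <= lisum N a - lisum N b <=
    (b - a) * lnser N (expR (- a)).
  rewrite !lnser_expRE /lisum -sumrB !mulr_sumr; apply/andP; split;
    apply: ler_sum => n _; rewrite /literm.
  - have n0 : 0 < n.+1%:R :> R by [].
    have -> : expR (- (n.+1%:R * a)) = expR (- (n.+1%:R * b)) * expR (n.+1%:R * (b - a)).
      by rewrite -expRD; congr expR; ring.
    have h := expR_ge1Dx (n.+1%:R * (b - a)).
    rewrite -mulrBl ler_pdivlMr ?exprn_gt0//.
    have -> : (b - a) * (expR (- (n.+1%:R * b)) / n.+1%:R) * n.+1%:R ^+ 2 =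
      expR (- (n.+1%:R * b)) * (n.+1%:R * (b - a)).
      by field; rewrite gt_eqF.
    by move: h; rewrite -(ler_pM2l (expR_gt0 (- (n.+1%:R * b)))) mulrDr mulr1; lra.
  - have n0 : 0 < n.+1%:R :> R by [].
    have -> : expR (- (n.+1%:R * b)) = expR (- (n.+1%:R * a)) * expR (- (n.+1%:R * (b - a))).
      by rewrite -expRD; congr expR; ring.
    have h := expR_ge1Dx (- (n.+1%:R * (b - a))).
    rewrite -mulrBl ler_pdivrMr ?exprn_gt0//.
    have -> : (b - a) * (expR (- (n.+1%:R * a)) / n.+1%:R) * n.+1%:R ^+ 2 =
      expR (- (n.+1%:R * a)) * (n.+1%:R * (b - a)).
      by field; rewrite gt_eqF.
    by move: h; rewrite -(ler_pM2l (expR_gt0 (- (n.+1%:R * a)))) mulrDr mulr1 mulrN; lra.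
apply/andP; split; apply: le_eps => e e0.
  have e1 : 0 < e / 2 / (b - a) by rewrite !divr_gt0.
  have [N1 h1] := le_lnser_eps (expRN_01 b0) e1.
  have [N2 h2] := Li_eps (ltW b0) (divr_gt0 e0 (ltr0n _ 2)).
  set N := maxn N1 N2.
  have /andP[k1 _] := key N; have k2 := lisum_leL N (ltW a0).
  have k3 := h1 N (leq_maxl _ _); have k4 := h2 N (leq_maxr _ _).
  have k5 : (b - a) * lgm b <= (b - a) * lnser N (expR (- b)) + e / 2.
    by move: k3; rewrite -(ler_pM2l ba) mulrDr mulrCA mulfV ?mulr1// gt_eqF.
  lra.
have [N h] := Li_eps (ltW a0) e0.
have /andP[_ k1] := key N; have k2 := lisum_leL N (ltW b0); have k3 := h N (leqnn N).
have k4 : (b - a) * lnser N (expR (- a)) <= (b - a) * lgm a.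
  by rewrite ler_pM2l//; apply: lnser_le; apply: expRN_01.
lra.
Qed.

(* Caratheodory slope squeezed between the values of [phi]. *)
Lemma dif_bracket (f phi : R -> R) x : 0 < x ->
  (forall a b, 0 < a -> a < b -> (b - a) * phi a <= f b - f a <= (b - a) * phi b) ->
  {for x, continuous phi} -> is_derive x 1 f (phi x).
Proof.
move=> x0 h cp; apply/is_derive1_caratheodory.
pose g z := if z == x then phi x else (f z - f x) / (z - x).
exists g; split; last by rewrite /g eqxx.
  move=> z; rewrite /g; case: eqVneq => [->|zx]; first by rewrite !subrr mulr0.
  by rewrite divfK// subr_eq0.
have gx : g x = phi x by rewrite /g eqxx.
move: cp; rewrite /prop_for /continuous_at gx => /cvgrPdist_le cp; apply/cvgrPdist_le => e e0.
near=> z.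
have : `|phi x - phi z| <= e by near: z; exact: cp.
have z0 : 0 < z.
  near: z; exact: lt_nbhsr.
rewrite /g; case: eqVneq => [_ _|zx]; first by rewrite subrr normr0 ltW.
rewrite !ler_norml => /andP[l u].
have [xz|zx'|/eqP] := ltgtP x z; last by rewrite eq_sym (negbTE zx).
  have d : 0 < z - x by rewrite subr_gt0.
  have /andP[h1 h2] := h _ _ x0 xz.
  have : phi x <= (f z - f x) / (z - x) by rewrite ler_pdivlMr// mulrC.
  have : (f z - f x) / (z - x) <= phi z by rewrite ler_pdivrMr// mulrC.
  by move=> ? ?; apply/andP; split; lra.
have d : 0 < x - z by rewrite subr_gt0.
have /andP[h1 h2] := h _ _ z0 zx'.
have -> : (f z - f x) / (z - x) = (f x - f z) / (x - z).
  by rewrite -[f z - f x]opprB -[z - x]opprB invrN mulrNN.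
have : phi z <= (f x - f z) / (x - z) by rewrite ler_pdivlMr// mulrC.
have : (f x - f z) / (x - z) <= phi x by rewrite ler_pdivrMr// mulrC.
by move=> ? ?; apply/andP; split; lra.
Unshelve. all: by end_near. Qed.

Lemma dif_expRN x : is_derive x 1 (fun y : R => expR (- y)) (- expR (- x)).
Proof. by apply: dif_eq (dif_exp (difN (dif_id x))) _ _ => //; rewrite mulrN mulr1. Qed.

Lemma dif_Li x : 0 < x -> is_derive x 1 Li (- lgm x).
Proof.
move=> x0; apply: (@dif_bracket Li (fun y => - lgm y)) => //.
  move=> a b a0 ab; have /andP[h1 h2] := Li_bracket a0 ab.
  have -> : (b - a) * - lgm a = - ((b - a) * lgm a) by rewrite mulrN.
  have -> : (b - a) * - lgm b = - ((b - a) * lgm b) by rewrite mulrN.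
  by apply/andP; split; lra.
have e1 : 0 < 1 - expR (- x) by rewrite subr_gt0; have /andP[] := expRN_01 x0.
have d := difN (difN (dif_ln (difB (dif_cst 1 x) (dif_expRN x)) e1)).
exact: dif_continuous d.
Qed.

End Dilog.

(** For a goal whose top assumption still has two premises: [apply: apply3] asks for these premises
    first. *)
Lemma apply3 (A B C D : Prop) : A -> B -> (C -> D) -> (A -> B -> C) -> D.
Proof. by move=> a b cd /(_ a b). Qed.

(** * The curve of the rate [g] and the integral of [g] *)

Section Curve.
Variables (R : realType) (k : nat).
Hypothesis k0 : (0 < k)%N.
Implicit Types (v x y a b : R).

Definition geo n v : R := \sum_(i < n) v ^+ i.
Definition wgeo n v : R := \sum_(i < n) (i.+1)%:R * v ^+ i.
Definition wgeo' n v : R := \sum_(i < n) (n - i)%:R * v ^+ i.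

Lemma geoS n v : geo n.+1 v = geo n v + v ^+ n.
Proof. by rewrite /geo big_ord_recr. Qed.

Lemma geoSl n v : geo n.+1 v = 1 + v * geo n v.
Proof.
rewrite /geo big_ord_recl expr0 mulr_sumr; congr (_ + _).
by apply: eq_bigr => i _; rewrite -exprS.
Qed.

Lemma geo_gt0 n v : (0 < n)%N -> 0 <= v -> 0 < geo n v.
Proof.
case: n => // n _ v0; rewrite geoSl ltr_wpDr// mulr_ge0//.
by apply: sumr_ge0 => i _; apply: exprn_ge0.
Qed.

Lemma wgeo'S n v : wgeo' n.+1 v = wgeo' n v + geo n.+1 v.
Proof.
rewrite /wgeo' /geo !big_ord_recr/= subSnn mul1r addrA -big_split/=; congr (_ + _).
by apply: eq_bigr => i _; rewrite subSn ?(ltnW (ltn_ord i))// -natr1 mulrDl mul1r.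
Qed.

Lemma wgeo'E n v : (1 - v) * wgeo' n v = n%:R - v * geo n v.
Proof.
elim: n => [|n IH]; first by rewrite /wgeo' /geo !big_ord0 !mulr0 subrr.
by have e := geoSl n v; rewrite wgeo'S mulrDr IH -(natr1 n) mulrBl mul1r; lra.
Qed.

(** The product of the two geometric sums has coefficients [1, 2, .., n, n, .., 2, 1]. *)
Lemma geo_mulS n v : geo n v * geo n.+1 v = wgeo n v + v ^+ n * wgeo' n v.
Proof.
elim: n => [|n IH]; first by rewrite /wgeo /wgeo' /geo !big_ord0 mul0r mulr0 addr0.
rewrite wgeo'S (geoS n.+1) mulrDr {2}geoS mulrDr [geo n.+1 v * geo n v]mulrC IH.
rewrite {2}/wgeo big_ord_recr/= -/(wgeo n v) exprS -!addrA; congr (_ + _).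
have := wgeo'E n v; rewrite -(natr1 n) (geoSl n) => e.
have -> : v ^+ n * wgeo' n v = v ^+ n * (v * wgeo' n v + n%:R - v * geo n v).
  by congr (_ * _); lra.
by ring.
Qed.

(* The value of [- hh'] at [y], in terms of [v = exp (- y)]. *)
Definition rate v := v ^+ k * wgeo' k v / (geo k v * geo k.+1 v).

Lemma wgeo_gt0 v : 0 <= v -> 0 < wgeo k v.
Proof.
move=> v0; case: k k0 => // n _; rewrite /wgeo big_ord_recl expr0 mulr1 ltr_wpDr//.
by apply: sumr_ge0 => i _; rewrite mulr_ge0// exprn_ge0.
Qed.

Lemma wgeo'_gt0 v : 0 <= v -> 0 < wgeo' k v.
Proof.
move=> v0; case: k k0 => // n _; rewrite /wgeo' big_ord_recl expr0 mulr1 ltr_wpDr//.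
by apply: sumr_ge0 => i _; rewrite mulr_ge0// exprn_ge0.
Qed.

Lemma rate_gt0 v : 0 < v -> 0 < rate v.
Proof.
move=> v0; rewrite /rate divr_gt0// mulr_gt0 ?exprn_gt0 ?wgeo'_gt0 ?geo_gt0 ?ltW//.
Qed.

Lemma rate_lt1 v : 0 < v -> rate v < 1.
Proof.
move=> v0; rewrite /rate ltr_pdivrMr ?mulr_gt0 ?geo_gt0 ?(ltW v0)// mul1r geo_mulS.
by rewrite ltrDr wgeo_gt0// ltW.
Qed.

(** By [geo_mulS], [rate v = B / (A + B)] with [A = wgeo k v] and [B = v^k * wgeo' k v].
    Cross-multiplying cancels the product of the two [B], and the rest compares monomials:
    [x^(k+i) y^j <= y^(k+i) x^j], as [j < k]. *)
Lemma rate_mono x y : 0 < x -> x <= y -> rate x <= rate y.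
Proof.
move=> x0 xy; have y0 := lt_le_trans x0 xy.
rewrite /rate ler_pdivrMr ?mulr_gt0 ?geo_gt0 ?(ltW x0)// mulrAC ler_pdivlMr; last first.
  by rewrite ?mulr_gt0 ?geo_gt0 ?(ltW y0).
rewrite !geo_mulS !mulrDr [X in _ <= _ + X]mulrC lerD2r.
rewrite -!mulrA /wgeo /wgeo' !mulr_suml !mulr_sumr; apply: ler_sum => i _.
rewrite !mulr_sumr; apply: ler_sum => j _.
have -> : x ^+ k * ((k - i)%:R * x ^+ i * (j.+1%:R * y ^+ j)) =
  ((k - i)%:R * j.+1%:R) * (x ^+ (k + i) * y ^+ j) by rewrite exprD; ring.
have -> : y ^+ k * ((k - i)%:R * y ^+ i * (j.+1%:R * x ^+ j)) =
  ((k - i)%:R * j.+1%:R) * (y ^+ (k + i) * x ^+ j) by rewrite exprD; ring.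
rewrite ler_wpM2l ?mulr_ge0//.
have -> : (k + i = (k + i - j) + j)%N by rewrite subnK// ltnW// ltn_addr.
rewrite !exprD -!mulrA [y ^+ j * x ^+ j]mulrC ler_wpM2r//.
  by rewrite mulr_ge0// exprn_ge0// ltW.
by rewrite lerXn2r// nnegrE ltW.
Qed.

Definition hh y : R := ln (geo k.+1 (expR (- y))) - ln (geo k (expR (- y))).
Definition dhh y : R := - rate (expR (- y)).

Let vp y : 0 < expR (- y) := expR_gt0 _.
Let gp y n : (0 < n)%N -> 0 < geo n (expR (- y)).
Proof. by move=> n0; rewrite geo_gt0// ltW. Qed.

Lemma dif_geo_exp n y : is_derive y 1 (fun x => geo n (expR (- x)))
  (- \sum_(i < n) i%:R * expR (- y) ^+ i).
Proof.
rewrite -sumrN; apply: (@dif_sum R n (fun i x => expR (- x) ^+ i)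
   (fun i => - (i%:R * expR (- y) ^+ i))) => i.
apply: dif_eq (dif_comp (dif_expRN y) (dif_pow i _)) _ _ => //.
by case: i => [|i]; rewrite ?mul0r ?oppr0// mulrN -mulrA -exprSr.
Qed.

Lemma dif_hh y : is_derive y 1 hh (dhh y).
Proof.
have v0 := vp y; have d n (n0 : (0 < n)%N) := dif_ln (dif_geo_exp n y) (gp y n0).
apply: dif_eq (difB (d k.+1 isT) (d k k0)) _ _ => //.
rewrite /dhh /rate; have := gp y k0; have := gp y (ltn0Sn k).
set v := expR (- y); set dk := \sum_(i < k) _ => p1 p2.
rewrite big_ord_recr/= -/dk.
have -> : wgeo' k v = k%:R * geo k v - dk.
  rewrite /wgeo' /geo /dk mulr_sumr -sumrB; apply: eq_bigr => i _.
  by rewrite natrB ?mulrBl// ltnW.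
move: p1 p2; rewrite geoS; move: (geo k v) => p p1 p2.
by field; rewrite !gt_eqF.
Qed.

Lemma hhE y : hh y = ln (1 + expR (- y) ^+ k / geo k (expR (- y))).
Proof.
have h := gp y k0.
rewrite /hh -ln_div ?posrE ?gp// geoS; congr ln; rewrite mulrDl divff// gt_eqF//.
Qed.

Lemma hh_gt0 y : 0 < hh y.
Proof. by rewrite hhE ln_gt0// ltrDl divr_gt0 ?gp ?exprn_gt0. Qed.

Lemma geo_inv n v : 0 < v -> geo n.+1 v^-1 * v ^+ n = geo n.+1 v.
Proof.
move=> v0; rewrite /geo mulr_suml (reindex_inj rev_ord_inj)/=; apply: eq_bigr => -[i /= iN] _.
rewrite subSS; rewrite ltnS in iN.
rewrite -{2}(subnK iN) exprD exprVn mulrA mulVf ?mul1r// expf_neq0// gt_eqF//.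
Qed.

(** Geometric sums are palindromic, and the two degrees differ by 1. This is why [z - g z = y] along
    the curve [z = hh (- y)], [g z = hh y]. *)
Lemma hh_sym y : hh (- y) = y + hh y.
Proof.
have v0 := vp y; rewrite /hh (expRN (- y)).
have i n : ln (geo n.+1 (expR (- y))^-1) = ln (geo n.+1 (expR (- y))) + n%:R * y.
  rewrite -[in RHS](geo_inv n v0) lnM ?posrE ?exprn_gt0 ?geo_gt0 ?invr_ge0 ?(ltW v0)//.
  by rewrite -addrA -expRM_natl mulrN expRK addNr addr0.
have [m ->] : exists m, k = m.+1 by case: k k0 => // m _; exists m.
by rewrite !i -(natr1 m) mulrDl mul1r; lra.
Qed.

Lemma dhh_bounds y : -1 < dhh y < 0.
Proof. by rewrite /dhh ltrN2 oppr_lt0 rate_gt0 ?rate_lt1. Qed.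

Lemma dhh_mono x y : x <= y -> dhh x <= dhh y.
Proof. by move=> xy; rewrite /dhh lerN2 rate_mono// ler_expR lerN2. Qed.

Lemma hh_decr x y : x < y -> hh y < hh x.
Proof.
move=> xy; have [c [_ hc]] := mvt xy (fun t _ => dif_hh t).
have /andP[_ h] := dhh_bounds c.
by rewrite -subr_lt0 hc pmulr_llt0 ?subr_gt0.
Qed.

Lemma hh_le x y : x <= y -> hh y <= hh x.
Proof. by rewrite le_eqVlt => /predU1P[->//|/hh_decr/ltW]. Qed.

Lemma hh_lip x y : x <= y -> hh x - hh y <= y - x.
Proof.
move=> xy; have : hh (- x) <= hh (- y) by apply: hh_le; rewrite lerN2.
by rewrite !hh_sym; lra.
Qed.

Lemma hh_tangent x y : hh y + (x - y) * dhh y <= hh x.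
Proof.
have [xy|xy|->] := ltgtP x y; last by rewrite subrr mul0r addr0.
- have [c [/andP[_ cy] hc]] := mvt xy (fun t _ => dif_hh t).
  have : dhh c * (y - x) <= dhh y * (y - x).
    by rewrite ler_wpM2r ?dhh_mono ?subr_ge0 ?ltW.
  by move: hc; lra.
- have [c [/andP[yc _] hc]] := mvt xy (fun t _ => dif_hh t).
  have : dhh y * (x - y) <= dhh c * (x - y).
    by rewrite ler_wpM2r ?dhh_mono ?subr_ge0 ?ltW.
  by move: hc; lra.
Qed.

Lemma hh_convex a x b : a <= x <= b -> (b - a) * hh x <= (b - x) * hh a + (x - a) * hh b.
Proof.
move=> /andP[ax xb]; have h1 := hh_tangent a x; have h2 := hh_tangent b x.
have := ler_wpM2l (_ : 0 <= b - x) h1; have := ler_wpM2l (_ : 0 <= x - a) h2.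
rewrite !subr_ge0 => /(_ ax) e1 /(_ xb) e2.
by move: (lerD e1 e2); move: (dhh x) => d; lra.
Qed.

Lemma hh_le_exp y : 0 <= y -> hh y <= expR (- y).
Proof.
move=> y0; have v1 : expR (- y) <= 1 by rewrite expR_le1 oppr_le0.
rewrite hhE; apply: le_trans (le_ln1Dx _) _.
  by apply: lt_le_trans (_ : 0 <= _); rewrite ?divr_ge0 ?exprn_ge0 ?ltW ?gp// ltrN10.
rewrite ler_pdivrMr ?gp//; apply: le_trans (_ : expR (- y) ^+ k <= _).
  by [].
apply: le_trans (_ : expR (- y) <= _).
  by rewrite -[leRHS]expr1 ler_wiXn2l// ltW.
rewrite ler_peMr ?(ltW (vp y))//; case: k k0 => // n _.
by rewrite geoSl lerDl mulr_ge0 ?(ltW (vp y))// sumr_ge0// => i _; rewrite exprn_ge0// ltW.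
Qed.

Lemma hh_surj z : 0 < z -> exists y, hh (- y) = z.
Proof.
move=> z0.
pose b := Num.max 0 (- ln z).
have bz : hh b <= z.
  apply: le_trans (hh_le_exp _) _; first by rewrite le_max lexx.
  rewrite -[leRHS]lnK ?posrE// ler_expR lerNl le_max lexx orbT//.
have zb : z <= hh (- z) by rewrite hh_sym lerDl ltW// hh_gt0.
have zb' : - z <= b by rewrite le_max oppr_le0 ltW.
have ct : {within `[- z, b], continuous hh}.
  by apply: derivable_within_continuous => x _; have [] := dif_hh x.
have zz : Num.min (hh (- z)) (hh b) <= z <= Num.max (hh (- z)) (hh b).
  by rewrite ge_min le_max bz zb orbT.
by have [c _ hc] := IVT zb' ct zz; exists (- c); rewrite opprK.
Qed.

(* [hh (- y)] is increasing in [y], so that [y] is determined by [z]. *)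
Definition g z : R := hh (get [set y | hh (- y) = z]).

Lemma g_spec z : 0 < z -> exists2 y, hh (- y) = z & g z = hh y.
Proof.
move=> z0; have [y hy] := hh_surj z0.
by exists (get [set y | hh (- y) = z]) => //; apply: (getPex (P := [set y | hh (- y) = z])); exists y.
Qed.

Lemma hh_opp_le x y : (hh (- x) <= hh (- y)) = (x <= y).
Proof.
have [xy|xy] := leP x y; first by rewrite hh_le// lerN2.
by apply/negbTE; rewrite -ltNge hh_decr// ltrN2.
Qed.

Lemma g_gt0 z : 0 < z -> 0 < g z.
Proof. by move=> /g_spec[y _ ->]; apply: hh_gt0. Qed.

Lemma g_decr z z' : 0 < z -> z <= z' -> g z' <= g z.
Proof.
move=> z0 zz'; have [y' e' ->] := g_spec (lt_le_trans z0 zz'); have [y e ->] := g_spec z0.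
by apply: hh_le; rewrite -hh_opp_le e e'.
Qed.

(* Along the curve [z = hh (- y)], [g = hh y], one has [g = z - y] with [z] convex and
   increasing in [y]. *)
Lemma g_convex a z b : 0 < a -> a <= z <= b ->
  (b - a) * g z <= (b - z) * g a + (z - a) * g b.
Proof.
move=> a0 /andP[az zb]; have z0 := lt_le_trans a0 az; have b0 := lt_le_trans z0 zb.
have [ya ea ->] := g_spec a0; have [yz ez ->] := g_spec z0; have [yb eb ->] := g_spec b0.
have lab : ya <= yb by rewrite -hh_opp_le ea eb (le_trans az).
have [ab|ab] := eqVneq a b.
  have -> : z = a by apply/eqP; rewrite eq_le az ab zb.
  by rewrite ab !subrr !mul0r addr0.
have dab : 0 < b - a by rewrite subr_gt0 lt_neqAle ab (le_trans az).
pose s := (z - a) / (b - a).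
have s0 : 0 <= s by apply: divr_ge0; [rewrite subr_ge0|exact: ltW].
have s1 : s <= 1 by rewrite ler_pdivrMr// mul1r lerD2r.
have zs : z = a + s * (b - a) by rewrite /s divfK ?gt_eqF//; lra.
pose w := ya + s * (yb - ya).
have hw : hh (- w) <= (1 - s) * a + s * b.
  have [e|ne] := eqVneq ya yb.
    have -> : w = ya by rewrite /w e subrr mulr0 addr0.
    by rewrite ea; have : s * a <= s * b; [rewrite ler_wpM2l// (le_trans az)|lra].
  have dy : 0 < yb - ya by rewrite subr_gt0 lt_neqAle ne.
  have /hh_convex : - yb <= - w <= - ya.
    have : s * (yb - ya) <= yb - ya by rewrite ler_piMl// ltW.
    have : 0 <= s * (yb - ya) by rewrite mulr_ge0// ltW.
    by rewrite /w => ? ?; apply/andP; split; lra.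
  rewrite ea eb.
  have -> : - ya - - yb = yb - ya by lra.
  have -> : (- ya - - w) * b + (- w - - yb) * a = (yb - ya) * ((1 - s) * a + s * b).
    by rewrite /w; ring.
  by rewrite ler_pM2l.
have wy : w <= yz by rewrite -hh_opp_le ez; move: hw; rewrite zs; lra.
have g' y : hh y = hh (- y) - y by rewrite hh_sym; lra.
rewrite (g' ya) (g' yb) (g' yz) ea eb ez.
have -> : (b - z) * (a - ya) + (z - a) * (b - yb) = (b - a) * (z - w).
  by rewrite /w zs; ring.
by rewrite ler_pM2l//; lra.
Qed.

(** With [v = exp (- y)], the curve gives [exp (- z) = v / exp (g z)] and
    [1 - exp (- z) = 1 / geo k.+1 v], so the [j]-th term is [v^j / geo k v]. *)
Lemma g_char z : 0 < z ->
  \sum_(j < k) (1 - expR (- z)) * expR (- z) ^+ j * expR (g z) ^+ j.+1 = 1.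
Proof.
move=> z0; have [y ez ->] := g_spec z0.
have p0 := gp y k0; have p1 := gp y (ltn0Sn k); have v0 := vp y.
have et : expR (hh y) = geo k.+1 (expR (- y)) / geo k (expR (- y)).
  by rewrite /hh expRB !lnK ?posrE.
have eu : expR (- z) = expR (- y) / expR (hh y).
  by rewrite -ez hh_sym -expRB; congr expR; lra.
have t0 := expR_gt0 (hh y).
have e1 : 1 - expR (- z) = (geo k.+1 (expR (- y)))^-1.
  by rewrite eu et geoSl; field; rewrite -geoSl !gt_eqF.
transitivity (\sum_(j < k) (geo k (expR (- y)))^-1 * expR (- y) ^+ j).
  apply: eq_bigr => j _; rewrite e1 eu expr_div_n exprS.
  move: (expR (hh y)) t0 et => t t0 et.
  have -> : geo k.+1 (expR (- y)) = t * geo k (expR (- y)) by rewrite et divfK ?gt_eqF.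
  have tj : 0 < t ^+ j by rewrite exprn_gt0.
  move: (geo k _) p0 (t ^+ j) tj (expR (- y) ^+ j) => p p0 q q0 w.
  by field; rewrite !gt_eqF.
by rewrite -mulr_sumr -/(geo k _) mulVf// gt_eqF.
Qed.

Lemma g_le_ln z : 0 < z -> g z <= - ln (1 - expR (- z)).
Proof.
move=> z0; have u1 : 0 < 1 - expR (- z) by rewrite subr_gt0; have /andP[] := expRN_01 z0.
have h : (1 - expR (- z)) * expR (g z) <= 1.
  rewrite -[leRHS](g_char z0) (bigD1 (Ordinal k0))//= expr0 mulr1 expr1 lerDl.
  by apply: sumr_ge0 => i _; rewrite !mulr_ge0 ?exprn_ge0 ?expR_ge0// ltW.
rewrite -lnV ?posrE// -(expRK (g z)) ler_ln ?posrE ?expR_gt0 ?invr_gt0//.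
by rewrite -[leRHS]mul1r ler_pdivlMr// mulrC.
Qed.

(* [HH0] and, on the whole line, [HH] are primitives of [- hh]. *)
Definition HH0 y : R := Li (k%:R * y) / k%:R - Li (k.+1%:R * y) / k.+1%:R.

Let kp : 0 < k%:R :> R. Proof. by rewrite ltr0n. Qed.
Let kp1 : 0 < k.+1%:R :> R. Proof. by []. Qed.

Lemma hh_lgm y : 0 < y -> hh y = lgm (k%:R * y) - lgm (k.+1%:R * y).
Proof.
move=> y0; have v1 : 0 < 1 - expR (- y) by rewrite subr_gt0; have /andP[] := expRN_01 y0.
have e n : (0 < n)%N -> ln (1 - expR (- (n%:R * y))) = ln (1 - expR (- y)) + ln (geo n (expR (- y))).
  move=> n0; rewrite -lnM ?posrE ?gp//; congr ln.
  rewrite -mulrN expRM_natl -[LHS]opprB subrX1 -mulNr opprB /geo.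
  by congr (_ * _).
by rewrite /lgm /hh (e k k0) (e k.+1 isT); lra.
Qed.

Lemma dif_HH0 y : 0 < y -> is_derive y 1 HH0 (- hh y).
Proof.
move=> y0; rewrite hh_lgm//.
have d n : (0 < n)%N -> is_derive y 1 (fun x => Li (n%:R * x) / n%:R) (- lgm (n%:R * y)).
  move=> n0; have np : 0 < n%:R :> R by rewrite ltr0n.
  have l1 := dif_comp (difMl n%:R (dif_id y)) (dif_Li (mulr_gt0 np y0)).
  apply: dif_eq (difM l1 (dif_cst n%:R^-1 y)) _ _ => //.
  by rewrite mulr0 addr0 mulr1 mulfK// gt_eqF.
by apply: dif_eq (difB (d k k0) (d k.+1 isT)) _ _ => //; rewrite opprB addrC opprK.
Qed.

Lemma HH0_cvg e : 0 < e -> exists2 d, 0 < d & forall y, 0 <= y <= d -> `|HH0 0 - HH0 y| <= e.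
Proof.
move=> e0; have [d d0 hd] := @Li_cvg0 R _ e0.
exists (d / k.+1%:R); first by rewrite divr_gt0.
move=> y /andP[y0]; rewrite ler_pdivlMr// mulrC => yd; rewrite /HH0 !mulr0.
have h n : (0 < n <= k.+1)%N -> 0 <= Li (0 : R) / n%:R - Li (n%:R * y) / n%:R <= e.
  move=> /andP[n0 nk]; have np : 0 < n%:R :> R by rewrite ltr0n.
  have ny : 0 <= n%:R * y by rewrite mulr_ge0.
  have nd : n%:R * y <= d by apply: le_trans yd; rewrite ler_wpM2r// ler_nat.
  rewrite -mulrBl divr_ge0 ?subr_ge0 ?Li_le0//=.
  rewrite ler_pdivrMr//; apply: le_trans (hd _ _) _; first by rewrite ny.
  by rewrite ler_peMr ?(ltW e0)// ler1n.
have /andP[a1 a2] := h k ltac:(by rewrite k0 leqnSn).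
have /andP[b1 b2] := h k.+1 (leqnn _).
have aux (p q r s t : R) : 0 <= p - q -> p - q <= t -> 0 <= r - s -> r - s <= t ->
  `|p - r - (q - s)| <= t by move=> *; rewrite ler_norml; apply/andP; split; lra.
exact: aux.
Qed.

Lemma HH0_upper0 a b : 0 < a -> a <= b -> HH0 a - HH0 b <= (b - a) * ((hh a + hh b) / 2).
Proof.
move=> a0 ab.
have := @dif_ge0_le R (fun y => (y - a) * ((hh a + hh y) / 2) + HH0 y)
  (fun y => (1 - 0) * ((hh a + hh y) / 2) + (y - a) * ((0 + dhh y) * 2^-1 + (hh a + hh y) * 0)
     + - hh y) a b ab.
rewrite subrr mul0r add0r; apply: apply3.
- move=> x /andP[ax xb].
  have d1 := difM (difD (dif_cst (hh a) x) (dif_hh x)) (dif_cst 2^-1 x).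
  have d2 := difM (difB (dif_id x) (dif_cst a x)) d1.
  exact: difD d2 (dif_HH0 (lt_le_trans a0 ax)).
- move=> x _; have := hh_tangent a x.
  by move: (hh a) (hh x) (dhh x) => p q r; lra.
- by lra.
Qed.

(** Since [hh] decreases with slope at least [-1], the area above the rectangle contains a triangle
    with both legs [hh a - hh b]. The triangle is what the term [hh^2 / 2] of [TT] asks for in
    [GG_rectangle]. *)
Lemma HH0_lower0 a b : 0 < a -> a <= b ->
  (b - a) * hh b + (hh a - hh b) ^+ 2 / 2 <= HH0 a - HH0 b.
Proof.
move=> a0 ab.
have := @dif_ge0_le R (fun y => - HH0 y - (y - a) * hh y - ((hh a - hh y) * (hh a - hh y)) / 2)
  (fun y => - - hh y - ((1 - 0) * hh y + (y - a) * dhh y)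
    - (((0 - dhh y) * (hh a - hh y) + (hh a - hh y) * (0 - dhh y)) * 2^-1
       + (hh a - hh y) * (hh a - hh y) * 0)) a b ab.
apply: apply3.
- move=> x /andP[ax xb]; have dd := difB (dif_cst (hh a) x) (dif_hh x).
  have d1 := difM (difB (dif_id x) (dif_cst a x)) (dif_hh x).
  have d2 := difB (difN (dif_HH0 (lt_le_trans a0 ax))) d1.
  exact: difB d2 (difM (difM dd dd) (dif_cst 2^-1 x)).
- move=> x /andP[ax _]; have := hh_lip ax; have /andP[_ d0] := dhh_bounds x.
  rewrite -subr_ge0 => h.
  have : 0 <= - dhh x * (x - a - (hh a - hh x)) by rewrite mulr_ge0 ?oppr_ge0// ltW.
  by move: (hh a) (hh x) (dhh x) => p q r; lra.
- by rewrite expr2; lra.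
Qed.

(** The derivative of [Li] is known for positive arguments only, so the endpoint 0 is reached by
    continuity. *)
Lemma HH0_upper a b : 0 <= a -> a <= b -> HH0 a - HH0 b <= (b - a) * ((hh a + hh b) / 2).
Proof.
rewrite le_eqVlt => /predU1P[<-{a} b0|]; last exact: HH0_upper0.
have [->|bn0] := eqVneq b 0; first by rewrite !subrr mul0r.
have bp : 0 < b by rewrite lt_neqAle eq_sym bn0.
apply: le_eps => e e0; have [d d0 hd] := HH0_cvg e0.
pose a := Num.min d b; have a0 : 0 < a by rewrite lt_min d0.
have ab : a <= b by rewrite ge_min lexx orbT.
have := hd a; rewrite (ltW a0) ge_min lexx/= => /(_ isT); rewrite ler_norml => /andP[_ h1].
have h2 := HH0_upper0 a0 ab; have h3 := hh_le (ltW a0).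
have : (b - a) * ((hh a + hh b) / 2) <= (b - 0) * ((hh 0 + hh b) / 2).
  apply: ler_pM; rewrite ?subr_ge0//; last by lra.
    by rewrite divr_ge0// addr_ge0// ltW// hh_gt0.
  by rewrite lerD2l lerN2 ltW.
lra.
Qed.

Lemma HH0_lower a b : 0 <= a -> a <= b ->
  (b - a) * hh b + (hh a - hh b) ^+ 2 / 2 <= HH0 a - HH0 b.
Proof.
rewrite le_eqVlt => /predU1P[<-{a} b0|]; last exact: HH0_lower0.
have [->|bn0] := eqVneq b 0; first by rewrite !subrr mul0r expr0n/= mul0r addr0.
have bp : 0 < b by rewrite lt_neqAle eq_sym bn0.
apply: le_eps => e e0.
pose c := 1 + hh b + hh 0; have c0 : 0 < c by have := hh_gt0 b; have := hh_gt0 0; rewrite /c; lra.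
have e2 : 0 < e / 2 by rewrite divr_gt0.
have [d d0 hd] := HH0_cvg e2.
pose a := Num.min (Num.min d b) (e / 2 / c).
have a0 : 0 < a by rewrite !lt_min d0 bp divr_gt0.
have ab : a <= b by rewrite !ge_min lexx orbT.
have ad : a <= d by rewrite !ge_min lexx.
have ac : a * c <= e / 2 by rewrite -ler_pdivlMr// ge_min lexx orbT.
have := hd a; rewrite (ltW a0) ad => /(_ isT); rewrite ler_norml => /andP[h1 _].
have h2 := HH0_lower0 a0 ab; have h3 := hh_le (ltW a0); have h4 := hh_lip (ltW a0).
have h5 := hh_le ab; have h6 := hh_gt0 b.
have h7 := hh_gt0 0.
move: h1 h2 h3 h4 h5 h6 h7 a0 ab ac; rewrite /c.
move: (hh a) (hh b) (hh 0) (HH0 0) (HH0 a) (HH0 b) => ha hb h0 X0 Xa Xb.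
clearbody a; clear -R; move=> h1 h2 h3 h4 h5 h6 h7 a0 ab ac.
have p1 : (h0 - ha) * ((h0 - hb) + (ha - hb)) <= a * (h0 + h0) by apply: ler_pM; lra.
rewrite !expr2 in h2 *; lra.
Qed.

(** For negative [y] this integrates [- hh y = y - hh (- y)], which is [hh_sym]; the constant makes
    the two halves agree at 0. *)
Definition HH y : R := if 0 <= y then HH0 y else 2 * HH0 0 + y ^+ 2 / 2 - HH0 (- y).

Lemma HH_upper a b : a <= b -> HH a - HH b <= (b - a) * ((hh a + hh b) / 2).
Proof.
have pos x y : 0 <= x -> x <= y -> HH x - HH y <= (y - x) * ((hh x + hh y) / 2).
  by move=> x0 xy; rewrite /HH x0 (le_trans x0 xy); apply: HH0_upper.
have HHneg x : x <= 0 -> HH x = 2 * HH0 0 + x ^+ 2 / 2 - HH0 (- x).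
  rewrite /HH; case: (leP 0 x) => // x0 x0'.
  have -> : x = 0 by apply/eqP; rewrite eq_le x0 x0'.
  by rewrite oppr0 expr0n/= mul0r; lra.
have neg x y : x <= y -> y <= 0 -> HH x - HH y <= (y - x) * ((hh x + hh y) / 2).
  move=> xy y0; rewrite !HHneg// ?(le_trans xy)//.
  have := @HH0_upper (- y) (- x); rewrite oppr_ge0 lerN2 => /(_ y0 xy).
  rewrite !hh_sym; move: (HH0 0) (HH0 _) (HH0 _) (hh x) (hh y) => p q r s t; rewrite !expr2.
  by clear; lra.
move=> ab; have [a0|a0] := leP 0 a; first exact: pos.
have [b0|b0] := leP b 0; first exact: neg.
have h1 := neg a 0 (ltW a0) (lexx _); have h2 := pos 0 b (lexx _) (ltW b0).
have h3 : a <= 0 <= b by rewrite !ltW.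
have := hh_convex h3; move: h1 h2; rewrite !sub0r !subr0.
by move: (HH a) (HH b) (HH 0) (hh a) (hh b) (hh 0) => p q r s t u; clear; lra.
Qed.

Lemma HH_lower a b : a <= b -> (b - a) * hh b + (hh a - hh b) ^+ 2 / 2 <= HH a - HH b.
Proof.
have pos x y : 0 <= x -> x <= y -> (y - x) * hh y + (hh x - hh y) ^+ 2 / 2 <= HH x - HH y.
  by move=> x0 xy; rewrite /HH x0 (le_trans x0 xy); apply: HH0_lower.
have HHneg x : x <= 0 -> HH x = 2 * HH0 0 + x ^+ 2 / 2 - HH0 (- x).
  rewrite /HH; case: (leP 0 x) => // x0 x0'.
  have -> : x = 0 by apply/eqP; rewrite eq_le x0 x0'.
  by rewrite oppr0 expr0n/= mul0r; lra.
have neg x y : x <= y -> y <= 0 -> (y - x) * hh y + (hh x - hh y) ^+ 2 / 2 <= HH x - HH y.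
  move=> xy y0; rewrite !HHneg// ?(le_trans xy)//.
  have := @HH0_lower (- y) (- x); rewrite oppr_ge0 lerN2 => /(_ y0 xy).
  rewrite !hh_sym; move: (HH0 0) (HH0 _) (HH0 _) (hh x) (hh y) => p q r s t; rewrite !expr2.
  by clear; lra.
move=> ab; have [a0|a0] := leP 0 a; first exact: pos.
have [b0|b0] := leP b 0; first exact: neg.
have h1 := neg a 0 (ltW a0) (lexx _); have h2 := pos 0 b (lexx _) (ltW b0).
have h4 := hh_le (ltW a0); have h5 := hh_le (ltW b0).
have h6 := hh_lip (ltW a0).
have h7 : 0 <= (hh 0 - hh b) * ((0 - a) - (hh a - hh 0)) by rewrite mulr_ge0// subr_ge0.
move: h1 h2 h7; rewrite !expr2.
by move: (HH a) (HH b) (HH 0) (hh a) (hh b) (hh 0) => p q r s t u; clear; lra.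
Qed.

Definition lam : R := 2 * HH0 0.

Lemma lamE : lam = pi ^+ 2 / (3 * k%:R * (k%:R + 1)).
Proof.
rewrite /lam /HH0 !mulr0 Li_0 -natr1; move: (pi ^+ 2) => p; field.
by rewrite !gt_eqF// natr1.
Qed.

(** Along the curve [z = y + hh y], so [g dz = hh dy + hh dhh], which integrates to
    [- HH + hh^2 / 2]. *)
Definition TT y : R := HH y - hh y ^+ 2 / 2.
(* The integral of [g] from [0] to [z], computed along the curve parametrised by [y]. *)
Definition GG z : R := lam - TT (get [set y | hh (- y) = z]).

Lemma GG_spec z : 0 < z -> exists y, [/\ hh (- y) = z, g z = hh y & GG z = lam - TT y].
Proof.
move=> z0; have [y hy] := hh_surj z0.
by exists (get [set y | hh (- y) = z]); split=> //;
  apply: (getPex (P := [set y | hh (- y) = z])); exists y.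
Qed.

Lemma GG_trapezoid z z' : 0 < z -> z <= z' ->
  GG z' - GG z <= (z' - z) * ((g z + g z') / 2).
Proof.
move=> z0 zz'; have [y [e -> ->]] := GG_spec z0.
have [y' [e' -> ->]] := GG_spec (lt_le_trans z0 zz').
have yy' : y <= y' by rewrite -hh_opp_le e e'.
have := HH_upper yy'; move: e e'; rewrite !hh_sym => <- <-; rewrite /TT !expr2.
by move: (HH y) (HH y') (hh y) (hh y') => p q r s; clear; lra.
Qed.

Lemma GG_rectangle z z' : 0 < z -> z <= z' -> (z' - z) * g z' <= GG z' - GG z.
Proof.
move=> z0 zz'; have [y' [e' -> ->]] := GG_spec (lt_le_trans z0 zz').
have [y [e _ ->]] := GG_spec z0.
have yy' : y <= y' by rewrite -hh_opp_le e e'.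
have := HH_lower yy'; move: e e'; rewrite !hh_sym => <- <-; rewrite /TT !expr2.
by move: (HH y) (HH y') (hh y) (hh y') => p q r s; clear; lra.
Qed.

Lemma GG_mono z z' : 0 < z -> z <= z' -> GG z <= GG z'.
Proof.
move=> z0 zz'; rewrite -subr_ge0; apply: le_trans (GG_rectangle z0 zz').
apply: mulr_ge0; first by rewrite subr_ge0.
exact: ltW (g_gt0 (lt_le_trans z0 zz')).
Qed.

Lemma HH0_bounds y : 0 <= y -> - (2 * expR (- y)) <= HH0 y <= 2 * expR (- (k%:R * y)).
Proof.
move=> y0; rewrite /HH0.
have h n : (0 < n)%N -> 0 <= Li (n%:R * y) / n%:R <= 2 * expR (- (n%:R * y)).
  move=> n0; have np : 0 < n%:R :> R by rewrite ltr0n.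
  have ny : 0 <= n%:R * y by rewrite mulr_ge0.
  rewrite divr_ge0 ?Li_ge0//= ler_pdivrMr//.
  apply: le_trans (Li_decay ny) _; by rewrite mulrC ler_peMr ?ler1n// mulr_ge0// expR_ge0.
have /andP[h1 h2] := h k k0; have /andP[h3 h4] := h k.+1 isT.
have h5 : expR (- (k.+1%:R * y)) <= expR (- y).
  by rewrite ler_expR lerN2 ler_peMl// ler1n.
have aux (p q r s t : R) : 0 <= p -> p <= 2 * r -> 0 <= q -> q <= 2 * s -> s <= t ->
  - (2 * t) <= p - q <= 2 * r by move=> *; apply/andP; split; lra.
exact: aux h5.
Qed.

Lemma hh0_le1 : hh 0 <= 1.
Proof. by have := hh_le_exp (lexx 0); rewrite oppr0 expR0. Qed.

Lemma exp_small e : 0 < e -> exists2 M : R, 0 < M & forall y, M <= y -> expR (- y) <= e.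
Proof.
move=> e0; exists (Num.max 1 (- ln e)); first by rewrite lt_max ltr01.
by move=> y; rewrite ge_max => /andP[_ h]; rewrite -[leRHS]lnK ?posrE// ler_expR lerNl.
Qed.

(** [GG] is monotone, and [TT y] tends to 0 as [y] grows. *)
Lemma GG_le_lam z : 0 < z -> GG z <= lam.
Proof.
move=> z0; apply: le_eps => e e0.
have e3 : 0 < e / 3 by rewrite divr_gt0.
have [M M0 hM] := exp_small e3.
pose z' := Num.max z (hh (- M)); have zz' : z <= z' by rewrite le_max lexx.
apply: le_trans (GG_mono z0 zz') _.
have [y [ey _ ->]] := GG_spec (lt_le_trans z0 zz').
have My : M <= y by rewrite -hh_opp_le ey le_max lexx orbT.
have y0 : 0 <= y by apply: le_trans My; apply: ltW.
have /andP[l _] := HH0_bounds y0; have hu := hh_le_exp y0; have hp := hh_gt0 y.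
have h1 := hM _ My; have h2 : hh y * hh y <= expR (- y) * 1.
  apply: ler_pM => //; try exact: ltW.
  by apply: le_trans hu _; rewrite expR_le1 oppr_le0.
rewrite /TT /HH y0 expr2.
by move: h1 h2 l; move: (HH0 y) (hh y * hh y) (expR (- y)) lam => p q r s; lra.
Qed.

(** All three terms vanish as [a] grows, which is why [lam] is the right constant for [GG] to vanish
    at 0. *)
Lemma GG_neg a : 0 <= a -> lam - TT (- a) = HH0 a + a * hh a + hh a ^+ 2 / 2.
Proof.
move=> a0; rewrite /TT hh_sym !expr2 /HH /lam oppr_ge0 opprK.
case: (leP a 0) => a0'; last by rewrite !expr2; move: (HH0 0) (HH0 a) (hh a) => p q r; lra.
have -> : a = 0 by apply/eqP; rewrite eq_le a0 a0'.
by rewrite oppr0; move: (HH0 0) (hh 0) => p q; lra.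
Qed.

Lemma GG_ge0 z : 0 < z -> 0 <= GG z.
Proof.
move=> z0; apply: le_eps => e e0.
have e3 : 0 < e / 2 by rewrite divr_gt0.
have [M M0 hM] := exp_small e3.
pose z' := Num.min z (hh M).
have z0' : 0 < z' by rewrite lt_min z0 hh_gt0.
have zz' : z' <= z by rewrite ge_min lexx.
apply: le_trans (_ : GG z' + e <= _); last by rewrite lerD2r GG_mono.
have [y [ey _ ->]] := GG_spec z0'.
have My : M <= - y by rewrite lerNr -hh_opp_le opprK ey ge_min lexx orbT.
have y0 : 0 <= - y by apply: le_trans My; apply: ltW.
rewrite -[y]opprK GG_neg//.
have /andP[l _] := HH0_bounds y0; have h1 := hM _ My.
have h2 := mulr_ge0 y0 (ltW (hh_gt0 (- y))).
have h3 := sqr_ge0 (hh (- y)).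
have aux (p q r s : R) : - (2 * s) <= p -> s <= e / 2 -> 0 <= q -> 0 <= r -> 0 <= p + q + r / 2 + e.
  by move=> *; lra.
exact: aux l h1 h2 h3.
Qed.

Lemma GG_tail z : 1 <= z -> lam - GG z <= 2 * expR (1 - z).
Proof.
move=> z1; have [y [ey _ ->]] := GG_spec (lt_le_trans ltr01 z1).
have y0 : 0 <= y.
  by rewrite -hh_opp_le ey oppr0 (le_trans hh0_le1).
have /andP[_ u] := HH0_bounds y0.
have h1 : expR (- (k%:R * y)) <= expR (1 - z).
  rewrite ler_expR -ey hh_sym.
  have : y <= k%:R * y by rewrite ler_peMl// ler1n.
  have := le_trans (hh_le y0) hh0_le1.
  by move: (hh y) (k%:R * y) => p q; lra.
have h3 := sqr_ge0 (hh y).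
rewrite /TT /HH y0; move: u h1 h3.
by move: (HH0 _) (_ ^+ 2) (expR _) (expR _) lam => p q r s t; lra.
Qed.

Lemma geo_le v : 0 <= v <= 1 -> geo k v <= k%:R.
Proof.
move=> /andP[v0 v1]; rewrite -[k in k%:R]card_ord -sumr_const; apply: ler_sum => i _.
by rewrite exprn_ile1.
Qed.

(** For [z < hh 0] write [z = hh a] with [a >= 0]. In [GG_neg], [a * hh a <= z * - ln z] because
    [hh a <= exp (- a)], and the other terms are [O (z)] because [exp (- k a) <= 2 k z]. The summand
    [lam / hh 0] of the constant covers the remaining [z]. *)
Lemma GG_small : exists2 C, 0 < C & forall z, 0 < z < 1 -> GG z <= C * z + z * (- ln z).
Proof.
have hl0 := GG_le_lam ltr01; have hl1 := GG_ge0 ltr01; have l0 := le_trans hl1 hl0.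
have h00 := hh_gt0 0.
have C1 : 0 <= lam / hh 0 by rewrite divr_ge0// ltW.
exists (4 * k%:R + 1 + lam / hh 0).
  by move: C1 kp; move: (lam / _) (k%:R) => p q; lra.
move=> z /andP[z0 z1].
have ln0 : 0 <= z * - ln z by rewrite mulr_ge0 ?ltW// oppr_gt0 ln_lt0// z0.
have kz := mulr_gt0 kp z0.
have [zh|zh] := leP (hh 0) z.
  apply: le_trans (GG_le_lam z0) _.
  have : lam <= lam / hh 0 * z by rewrite -[leLHS](divfK (lt0r_neq0 h00)) ler_wpM2l.
  have -> : (4 * k%:R + 1 + lam / hh 0) * z = 4 * (k%:R * z) + z + lam / hh 0 * z by ring.
  have aux (p q r s t : R) : 0 <= p -> 0 < q -> s <= r -> 0 < t -> s <= 4 * q + t + r + p.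
    by move=> *; lra.
  by move=> h; apply: aux.
have [y [ey _ ->]] := GG_spec z0.
have y0 : 0 <= - y.
  by rewrite lerNr oppr0 -hh_opp_le ey oppr0 ltW.
have v1 : expR y <= 1 by rewrite expR_le1 -oppr_ge0.
have v0 := expR_gt0 y.
have hz : hh (- y) = z by [].
have a1 : - y <= - ln z.
  rewrite lerN2 -ler_expR lnK ?posrE// -hz; apply: le_trans (hh_le_exp y0) _.
  by rewrite opprK.
have a2 : expR y ^+ k <= 2 * k%:R * z.
  rewrite -hz hhE opprK; set x := _ / _.
  have g0 : 0 < geo k (expR y) by apply: geo_gt0 => //; apply: ltW.
  have x0 : 0 < x by rewrite divr_gt0 ?exprn_gt0.
  have x1 : x <= 1.
    rewrite ler_pdivrMr// mul1r; apply: le_trans (_ : 1 <= _); first by rewrite exprn_ile1// ltW.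
    case: (k) k0 => // n _.
    by rewrite geoSl lerDl mulr_ge0 ?(ltW v0)// sumr_ge0// => i _; rewrite exprn_ge0// ltW.
  have e1 : x / 2 <= ln (1 + x).
    have p1 : 0 < 1 + x by rewrite addr_gt0.
    have := @le_ln1Dx R (- x / (1 + x)).
    have -> : 1 + - x / (1 + x) = (1 + x)^-1 by field; rewrite gt_eqF.
    rewrite -subr_gt0 opprK.
    have -> : - x / (1 + x) + 1 = (1 + x)^-1 by field; rewrite gt_eqF.
    rewrite invr_gt0 p1 => /(_ isT); rewrite lnV ?posrE// mulNr lerN2; apply: le_trans.
    rewrite ler_pdivlMr// mulrAC ler_pdivrMr//.
    have : x * x <= x by rewrite ler_piMl// ltW.
    by lra.
  have e2 : expR y ^+ k = x * geo k (expR y) by rewrite divfK// gt_eqF.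
  rewrite e2; have e3 := @geo_le (expR y).
  rewrite (ltW v0) v1 in e3; have := ler_pM (ltW x0) (ltW g0) (_ : x <= 2 * ln (1 + x)) (e3 isT).
  move=> /(_ _)/le_trans; apply; first by move: e1; lra.
  by rewrite -!mulrA [ln _ * _]mulrC.
have /andP[_ a3] := HH0_bounds y0.
have a4 : expR (- (k%:R * - y)) = expR y ^+ k by rewrite mulrN opprK expRM_natl.
rewrite -[y]opprK GG_neg// hz.
have a5 : - y * z <= - ln z * z by rewrite ler_wpM2r// ltW.
have a6 : z * z <= z by rewrite ler_piMl// ltW.
have a7 := mulr_ge0 C1 (ltW z0).
rewrite a4 in a3; rewrite expr2.
have -> : (4 * k%:R + 1 + lam / hh 0) * z = 4 * (k%:R * z) + z + lam / hh 0 * z by ring.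
have aux (p q r s t u v w : R) : v <= 2 * q -> p <= 2 * v -> s <= r -> t <= w -> 0 <= u -> 0 < w ->
  p + s + t / 2 <= 4 * q + w + u + r by move=> *; lra.
apply: aux a6 a7 z0; [|exact: a3|by rewrite [z * _]mulrC].
by rewrite mulrA.
Qed.

End Curve.

(** * Finite products of Bernoulli variables *)

Section Expectation.
Variables (R : realType) (I : eqType).
Implicit Types (a b : I -> R) (L : seq I) (F G : (I -> bool) -> R) (w : I -> bool).

Definition upd w x c := fun y => if y == x then c else w y.

(* The expectation of [F] when the values at [x \in L] are independent and true with
   probability [a x], the other values being those of [w]. *)
Fixpoint Ex a L F w : R :=
  if L is x :: L' then
    a x * Ex a L' F (upd w x true) + (1 - a x) * Ex a L' F (upd w x false)
  else F w.

Lemma Ex_cat a L1 L2 F w : Ex a (L1 ++ L2) F w = Ex a L1 (Ex a L2 F) w.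
Proof. by elim: L1 w => //= x L1 IH w; rewrite !IH. Qed.

Lemma Ex_congr a b L F G w : {in L, a =1 b} ->
  (forall w', (forall x, x \notin L -> w' x = w x) -> F w' = G w') ->
  Ex a L F w = Ex b L G w.
Proof.
elim: L w => [|x L IH] w /= ab h; first exact: h.
have st c : Ex a L F (upd w x c) = Ex b L G (upd w x c).
  apply: IH => [y yL|w' hw]; first by apply: ab; rewrite inE yL orbT.
  apply: h => y; rewrite inE negb_or => /andP[yx yL].
  by rewrite hw// /upd (negbTE yx).
by rewrite !st ab ?mem_head.
Qed.

Lemma Ex_le a L F G w : {in L, forall x, 0 <= a x <= 1} ->
  (forall w', (forall x, x \notin L -> w' x = w x) -> F w' <= G w') ->
  Ex a L F w <= Ex a L G w.
Proof.
elim: L w => [|x L IH] w /= ab h; first exact: h.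
have st c : Ex a L F (upd w x c) <= Ex a L G (upd w x c).
  apply: IH => [y yL|w' hw]; first by apply: ab; rewrite inE yL orbT.
  apply: h => y; rewrite inE negb_or => /andP[yx yL].
  by rewrite hw// /upd (negbTE yx).
have /andP[a0 a1] := ab x (mem_head _ _).
by apply: lerD; apply: ler_wpM2l => //; rewrite subr_ge0.
Qed.

Lemma Ex_cst a L (c : R) w : Ex a L (fun=> c) w = c.
Proof. by elim: L w => //= x L IH w; rewrite !IH; lra. Qed.

Lemma Ex_scale a L (c : R) F w : Ex a L (fun w' => c * F w') w = c * Ex a L F w.
Proof. by elim: L w => //= x L IH w; rewrite !IH; ring. Qed.

Lemma Ex_ge0 a L F w : {in L, forall x, 0 <= a x <= 1} -> (forall w', 0 <= F w') ->
  0 <= Ex a L F w.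
Proof. by move=> ha hF; rewrite -[leLHS](Ex_cst a L 0 w); apply: Ex_le. Qed.

Lemma Ex_start a L F w w' :
  (forall v v', (forall x, x \in L -> v x = v' x) ->
    (forall x, x \notin L -> v x = w x) -> (forall x, x \notin L -> v' x = w' x) -> F v = F v') ->
  Ex a L F w = Ex a L F w'.
Proof.
elim: L w w' => [|x L IH] w w' /= h; first exact: h.
have st c : Ex a L F (upd w x c) = Ex a L F (upd w' x c).
  apply: IH => v v' hvv hv hv'; apply: h => y; rewrite inE.
  - case/orP => [/eqP ->|]; last exact: hvv.
    have [xL|xL] := boolP (x \in L); first exact: hvv.
    by rewrite hv// hv'// /upd eqxx.
  - by rewrite negb_or => /andP[yx yL]; rewrite hv// /upd (negbTE yx).
  - by rewrite negb_or => /andP[yx yL]; rewrite hv'// /upd (negbTE yx).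
by rewrite !st.
Qed.

Lemma Ex_indep a L1 L2 F1 F2 w :
  (forall v v', (forall x, x \notin L2 -> v x = v' x) -> F1 v = F1 v') ->
  (forall v v', (forall x, x \in L2 -> v x = v' x) -> F2 v = F2 v') ->
  Ex a (L1 ++ L2) (fun v => F1 v * F2 v) w = Ex a L1 F1 w * Ex a L2 F2 w.
Proof.
move=> h1 h2; rewrite Ex_cat mulrC -Ex_scale; apply: Ex_congr => // v _.
rewrite (Ex_congr (b := a) (G := fun v' => F1 v * F2 v')) => [|//|v' hv'].
  rewrite Ex_scale mulrC; congr (_ * _); apply: Ex_start => u u' hu _ _; exact: h2.
by congr (_ * _); apply: h1.
Qed.

Lemma Ex_affine a L F w x : uniq L -> x \in L ->
  Ex a L F w = a x * Ex (fun y => if y == x then 1 else a y) L F w +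
               (1 - a x) * Ex (fun y => if y == x then 0 else a y) L F w.
Proof.
elim: L w => //= y L IH w /andP[yL uL]; rewrite inE => /orP[/eqP xy|xL].
  rewrite -xy eqxx in yL *; rewrite subrr subr0 !mul0r !mul1r addr0 add0r.
  by congr (_ * _ + _ * _); apply: Ex_congr => // z zL; case: eqP => // zx;
    rewrite -zx zL in yL.
have yx : y == x = false by apply: contraNF yL => /eqP ->.
by rewrite yx !IH//; ring.
Qed.

Definition incr F := forall v v' : I -> bool, (forall x, v x -> v' x) -> F v <= F v'.

Lemma Ex_mono a b L F w w' : incr F -> {in L, forall x, 0 <= a x <= b x} ->
  {in L, forall x, b x <= 1} -> (forall x, w x -> w' x) -> Ex a L F w <= Ex b L F w'.
Proof.
move=> iF; elim: L w w' => [|x L IH] w w' /= ha hb ww; first exact: iF.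
have /andP[a0 ab] := ha x (mem_head _ _); have b1 := hb x (mem_head _ _).
have ha' : {in L, forall x, 0 <= a x <= b x} by move=> y yL; apply: ha; rewrite inE yL orbT.
have hb' : {in L, forall x, b x <= 1} by move=> y yL; apply: hb; rewrite inE yL orbT.
have sT : Ex a L F (upd w x true) <= Ex b L F (upd w' x true).
  by apply: IH => // y; rewrite /upd; case: eqP => // _; apply: ww.
have sF : Ex a L F (upd w x false) <= Ex b L F (upd w' x false).
  by apply: IH => // y; rewrite /upd; case: eqP => // _; apply: ww.
have sFT : Ex a L F (upd w x false) <= Ex b L F (upd w' x true).
  by apply: IH => // y; rewrite /upd; case: eqP => // _; apply: ww.
apply: le_trans (_ : a x * Ex b L F (upd w' x true) +
  ((b x - a x) * Ex b L F (upd w' x true) + (1 - b x) * Ex b L F (upd w' x false)) <= _).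
  apply: lerD; first exact: ler_wpM2l.
  have -> : 1 - a x = (b x - a x) + (1 - b x) by lra.
  by rewrite mulrDl; apply: lerD; apply: ler_wpM2l; rewrite ?subr_ge0.
by rewrite addrA -mulrDl [a x + _]addrC subrK.
Qed.

(** Passing from [a x] to [b x] multiplies the weight of [true] by [b x / a x] and does not increase
    the weight of [false]; as [F] is nonnegative, this can be iterated over the sites. *)
Lemma Ex_ratio a b L F w : (forall v, 0 <= F v) -> {in L, forall x, 0 < a x <= b x} ->
  {in L, forall x, b x <= 1} -> Ex b L F w <= (\prod_(x <- L) (b x / a x)) * Ex a L F w.
Proof.
move=> F0; elim: L w => [|x L IH] w /= ha hb; first by rewrite big_nil mul1r.
have /andP[a0 ab] := ha x (mem_head _ _); have b1 := hb x (mem_head _ _).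
have ha' : {in L, forall x, 0 < a x <= b x} by move=> y yL; apply: ha; rewrite inE yL orbT.
have hb' : {in L, forall x, b x <= 1} by move=> y yL; apply: hb; rewrite inE yL orbT.
have b0 := lt_le_trans a0 ab.
set p := \prod_(_ <- L) _ in IH.
have p0 : 0 <= p.
  rewrite /p big_seq; apply: prodr_ge0 => y yL; have /andP[y0 yb] := ha' y yL.
  by apply: divr_ge0; apply: ltW => //; apply: lt_le_trans yb.
have Y0 c : 0 <= Ex a L F (upd w x c).
  apply: Ex_ge0 => // y yL; have /andP[y0 yb] := ha' y yL.
  by rewrite ltW//= (le_trans yb)// hb'.
have T := IH (upd w x true) ha' hb'; have T' := IH (upd w x false) ha' hb'.
rewrite big_cons -/p mulrDr; apply: lerD.
  have -> : b x / a x * p * (a x * Ex a L F (upd w x true)) = b x * (p * Ex a L F (upd w x true)).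
    by field; rewrite gt_eqF.
  by apply: ler_wpM2l; rewrite ?(ltW b0).
have -> : b x / a x * p * ((1 - a x) * Ex a L F (upd w x false)) =
  (b x / a x * (1 - a x)) * (p * Ex a L F (upd w x false)) by ring.
apply: ler_pM => //.
- by rewrite subr_ge0.
- apply: Ex_ge0 => // y yL; have /andP[y0 yb] := ha' y yL.
  by rewrite (ltW (lt_le_trans y0 yb)) hb'.
- by rewrite mulrAC ler_pdivlMr//; lra.
Qed.

Lemma Ex_01 (f : I -> bool) L F w :
  (forall v v', (forall x, x \in L -> v x = v' x) -> F v = F v') ->
  Ex (fun x => (f x)%:R) L F w = F f.
Proof.
move=> hF.
have -> : F f = Ex (fun x => (f x)%:R) L (fun=> F f) w by rewrite Ex_cst.
have H : forall L0 w0, (forall v, (forall x, x \in L0 -> v x = f x) ->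
   (forall x, x \notin L0 -> v x = w0 x) -> F v = F f) ->
   Ex (fun x => (f x)%:R) L0 F w0 = F f.
  elim=> [|x L0 IH] w0 h /=; first exact: h.
  have st c : c = f x -> Ex (fun x => (f x)%:R) L0 F (upd w0 x c) = F f.
    move=> cx; apply: IH => v hv hv'; apply: h => y; rewrite inE.
      case/orP => [/eqP ->|]; last exact: hv.
      have [xL|xL] := boolP (x \in L0); first exact: hv.
      by rewrite hv'// /upd eqxx.
    by rewrite negb_or => /andP[yx yL]; rewrite hv'// /upd (negbTE yx).
  case fx : (f x); first by rewrite subrr mul0r addr0 mul1r st.
  by rewrite mul0r subr0 mul1r add0r st.
rewrite Ex_cst; apply: H => v hv _; exact: hF.
Qed.

End Expectation.

(** * Lines hit by a random set of sites *)

Section Lines.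
Variables (R : realType) (S Lam : eqType) (inc : S -> Lam -> bool) (p : R).
Hypothesis p01 : 0 <= p <= 1.
Implicit Types (l : seq S) (LL : seq Lam) (F : (Lam -> bool) -> R) (w : S -> bool) (f : Lam -> bool).

Definition hit l w ell := has (fun z => w z && inc z ell) l.
Definition lprob l ell : R := 1 - (1 - p) ^+ count (inc^~ ell) l.

Lemma lprob_cons z l ell : lprob (z :: l) ell =
  if inc z ell then p + (1 - p) * lprob l ell else lprob l ell.
Proof. by rewrite /lprob /=; case: ifP => _; rewrite ?add0n// add1n exprS; ring. Qed.

Lemma lprob01 l ell : 0 <= lprob l ell <= 1.
Proof.
have /andP[p0 p1] := p01.
rewrite /lprob subr_ge0 exprn_ile1 ?subr_ge0 ?gerBl//=.
by rewrite exprn_ge0// subr_ge0.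
Qed.

Definition dep_on LL F := forall v v', (forall x, x \in LL -> v x = v' x) -> F v = F v'.

(** The sites are revealed one at a time, [f0] recording the lines already hit. A site meets at most
    one line [e0] of [LL], and the mean is affine in the probability of [e0], which revealing the
    site raises from [lprob l e0] to [lprob (z :: l) e0]. *)
Lemma Ex_lines l LL F f0 w f : uniq l -> uniq LL -> dep_on LL F ->
  {in l, forall z, {in LL &, forall e e', inc z e -> inc z e' -> e = e'}} ->
  Ex (fun=> p) l (fun w' => F (fun e => f0 e || hit l w' e)) w =
  Ex (fun e => if f0 e then 1 else lprob l e) LL F f.
Proof.
move=> + uLL dF; elim: l f0 w => [|z l IH] f0 w /=.
  move=> _ _; rewrite -[RHS](Ex_congr (a := fun e => (f0 e || false)%:R) (F := F)) ?Ex_01//.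
  by move=> e _; rewrite /lprob/= expr0 subrr orbF; case: (f0 e).
move=> /andP[zl ul] hl.
have hl' : {in l, forall z, {in LL &, forall e e', inc z e -> inc z e' -> e = e'}}.
  by move=> y yl; apply: hl; rewrite inE yl orbT.
have E c : Ex (fun=> p) l (fun w' => F (fun e => f0 e || hit (z :: l) w' e)) (upd w z c) =
    Ex (fun e => if f0 e || (c && inc z e) then 1 else lprob l e) LL F f.
  rewrite -(IH _ (upd w z c))//; apply: Ex_congr => // v hv; congr F; apply/funext => e.
  by rewrite /hit /= hv// /upd eqxx orbA.
rewrite !E /=.
have [|/hasPn nz] := boolP (has (inc z) LL); last first.
  have e1 c : Ex (fun e => if f0 e || (c && inc z e) then 1 else lprob l e) LL F f =
     Ex (fun e => if f0 e then 1 else lprob (z :: l) e) LL F f.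
    by apply: Ex_congr => // e eL; rewrite lprob_cons (negbTE (nz e eL)) andbF orbF.
  by rewrite (e1 true) (e1 false); lra.
move=> /hasP[e0 e0L ze0].
have one e : e \in LL -> inc z e = (e == e0).
  move=> eL; apply/idP/eqP => [ze|->//]; exact: hl (mem_head _ _) _ _ eL e0L ze ze0.
pose a1 := fun e => if e == e0 then 1 else if f0 e then 1 else lprob l e.
pose a0 := fun e => if e == e0 then 0 else if f0 e then 1 else lprob l e.
rewrite (Ex_affine _ F f uLL e0L).
rewrite [X in _ + _ * X](Ex_affine _ F f uLL e0L).
rewrite [RHS](Ex_affine _ F f uLL e0L).
have -> : Ex (fun y => if y == e0 then 1 else if f0 y || (true && inc z y) then 1 else lprob l y)
   LL F f = Ex a1 LL F f.
  by apply: Ex_congr => // e eL; rewrite /a1 one//; case: (e == e0); rewrite ?orbF.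
have -> : Ex (fun y => if y == e0 then 0 else if f0 y || (true && inc z y) then 1 else lprob l y)
   LL F f = Ex a0 LL F f.
  by apply: Ex_congr => // e eL; rewrite /a0 one//; case: (e == e0); rewrite ?orbF.
have -> : Ex (fun y => if y == e0 then 1 else if f0 y || (false && inc z y) then 1 else lprob l y)
   LL F f = Ex a1 LL F f.
  by apply: Ex_congr => // e eL; rewrite /a1 orbF.
have -> : Ex (fun y => if y == e0 then 0 else if f0 y || (false && inc z y) then 1 else lprob l y)
   LL F f = Ex a0 LL F f.
  by apply: Ex_congr => // e eL; rewrite /a0 orbF.
have -> : Ex (fun y => if y == e0 then 1 else if f0 y then 1 else lprob (z :: l) y)
   LL F f = Ex a1 LL F f.
  by apply: Ex_congr => // e eL; rewrite /a1 lprob_cons one//; case: (e == e0).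
have -> : Ex (fun y => if y == e0 then 0 else if f0 y then 1 else lprob (z :: l) y)
   LL F f = Ex a0 LL F f.
  by apply: Ex_congr => // e eL; rewrite /a0 lprob_cons one//; case: (e == e0).
rewrite lprob_cons ze0 orbF orbT; move: (Ex a1 _ _ _) (Ex a0 _ _ _) (lprob l e0) => x y u.
by case: (f0 e0); ring.
Qed.

(* A shared occupied site saves its lines at most the reciprocals of their probabilities. *)
Lemma Ex_lines_shared lC lN LL F (b : Lam -> R) (kap : S -> R) f0 w f :
  uniq (lC ++ lN) -> uniq LL -> dep_on LL F -> incr F -> (forall v, 0 <= F v) ->
  {in lN, forall z, {in LL &, forall e e', inc z e -> inc z e' -> e = e'}} ->
  {in LL, forall e, 0 < b e <= 1} -> {in LL, forall e, lprob lN e <= b e} ->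
  {in lC, forall z, \prod_(e <- LL | inc z e) (b e)^-1 <= kap z} ->
  Ex (fun=> p) (lC ++ lN) (fun w' => F (fun e => f0 e || hit (lC ++ lN) w' e)) w <=
  \prod_(z <- lC) (1 + p * kap z) * Ex (fun e => if f0 e then 1 else b e) LL F f.
Proof.
move=> + uLL dF iF F0 hN hb01 hb.
have /andP[p0 p1] := p01.
elim: lC f0 w => [|z lC IH] f0 w /=.
  move=> ul _; rewrite big_nil mul1r (@Ex_lines lN LL F f0 w f)//.
  apply: Ex_mono => // e eL; have /andP[b0 b1] := hb01 e eL; case: (f0 e) => //.
  - by rewrite lexx ler01.
  - by rewrite hb// andbT; have /andP[] := lprob01 lN e.
move=> /andP[zl ul] hk.
have hk' : {in lC, forall z, \prod_(e <- LL | inc z e) (b e)^-1 <= kap z}.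
  by move=> y yl; apply: hk; rewrite inE yl orbT.
have E c : Ex (fun=> p) (lC ++ lN) (fun w' => F (fun e => f0 e || hit (z :: lC ++ lN) w' e)) (upd w z c) <=
    \prod_(z <- lC) (1 + p * kap z) *
    Ex (fun e => if f0 e || (c && inc z e) then 1 else b e) LL F f.
  rewrite -[leLHS](Ex_congr (a := fun=> p) (F := fun w' => F (fun e => (f0 e || (c && inc z e)) || hit (lC ++ lN) w' e))) => [|//|v hv].
    exact: IH.
  congr F; apply/funext => e.
  by rewrite /hit /= hv// /upd eqxx orbA.
apply: le_trans (lerD (ler_wpM2l p0 (E true)) (ler_wpM2l _ (E false))) _; first by rewrite subr_ge0.
rewrite big_cons /=.
set Q := \prod_(_ <- lC) _; set X := Ex (fun e => if f0 e then 1 else b e) LL F f.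
have Q0 : 0 <= Q.
  rewrite /Q big_seq; apply: prodr_ge0 => y yl; rewrite addr_ge0// mulr_ge0//.
  apply: le_trans (hk' y yl); rewrite big_seq_cond; apply: prodr_ge0 => e /andP[eL _].
  by have /andP[b0 _] := hb01 e eL; rewrite invr_ge0 ltW.
have X0 : 0 <= X.
  by apply: Ex_ge0 => // e eL; have /andP[b0 b1] := hb01 e eL; case: (f0 e); rewrite ?ler01 ?lexx// (ltW b0).
have -> : Ex (fun e => if f0 e || (false && inc z e) then 1 else b e) LL F f = X.
  by apply: Ex_congr => // e _; rewrite orbF.
have Y : Ex (fun e => if f0 e || (true && inc z e) then 1 else b e) LL F f <= kap z * X.
  apply: le_trans (@Ex_ratio R Lam (fun e => if f0 e then 1 else b e) _ LL F f F0 _ _) _.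
  - move=> e eL; have /andP[b0 b1] := hb01 e eL.
    by case: (f0 e) => /=; rewrite ?ltr01 ?lexx//; case: (inc z e); rewrite ?b0 ?b1 ?lexx.
  - by move=> e eL; have /andP[b0 b1] := hb01 e eL; case: ifP.
  apply: ler_wpM2r => //; apply: le_trans (hk z (mem_head _ _)).
  rewrite [leRHS]big_mkcond/= !big_seq; apply: ler_prod => e eL.
  have /andP[b0 b1] := hb01 e eL.
  case: (f0 e) => /=; rewrite ?invr1 ?mulr1.
    by rewrite ler01/=; case: (inc z e); rewrite ?invf_ge1.
  case: (inc z e); rewrite ?mul1r ?invr_ge0 ?(ltW b0) ?lexx//.
  by rewrite divff ?gt_eqF// ler01 lexx.
have -> : (1 + p * kap z) * Q * X = p * (Q * (kap z * X)) + (1 * (Q * X)) by ring.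
apply: lerD; first by apply: ler_wpM2l => //; apply: ler_wpM2l.
by apply: ler_wpM2r; [rewrite mulr_ge0|rewrite gerBl].
Qed.

End Lines.

(** * Runs of missed lines *)

Section Chain.
Variables (R : realType) (k : nat).
Hypothesis k0 : (0 < k)%N.
Implicit Types (rho a : nat -> R) (i j n : nat) (bs : seq bool).

(* A chain of trials dies at the end of a run of [k] failures: reaching such a run at
   position [i] multiplies the weight by [rho i] and starts a new run. *)
Fixpoint wt rho i j bs : R :=
  if bs is b :: bs' then
    if b then wt rho i.+1 0 bs'
    else if (j.+1 < k)%N then wt rho i.+1 j.+1 bs' else rho i * wt rho i.+1 0 bs'
  else 1.

(* The mean weight of [n] independent trials, started after [j] failures. *)
Fixpoint Zf rho a i j n : R :=
  if n is n'.+1 then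
    a i * Zf rho a i.+1 0 n' +
    (1 - a i) * (if (j.+1 < k)%N then Zf rho a i.+1 j.+1 n' else rho i * Zf rho a i.+1 0 n')
  else 1.

Lemma Ex_wt (I : eqType) (ln : nat -> I) (a : I -> R) rho i j n w :
  injective ln ->
  Ex a (map ln (iota i n)) (fun f => wt rho i j (map (f \o ln) (iota i n))) w =
  Zf rho (a \o ln) i j n.
Proof.
move=> il; elim: n i j w => [|n IH] i j w //=.
have E c : Ex a [seq ln x | x <- iota i.+1 n]
    (fun f => if f (ln i) then wt rho i.+1 0 [seq (f \o ln) x | x <- iota i.+1 n]
     else if (j.+1 < k)%N then wt rho i.+1 j.+1 [seq (f \o ln) x | x <- iota i.+1 n]
     else rho i * wt rho i.+1 0 [seq (f \o ln) x | x <- iota i.+1 n]) (upd w (ln i) c) =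
    if c then Zf rho (a \o ln) i.+1 0 n
    else if (j.+1 < k)%N then Zf rho (a \o ln) i.+1 j.+1 n else rho i * Zf rho (a \o ln) i.+1 0 n.
  have ni : ln i \notin [seq ln x | x <- iota i.+1 n].
    by rewrite (mem_map il) mem_iota ltnn.
  transitivity (Ex a [seq ln x | x <- iota i.+1 n]
    (fun f => if c then wt rho i.+1 0 [seq (f \o ln) x | x <- iota i.+1 n]
     else if (j.+1 < k)%N then wt rho i.+1 j.+1 [seq (f \o ln) x | x <- iota i.+1 n]
     else rho i * wt rho i.+1 0 [seq (f \o ln) x | x <- iota i.+1 n]) (upd w (ln i) c)).
    by apply: Ex_congr => // v hv; rewrite hv// /upd eqxx.
  by case: c; first exact: IH; case: ifP => _; rewrite ?Ex_scale IH.
by rewrite !E.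
Qed.

Fixpoint norun j bs : bool :=
  if bs is b :: bs' then if b then norun 0 bs' else (j.+1 < k)%N && norun j.+1 bs' else true.

Lemma wt_norun i j bs : wt (fun=> 0) i j bs = (norun j bs)%:R.
Proof.
by elim: bs i j => //= b bs IH i j; case: b => //; case: ltnP => _; rewrite ?mul0r//= IH.
Qed.

Lemma norun_mono j j' bs bs' : (j <= j')%N ->
  (forall n, nth true bs' n -> nth true bs n) -> size bs = size bs' ->
  norun j' bs' -> norun j bs.
Proof.
elim: bs bs' j j' => [|b bs IH] [|b' bs']//= j j' jj h [sz].
have h0 := h 0; have hS n := h n.+1; rewrite /= in h0 hS.
case: b' h0 {h} => [/(_ isT) ->|_]; first exact: IH.
move=> /andP[jk n']; case: b => //; first exact: (IH bs' 0 j'.+1).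
by rewrite (leq_ltn_trans _ jk)//=; apply: IH n'.
Qed.

(** The [j] earlier failures are made explicit as a prefix, since the run that is found may start
    among them. *)
Lemma norunPn j bs : (j < k)%N -> ~~ norun j bs ->
  exists2 m, (m + k <= j + size bs)%N &
    forall l, (l < k)%N -> ~~ nth true (nseq j false ++ bs) (m + l).
Proof.
elim: bs j => //= b bs IH j jk; case: b.
  move=> /(IH 0 k0)[m ms h]; exists (m + j.+1)%N; first by rewrite add0n in ms; lia.
  move=> l lk; rewrite nth_cat size_nseq ifN; last by lia.
  have -> : (m + j.+1 + l - j = (m + l).+1)%N by lia.
  exact: h.
have e : nseq j false ++ false :: bs = nseq j.+1 false ++ bs.
  by elim: j {jk IH} => //= j ->.
rewrite negb_and -leqNgt e => /orP[jk'|].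
  exists 0; first by lia.
  by move=> l lk; rewrite add0n nth_cat size_nseq nth_nseq ifT ?ifT//; lia.
have [jk' /(IH _ jk')[m ms h]|jk'] := ltnP j.+1 k.
  by exists m; [rewrite addnS -addSn|].
exists 0; first by lia.
by move=> l lk; rewrite add0n nth_cat size_nseq nth_nseq ifT ?ifT//; lia.
Qed.

Fixpoint resets i j bs : seq nat :=
  if bs is b :: bs' then
    if b then resets i.+1 0 bs'
    else if (j.+1 < k)%N then resets i.+1 j.+1 bs' else i :: resets i.+1 0 bs'
  else [::].

Lemma wt_resets rho i j bs : wt rho i j bs = \prod_(x <- resets i j bs) rho x.
Proof.
elim: bs i j => [|b bs IH] i j /=; first by rewrite big_nil.
case: b; first exact: IH.
by case: ifP => _; rewrite ?big_cons IH.
Qed.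

Lemma resets_bounds i j bs x : x \in resets i j bs -> (i <= x < i + size bs)%N.
Proof.
elim: bs i j => // b bs IH i j /=.
have st j' : x \in resets i.+1 j' bs -> (i <= x < i + (size bs).+1)%N by move/IH; lia.
by case: b; [exact: st|case: ifP => _; [exact: st|rewrite inE => /orP[/eqP->|/st//]]; lia].
Qed.

Lemma resets_uniq i j bs : uniq (resets i j bs).
Proof.
elim: bs i j => // b bs IH i j /=; case: b => //; case: ifP => // _ /=; rewrite IH andbT.
by apply/negP => /resets_bounds; lia.
Qed.

(** With its converse [resets_catP]: resets are decided from left to right, so more trials do not
    alter the earlier ones. This makes the events [grow n] decrease in [n]. *)
Lemma resets_cat i j bs bs' x : x \in resets i j bs -> x \in resets i j (bs ++ bs').
Proof.
elim: bs i j => //= b bs IH i j; case: b => //; first exact: IH.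
by case: ifP => _; [exact: IH|rewrite !inE => /orP[->//|/IH ->]; rewrite orbT].
Qed.

Lemma resets_catP i j bs bs' x : x \in resets i j (bs ++ bs') -> (x < i + size bs)%N ->
  x \in resets i j bs.
Proof.
elim: bs i j => [|b bs IH] i j /=; first by move/resets_bounds; lia.
have st j' : x \in resets i.+1 j' (bs ++ bs') -> (x < i + (size bs).+1)%N ->
  x \in resets i.+1 j' bs by move=> h1 h2; apply: IH => //; lia.
case: b; first exact: st.
case: ifP => _; first exact: st.
rewrite !inE => /orP[->//|h1 h2].
by rewrite st// orbT.
Qed.

(** A run is reset as soon as it reaches length [k], so [k] consecutive positions contain a success
    or a reset. Positions include the [j] initial failures. *)
Lemma resets_window i j bs m : (j < k)%N -> (m + k <= j + size bs)%N ->
  exists2 l, (m <= l < m + k)%N & nth false (nseq j false ++ bs) l \/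
    ((j <= l)%N /\ (i + (l - j))%N \in resets i j bs).
Proof.
elim: bs i j m => [|b bs IH] i j m jk /=; first by lia.
move=> mk; case: b.
  have [mj|mj] := leqP m j.
    by exists j; [lia|left; rewrite nth_cat size_nseq ltnn subnn].
  have [|l lm hl] := IH i.+1 0 (m - j.+1)%N k0; first by lia.
  exists (l + j.+1)%N; first by lia.
  case: hl => [hl|[_ hl]]; [left|right].
    rewrite nth_cat size_nseq ifN; last by lia.
    by have -> : (l + j.+1 - j = l.+1)%N by lia.
  split; first by lia.
  by have -> : (i + (l + j.+1 - j) = i.+1 + (l - 0))%N by lia.
have e : nseq j false ++ false :: bs = nseq j.+1 false ++ bs.
  by elim: j {jk mk IH} => //= j ->.
rewrite e; case: ltnP => jk'.
  have [|l lm hl] := IH i.+1 j.+1 m jk'; first by lia.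
  exists l => //; case: hl => [|[jl hl]]; [by left|right; split; first by lia].
  by have -> : (i + (l - j) = i.+1 + (l - j.+1))%N by lia.
have [mj|mj] := leqP m j.
  by exists j; [lia|right; rewrite subnn addn0 mem_head].
have [|l lm hl] := IH i.+1 0 (m - j.+1)%N k0; first by lia.
exists (l + j.+1)%N; first by lia.
case: hl => [hl|[_ hl]]; [left|right].
  rewrite nth_cat size_nseq ifN; last by lia.
  by have -> : (l + j.+1 - j.+1 = l)%N by lia.
split; first by lia.
rewrite inE; apply/orP; right.
by have -> : (i + (l + j.+1 - j) = i.+1 + (l - 0))%N by lia.
Qed.

Section Bounds.
Variables (rho a : nat -> R).
Hypotheses (a01 : forall i, 0 <= a i <= 1) (rho0 : forall i, 0 <= rho i <= 1).
Hypothesis rhoa : forall i, rho i <= a i.+1.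

Lemma Zf_ge0 i j n : 0 <= Zf rho a i j n.
Proof.
elim: n i j => //= n IH i j; have /andP[h0 h1] := a01 i; have /andP[r0 _] := rho0 i.
by apply: addr_ge0; rewrite mulr_ge0 ?subr_ge0//; case: ifP => _ //; rewrite mulr_ge0.
Qed.

(** The hypothesis [rhoa] serves the case where the run of [j'] is completed at [i] and that of [j]
    is not: the first chain restarts with the factor [rho i], while the second still succeeds at
    [i.+1] with probability [a i.+1 >= rho i]. *)
Lemma Zf_mono n i j j' : (j <= j' < k)%N -> Zf rho a i j' n <= Zf rho a i j n.
Proof.
elim/ltn_ind: n i j j' => -[//|n] IH i j j' jj /=.
have /andP[h0 h1] := a01 i; have /andP[r0 r1] := rho0 i.
rewrite lerD2l ler_wpM2l ?subr_ge0//.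
have [j'k|j'k] := ltnP j'.+1 k.
  by rewrite ifT; [apply: IH => //; lia|lia].
case: ltnP => // jk.
case: n IH => [|n] IH /=; first by rewrite mulr1.
have /andP[h0' h1'] := a01 i.+1; have /andP[r0' r1'] := rho0 i.+1.
apply: le_trans (_ : a i.+1 * Zf rho a i.+2 0 n <= _); last first.
  by rewrite lerDl mulr_ge0 ?subr_ge0//; case: ifP => _; rewrite ?mulr_ge0// Zf_ge0.
apply: ler_pM => //.
  by apply: addr_ge0; rewrite mulr_ge0 ?subr_ge0 ?Zf_ge0//; case: ifP => _; rewrite ?mulr_ge0// Zf_ge0.
have : (if (1 < k)%N then Zf rho a i.+2 1 n else rho i.+1 * Zf rho a i.+2 0 n) <= Zf rho a i.+2 0 n.
  case: ltnP => k1; first by apply: IH => //; lia.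
  by rewrite ler_piMl// Zf_ge0.
set y := (if _ then _ else _); set x := Zf _ _ _ 0 _ => yx.
have : (1 - a i.+1) * y <= (1 - a i.+1) * x by rewrite ler_wpM2l ?subr_ge0.
lra.
Qed.

(** Renewal at the first success of the window, or at the reset that ends it. Using one bound [u]
    for all failure probabilities only lowers the mean, since by [Zf_mono] a failure is worth less
    than a success. *)
Lemma Zf_expand d x j n u : (0 < d)%N -> (d + j = k)%N -> (d <= n)%N -> 0 <= u <= 1 ->
  (forall y, (x <= y < x + d)%N -> 1 - u <= a y) ->
  \sum_(m < d) (1 - u) * u ^+ m * Zf rho a (x + m.+1) 0 (n - m.+1) +
    rho (x + d).-1 * u ^+ d * Zf rho a (x + d) 0 (n - d) <= Zf rho a x j n.
Proof.
elim: d x j n => // d IH x j n _ djk dn /andP[u0 u1] hu; case: n dn => // n dn /=.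
have /andP[h0 h1] := a01 x; have /andP[r0 r1] := rho0 x.
have hx : 1 - u <= a x by apply: hu; clear; lia.
rewrite big_ord_recl/= expr0 mulr1 addn1 subSS subn0.
have Z0 := Zf_ge0 x.+1 0 n.
case: d IH djk dn hu => [|d] IH djk dn hu.
  rewrite big_ord0 addr0 addn1/= expr1 subn1/= ifN; last by clear -djk; lia.
  have : 0 <= (a x - (1 - u)) * ((1 - rho x) * Zf rho a x.+1 0 n).
    by rewrite mulr_ge0 ?mulr_ge0 ?subr_ge0.
  have aux (al r z : R) : 0 <= (al - (1 - u)) * ((1 - r) * z) ->
    (1 - u) * z + r * u * z <= al * z + (1 - al) * (r * z).
    move=> e; rewrite -subr_ge0; apply: le_trans e _; rewrite le_eqVlt.
    by apply/orP; left; apply/eqP; ring.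
  exact: aux.
have jk : (j.+1 < k)%N by clear -djk; lia.
rewrite jk.
have hm := @Zf_mono n x.+1 0 j.+1 jk.
have djk' : (d.+1 + j.+1 = k)%N by clear -djk; lia.
have hu' y : (x.+1 <= y < x.+1 + d.+1)%N -> 1 - u <= a y.
  by move=> hy; apply: hu; clear -hy; lia.
have u01 : 0 <= u <= 1 by rewrite u0.
have ih := IH x.+1 j.+1 n isT djk' dn u01 hu'.
have e1 : \sum_(i < d.+1) (1 - u) * u ^+ bump 0 i * Zf rho a (x + (bump 0 i).+1) 0 (n.+1 - (bump 0 i).+1)
  = u * \sum_(i < d.+1) (1 - u) * u ^+ i * Zf rho a (x.+1 + i.+1) 0 (n - i.+1).
  rewrite mulr_sumr; apply: eq_bigr => i _.
  rewrite /bump /= add1n exprS subSS addSnnS; ring.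
rewrite e1 subSS.
have -> : (x + d.+2 = x.+1 + d.+1)%N by clear; lia.
rewrite exprS.
set A := \sum_(_ < _) _ in ih *; set B := Zf _ _ (_ + _) 0 _ in ih *.
set r := rho _ in ih *; set v := u ^+ _ in ih *; set C := Zf _ _ _ j.+1 _ in ih hm *.
have h2 : u * (A + r * v * B) <= u * C by rewrite ler_wpM2l.
have h3 : 0 <= (a x - (1 - u)) * (Zf rho a x.+1 0 n - C) by rewrite mulr_ge0 ?subr_ge0.
have aux (al z c s q t : R) : u * s <= u * c -> 0 <= (al - (1 - u)) * (z - c) ->
  s = q + t -> (1 - u) * z + u * q + u * t <= al * z + (1 - al) * c.
  move=> e e' e''; rewrite e'' in e; rewrite -subr_ge0.
  have -> : al * z + (1 - al) * c - ((1 - u) * z + u * q + u * t) =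
    (al - (1 - u)) * (z - c) + (u * c - u * (q + t)) by ring.
  by apply: addr_ge0; rewrite ?subr_ge0.
have := aux _ _ _ _ _ _ h2 h3 erefl.
by rewrite !mulrA [u * r]mulrC.
Qed.

Lemma Zf_eq1 i j n : (n + j < k)%N -> Zf rho a i j n = 1.
Proof.
elim: n i j => //= n IH i j nj; rewrite !IH; try lia.
by rewrite ifT; [lra|lia].
Qed.

(** The product of the [T m] is a subsolution of [Zf_expand]: the first [m] factors are at most
    [tau], so the others multiply to at least the product over [tau^m], and a renewal sum of at
    least 1 closes the induction. *)
Lemma Zf_lower (T : nat -> R) n x : (forall m, 0 < T m <= 1) ->
  (forall y, (x <= y)%N -> (y + k <= x + n)%N -> exists u tau, [/\ 0 <= u <= 1, 0 < tau,
     (forall z, (y <= z < y + k)%N -> 1 - u <= a z /\ T z <= tau) &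
     1 <= \sum_(m < k) (1 - u) * u ^+ m / tau ^+ m.+1 + rho (y + k).-1 * u ^+ k / tau ^+ k]) ->
  \prod_(x <= m < x + n) T m <= Zf rho a x 0 n.
Proof.
move=> hT; elim/ltn_ind: n x => n IH x h.
have T0 m : 0 <= T m by have /andP[/ltW] := hT m.
have prod1 p q : \prod_(p <= m < q) T m <= 1.
  suff : 0 <= \prod_(p <= m < q) T m <= 1 by case/andP.
  apply: (big_ind (fun z => 0 <= z <= 1)); first by rewrite ler01 lexx.
    by move=> y z /andP[y0 y1] /andP[z0 z1]; rewrite mulr_ge0// mulr_ile1.
  by move=> i _; have /andP[_ ->] := hT i; rewrite T0.
have [nk|kn] := ltnP n k; first by rewrite Zf_eq1 ?addn0.
have [u [tau [u01 tau0 hz hs]]] := h x (leqnn x) ltac:(lia).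
apply: le_trans (@Zf_expand k x 0 n u k0 (addn0 k) kn u01 (fun y hy => (hz y hy).1)).
set P := \prod_(_ <= _ < _) _.
have P0 : 0 <= P by rewrite prodr_ge0.
have part m : (0 < m <= k)%N -> P / tau ^+ m <= Zf rho a (x + m) 0 (n - m).
  move=> /andP[m0 mk].
  have := IH (n - m)%N ltac:(lia) (x + m)%N _; rewrite -addnA subnKC; last by lia.
  move=> ih; apply: le_trans (ih _); last first.
    by move=> y xy yk; apply: h; lia.
  rewrite ler_pdivrMr ?exprn_gt0// mulrC /P (@big_cat_nat _ _ _ (x + m))/=; try lia.
  apply: ler_wpM2r; first by rewrite prodr_ge0.
  have -> : tau ^+ m = \prod_(x <= i < x + m) tau.
    by rewrite big_const_nat addKn -Monoid.iteropE.
  rewrite big_nat [leRHS]big_nat; apply: ler_prod => i hi; rewrite T0/=; apply: (hz i _).2; lia.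
apply: le_trans (_ : P * (\sum_(m < k) (1 - u) * u ^+ m / tau ^+ m.+1 + rho (x + k).-1 * u ^+ k / tau ^+ k) <= _).
  by rewrite ler_peMr.
have /andP[u0 u1] := u01.
rewrite mulrDr mulr_sumr; apply: lerD.
  apply: ler_sum => m _; rewrite [_ / _]mulrC mulrA mulrC; apply: ler_wpM2l.
    by rewrite mulr_ge0 ?subr_ge0 ?exprn_ge0.
  by apply: part; rewrite ltn0Sn ltn_ord.
rewrite [_ / _]mulrC mulrA mulrC; apply: ler_wpM2l.
  by have /andP[r0 _] := rho0 (x + k).-1; rewrite mulr_ge0 ?exprn_ge0.
by apply: part; rewrite k0 leqnn.
Qed.

End Bounds.

(** With constant probabilities and [rho = 0] the renewal equation is exact and [E] is its root.
    Fewer than [k] trials have mean 1, which costs the factor [E^(k - 1)]: the [k - 1] lines lost in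
    each block. *)
Lemma Zf_upper (u E : R) i n : 0 <= u <= 1 -> 1 <= E ->
  \sum_(m < k) (1 - u) * u ^+ m * E ^+ m.+1 = 1 ->
  Zf (fun=> 0) (fun=> 1 - u) i 0 n * E ^+ n <= E ^+ (k - 1).
Proof.
move=> u01 E1 hs; have /andP[u0 u1] := u01.
have E0 : 0 < E := lt_le_trans ltr01 E1.
have a01 (x : nat) : 0 <= 1 - u <= 1 by rewrite subr_ge0 u1 gerBl.
have expand d x j N : (0 < d)%N -> (d + j = k)%N -> (d <= N)%N ->
  Zf (fun=> 0) (fun=> 1 - u) x j N =
  \sum_(m < d) (1 - u) * u ^+ m * Zf (fun=> 0) (fun=> 1 - u) (x + m.+1) 0 (N - m.+1).
  elim: d x j N => // d IH x j [//|N] _ djk dn /=.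
  rewrite big_ord_recl/= expr0 mulr1 addn1 subSS subn0; congr (_ + _).
  case: d IH djk dn => [|d] IH djk dn.
    by rewrite big_ord0 ifN ?mul0r ?mulr0//; lia.
  rewrite ifT; last by lia.
  rewrite (IH x.+1 j.+1 N)//; last by lia.
  rewrite subKr mulr_sumr; apply: eq_bigr => m _.
  by rewrite /bump /= add1n exprS subSS addSnnS; ring.
elim/ltn_ind: n i => n IH i.
have [nk|kn] := ltnP n k.
  rewrite Zf_eq1 ?addn0// mul1r; apply: ler_weXn2l => //; lia.
rewrite (@expand k i 0 n)// ?addn0// mulr_suml.
apply: le_trans (_ : \sum_(m < k) (1 - u) * u ^+ m * E ^+ m.+1 * E ^+ (k - 1) <= _); last first.
  by rewrite -mulr_suml hs mul1r.
apply: ler_sum => m _; have mk := ltn_ord m.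
have -> : E ^+ n = E ^+ m.+1 * E ^+ (n - m.+1) by rewrite -exprD subnKC//; lia.
set Z := Zf _ _ _ _ _.
have -> : (1 - u) * u ^+ m * Z * (E ^+ m.+1 * E ^+ (n - m.+1)) =
  (1 - u) * u ^+ m * E ^+ m.+1 * (Z * E ^+ (n - m.+1)) by ring.
apply: ler_wpM2l; first by rewrite !mulr_ge0 ?exprn_ge0 ?subr_ge0// ltW.
by apply: IH; lia.
Qed.

End Chain.

(** * Finitary rules, and measurability of the growth events *)

Lemma occupied_rule_finitary m (S : set site) y : occupied_rule m S y ->
  exists z, S z /\ forall U : set site, U z -> occupied_rule m U y.
Proof. by case: m => [k||] [z [hz hd]]; exists z; split => // U Uz; exists z. Qed.

Lemma empty_rule_finitary m (S : set site) y : empty_rule m S y ->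
  exists l : seq site, (forall z, z \in l -> S z) /\
    forall U : set site, (forall z, z \in l -> U z) -> empty_rule m U y.
Proof.
case: m => [k||] /=.
- by move=> [l [ul sl h1 h2]]; exists l; split => // U hU; exists l; split.
- move=> [h1 h2].
  have [z1 [S1 z1P]] : exists z1, S z1 /\ (z1 = (y.1, y.2 + 1) \/ z1 = (y.1, y.2 - 1)).
    by case: h1 => h1; [exists (y.1, y.2 + 1)|exists (y.1, y.2 - 1)]; split => //; [left|right].
  have [z2 [S2 z2P]] : exists z2, S z2 /\ (z2 = (y.1 + 1, y.2) \/ z2 = (y.1 - 1, y.2)).
    by case: h2 => h2; [exists (y.1 + 1, y.2)|exists (y.1 - 1, y.2)]; split => //; [left|right].
  exists [:: z1; z2]; split; first by move=> z; rewrite !inE => /orP[/eqP->|/eqP->].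
  move=> U hU; have U1 := hU z1 (mem_head _ _).
  have U2 : U z2 by apply: hU; rewrite !inE eqxx orbT.
  by split; [case: z1P => <-|case: z2P => <-]; [left|right|left|right].
- move=> [e [d' [he [hd [h1 [h2 h3]]]]]].
  exists [:: (y.1 + e, y.2); (y.1, y.2 + d'); (y.1 + e, y.2 + d')]; split.
    by move=> z; rewrite !inE => /or3P[/eqP->|/eqP->|/eqP->].
  by move=> U hU; exists e, d'; do !split => //; apply: hU; rewrite !inE eqxx ?orbT.
Qed.

Lemma final_active_closed m w : closed_set m w (final_active m w).
Proof.
split; [|split].
- by move=> y hy U [hU _]; apply: hU.
- move=> y wy /occupied_rule_finitary[z [hz h]] U hU; apply: hU.2.1 => //.
  by apply: h; apply: hz.
- move=> y wy /empty_rule_finitary[l [hl h]] U hU; apply: hU.2.2 => //.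
  by apply: h => z /hl; apply.
Qed.

Lemma final_active_min m w (S : set site) : closed_set m w S -> final_active m w `<=` S.
Proof. by move=> hS x; apply. Qed.

Section Field.
Variables (R : realType) (d : measure_display) (T : measurableType d).
Variables (P : probability T R) (X : T -> config) (p : R).
Hypothesis iid : iid_bernoulli_field P X p.
Implicit Types (L : seq site) (w b : config) (E : config -> bool).

Lemma measurable_site x c : measurable [set t | X t x = c].
Proof.
have [m _] := iid; case: c; first exact: m.
have -> : [set t | X t x = false] = ~` [set t | X t x = true].
  by apply/seteqP; split => t /=; [move=> ->|move/negP/negbTE].
exact/measurableC/m.
Qed.

Definition agree L b : set T := [set t | forall x, x \in L -> X t x = b x].

Lemma agree_cons x L b : agree (x :: L) b = [set t | X t x = b x] `&` agree L b.
Proof.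
apply/seteqP; split => t /=.
  move=> h; split; first by apply: h; rewrite mem_head.
  by move=> y yL; apply: h; rewrite inE yL orbT.
by move=> [hx h] y; rewrite inE => /orP[/eqP->//|/h].
Qed.

Lemma measurable_agree L b : measurable (agree L b).
Proof.
elim: L => [|x L IH]; last by rewrite agree_cons; apply: measurableI => //; exact: measurable_site.
have -> : agree [::] b = setT by apply/seteqP; split.
exact: measurableT.
Qed.

Definition determined L E := forall w w', (forall x, x \in L -> w x = w' x) -> E w = E w'.

(** Induction on the sites still to be revealed, those of [L0] being fixed to [b]; the event is
    split according to the value at the next site. *)
Lemma prob_Ex_agree L L0 b E : uniq (L0 ++ L) -> determined (L0 ++ L) E ->
  measurable (agree L0 b `&` [set t | E (X t)]) /\
  P (agree L0 b `&` [set t | E (X t)]) =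
    ((\prod_(x <- L0) (if b x then p else 1 - p)) *
     Ex (fun=> p) L (fun w => (E w)%:R) b)%:E.
Proof.
elim: L L0 b => [|x L IH] L0 b.
  rewrite cats0 => u det /=.
  have [Eb|Eb] := boolP (E b).
    have -> : agree L0 b `&` [set t | E (X t)] = agree L0 b.
      by apply/seteqP; split => [t []//|t h]; split => //=; rewrite (det _ b).
    by rewrite mulr1; split; [exact: measurable_agree|rewrite iid.2].
  have -> : agree L0 b `&` [set t | E (X t)] = set0.
    by apply/seteqP; split => // t [h] /=; rewrite (det _ b)// (negbTE Eb).
  by rewrite mulr0 measure0; split; [exact: measurable0|].
rewrite -cat_rcons => u det.
have xL0 : x \notin L0.
  by move: u; rewrite cat_uniq rcons_uniq => /andP[/andP[]].
have pe : perm_eq (rcons L0 x ++ L) ((x :: L0) ++ L) by rewrite perm_cat2r perm_rcons.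
rewrite (perm_uniq pe) in u.
have det' : determined ((x :: L0) ++ L) E.
  by move=> w w' h; apply: det => y yL; apply: h; rewrite -(perm_mem pe).
have H c := IH (x :: L0) (upd b x c) u det'.
have e c : agree (x :: L0) (upd b x c) = [set t | X t x = c] `&` agree L0 b.
  rewrite agree_cons {1}/upd eqxx; congr (_ `&` _); apply/seteqP; split => t h y yL.
    by rewrite h// /upd; case: eqP => // yx; rewrite -yx yL in xL0.
  by rewrite h// /upd; case: eqP => // yx; rewrite -yx yL in xL0.
have U : agree L0 b `&` [set t | E (X t)] =
   (agree (x :: L0) (upd b x true) `&` [set t | E (X t)]) `|`
   (agree (x :: L0) (upd b x false) `&` [set t | E (X t)]).
  rewrite !e; apply/seteqP; split => t /=.
    by move=> [h1 h2]; case: (X t x); [left|right].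
  by case=> -[[_ h1] h2].
have w c : \prod_(y <- x :: L0) (if upd b x c y then p else 1 - p) =
   (if c then p else 1 - p) * \prod_(y <- L0) (if b y then p else 1 - p).
  rewrite big_cons /upd eqxx; congr (_ * _); rewrite big_seq [RHS]big_seq.
  by apply: eq_bigr => y yL; case: eqP => // yx; rewrite -yx yL in xL0.
rewrite U; split; first by apply: measurableU; [exact: (H true).1|exact: (H false).1].
have -> : P ((agree (x :: L0) (upd b x true) `&` [set t | E (X t)]) `|`
   (agree (x :: L0) (upd b x false) `&` [set t | E (X t)])) =
   (P (agree (x :: L0) (upd b x true) `&` [set t | E (X t)]) +
    P (agree (x :: L0) (upd b x false) `&` [set t | E (X t)]))%E.
  apply: measureU; [exact: (H true).1|exact: (H false).1|].
  rewrite !e; apply/seteqP; split => // t [[[h _] _] [[h' _] _]] /=.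
  by rewrite /= in h h'; rewrite h in h'.
by rewrite (H true).2 (H false).2 !w -EFinD /=; congr (_%:E); ring.
Qed.

Lemma prob_Ex L E w : uniq L -> determined L E ->
  measurable [set t | E (X t)] /\
  P [set t | E (X t)] = (Ex (fun=> p) L (fun w => (E w)%:R) w)%:E.
Proof.
move=> u det; have := @prob_Ex_agree L [::] w E u det; rewrite big_nil mul1r.
by have -> : agree [::] w = setT; [apply/seteqP; split|rewrite setTI].
Qed.

(* Every outcome of such an event is certified by finitely many sites, so it is a
   countable union of cylinders. *)
Lemma measurable_finitely_witnessed (Q : config -> Prop) :
  (forall w, Q w -> exists L, forall w', (forall x, x \in L -> w' x = w x) -> Q w') ->
  measurable [set t | Q (X t)].
Proof.
move=> h.
pose good (c : seq (site * bool)) := forall w, (forall e, e \in c -> w e.1 = e.2) -> Q w.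
pose cyl (c : seq (site * bool)) : set T :=
  if `[< good c >] then [set t | forall e, e \in c -> X t e.1 = e.2] else set0.
have -> : [set t | Q (X t)] = \bigcup_c cyl c.
  apply/seteqP; split => t /=.
    move=> /h[L hL]; exists [seq (x, X t x) | x <- L] => //.
    rewrite /cyl asboolT; first by move=> e /mapP[x _ ->].
    move=> w hw; apply: hL => x xL; apply: (hw (x, X t x)); exact: map_f.
  by move=> [c _]; rewrite /cyl; case: asboolP => // gc /gc.
apply: countable_bigcupT_measurable => [|c]; first exact: countableP.
rewrite /cyl; case: asboolP => // _.
elim: c => [|e c IH].
  have -> : [set t | forall e, e \in [::] -> X t e.1 = e.2] = setT by apply/seteqP; split.
  exact: measurableT.
have -> : [set t | forall e', e' \in e :: c -> X t e'.1 = e'.2] =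
    [set t | X t e.1 = e.2] `&` [set t | forall e, e \in c -> X t e.1 = e.2].
  apply/seteqP; split => t /=.
    move=> h'; split; first by apply: h'; rewrite mem_head.
    by move=> y yL; apply: h'; rewrite inE yL orbT.
  by move=> [hx h'] y; rewrite inE => /orP[/eqP->//|/h'].
by apply: measurableI => //; exact: measurable_site.
Qed.

Lemma measurable_final_active m x : measurable [set t | final_active m (X t) x].
Proof.
apply: (@measurable_finitely_witnessed (fun w => final_active m w x)) => w.
(* Because both rules are finitary, the sites whose activity is certified by finitely many values of
   [w] form a closed set, so every active site is among them. *)
pose S : set site := [set y | exists L, forall w', (forall z, z \in L -> w' z = w z) ->
  final_active m w' y].
suff hS : closed_set m w S by move=> h; exact: (final_active_min hS h).
have extend L w' y : (forall z, z \in y :: L -> w' z = w z) -> w' y = w y /\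
    (forall z, z \in L -> w' z = w z).
  by move=> hz; split; [apply: hz; rewrite mem_head|move=> z zL; apply: hz; rewrite inE zL orbT].
have ecat L1 L2 w' : (forall z, z \in L1 ++ L2 -> w' z = w z) ->
    (forall z, z \in L1 -> w' z = w z) /\ (forall z, z \in L2 -> w' z = w z).
  by move=> hz; split => z zL; apply: hz; rewrite mem_cat zL ?orbT.
split; [|split].
- move=> y [-> w0]; exists [:: (0, 0)] => w' hw U [hU _]; apply: hU; split => //.
  by rewrite hw ?mem_head.
- move=> y wy h.
  have [z [Sz hz]] := occupied_rule_finitary h.
  case: Sz => L hL; exists (y :: L) => w' /extend[e1 e2].
  by apply: (final_active_closed m w').2.1; [rewrite e1|apply: hz; exact: hL].
- move=> y wy h.
  have [l [hl1 hl2]] := empty_rule_finitary h.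
  have [L hL] : exists L, forall w', (forall z, z \in L -> w' z = w z) ->
      forall z, z \in l -> final_active m w' z.
    elim: l hl1 {hl2 h} => [|z l IH] hl1; first by exists [::].
    have [|L1 hL1] := IH; first by move=> v vl; apply: hl1; rewrite inE vl orbT.
    have [L2 hL2] := hl1 z (mem_head _ _).
    exists (L1 ++ L2) => w' /ecat[e1 e2] v; rewrite inE => /orP[/eqP->|]; first exact: hL2.
    exact: hL1.
  exists (y :: L) => w' /extend[e1 e2].
  by apply: (final_active_closed m w').2.2; [rewrite e1|apply: hl2; exact: hL].
Qed.

Lemma measurable_indefinite_growth m : measurable [set t | indefinite_growth m (X t)].
Proof.
have -> : [set t | indefinite_growth m (X t)] =
   ~` \bigcup_x ~` [set t | final_active m (X t) x].
  apply/seteqP; split => t /=.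
    by rewrite /indefinite_growth => e [x _]; rewrite /= e; apply.
  move=> h; apply/seteqP; split => // x _; apply: contrapT => nx; apply: h; by exists x.
apply: measurableC; apply: countable_bigcupT_measurable => [|x]; first exact: countableP.
exact/measurableC/measurable_final_active.
Qed.

End Field.

(** * Upper bound *)

Definition co (ax : bool) (z : site) : int := if ax then z.2 else z.1.

(* [e ax sd] is the extent of the rectangle on side [sd] of axis [ax]. *)
Definition inrect (e : bool -> bool -> nat) (j : nat) (z : site) : bool :=
  [&& - (e false false + j)%N%:Z <= z.1, z.1 <= (e false true + j)%N%:Z,
      - (e true false + j)%N%:Z <= z.2 & z.2 <= (e true true + j)%N%:Z].

Definition unblocked (k : nat) (w : config) :=
  forall e, exists z, [/\ w z, inrect e k z & ~~ inrect e 0 z].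

(** If the margin of width [k] around a rectangle has no occupied site, the rectangle is closed. For
    [k >= 2], an empty site outside it meets it, within [N_k], along a single ray only, hence in at
    most [k - 1] sites. *)
Lemma growth_unblocked m w : valid_model m -> indefinite_growth m w -> unblocked (model_k m) w.
Proof.
move=> vm ig e; apply: contrapT => no.
have no' z : w z -> inrect e (model_k m) z -> inrect e 0 z.
  by move=> wz hz; apply/negPn/negP => hz0; apply: no; exists z.
pose S : set site := [set z | inrect e 0 z].
suff hS : closed_set m w S.
  have : final_active m w ((e false true).+1%:Z, 0) by rewrite ig.
  by move=> /(_ S hS); rewrite /S/= /inrect /=; lia.
split; [|split].
- by move=> x [-> _]; rewrite /S /= /inrect /=; lia.
- move=> x wx h; apply: no' => //.
  case: m vm h {ig no} => [k||] vm [y [Sy]]; move: Sy;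
    rewrite /S/= /inrect /l1dist /linfdist /=; case: x y {wx} => x1 x2 [y1 y2] /=; lia.
- move=> x wx h; rewrite /S /=.
  case: m vm h {ig no no'} => [k||] /= vm; last 2 first.
  + by case: x {wx} => x1 x2; rewrite /S/= /inrect /= => -[]; lia.
  + by case: x {wx} => x1 x2; rewrite /S/= /inrect /= => -[e1 [d1]]; lia.
  move=> [l [ul sl h1 h2]]; apply/negPn/negP => nx.
  have [ax [sd hx]] : exists ax (sd : bool), if sd then co ax x > (e ax true)%:Z else co ax x < - (e ax false)%:Z.
    move: nx; rewrite /inrect !negb_and -!ltNge !addn0 => /or4P[] h.
    + by exists false, false.
    + by exists false, true.
    + by exists true, false.
    + by exists true, true.
  have hy y : y \in l -> [/\ co (~~ ax) y = co (~~ ax) x,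
      (1 <= `|co ax y - co ax x| < k)%N & (if sd then co ax y < co ax x else co ax y > co ax x)].
    move=> yl; have := h1 y yl; have := h2 y yl; move: hx.
    rewrite /inNk /S/= /inrect /co; clear; case: x y => x1 x2 [y1 y2] /=.
    by move=> hx /and4P[? ? ? ?] hN; move: hx; case: ax; case: sd => /= hx; split; lia.
  pose f y := `|co ax y - co ax x|%N.
  have uf : uniq [seq f y | y <- l].
    rewrite map_inj_in_uniq// => y y' /hy[a1 b1 c1] /hy[a2 b2 c2]; rewrite /f => fe.
    have : co ax y = co ax y' by move: c1 c2 fe; clear; case: sd; lia.
    by move: a1; rewrite -a2; clear; case: y y' => y1 y2 [y1' y2']; case: ax => /= -> ->.
  have : {subset [seq f y | y <- l] <= iota 1 k.-1}.
    by move=> v /mapP[y /hy[_ b _] ->]; rewrite mem_iota /f; lia.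
  by move=> /(uniq_leq_size uf); rewrite size_map size_iota sl; lia.
Qed.

(** * Lists of directions and the blocks of lines that they cross *)

Section Paths.
Variables (k : nat) (x : nat -> nat).
Hypothesis xS : forall i, (x i < x i.+1)%N.

(* An axis and a side; a line is given by the axis to which it is orthogonal and by its
   coordinate on that axis. *)
Definition dir := (bool * bool)%type.
Definition line := (bool * int)%type.
Implicit Types (ds : seq dir) (d : dir) (f : line -> bool) (z : site) (e : line).

Definition sg (sd : bool) (c : nat) : int := if sd then c%:Z else - c%:Z.
Definition cnt ds d := count_mem d ds.
(** Lines are searched up to the next grid position on each orthogonal side, not the current one,
    because the rectangle in [unblocked_crossed] may end anywhere inside the next blocks. *)
Definition lo ds (ax : bool) := x (cnt ds (~~ ax, false)).+1.
Definition hi ds (ax : bool) := x (cnt ds (~~ ax, true)).+1.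

Definition block ds d : seq line :=
  [seq (d.1, sg d.2 c) | c <- iota (x (cnt ds d)).+1 (x (cnt ds d).+1 - x (cnt ds d))].

Fixpoint lines ds : seq line := if ds is d :: ds' then block ds' d ++ lines ds' else [::].

Definition inc_at (l h : nat) z e := (co e.1 z == e.2) && (- l%:Z <= co (~~ e.1) z <= h%:Z).

(** The range of a line is fixed when its block is crossed; later steps do not enlarge it. *)
Fixpoint inc ds z e : bool :=
  if ds is d :: ds' then
    if e \in block ds' d then inc_at (lo ds' d.1) (hi ds' d.1) z e else inc ds' z e
  else false.

(* [ds] lists the directions of the steps, latest first; each step crosses one block of
   lines, and demands that no [k] consecutive lines of the block are missed. *)
Fixpoint crossed ds f : bool :=
  if ds is d :: ds' then norun k 0 (map f (block ds' d)) && crossed ds' f else true.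

Lemma x_le i j : (i <= j)%N -> (x i <= x j)%N.
Proof. by elim: j => [|j IH]; [rewrite leqn0 => /eqP->|rewrite leq_eqVlt => /predU1P[->//|/IH h]; have := xS j; lia]. Qed.

Lemma x_lt_inv i j : (x i < x j)%N -> (i < j)%N.
Proof. by move=> h; rewrite ltnNge; apply/negP => /x_le; lia. Qed.

Lemma sg_inj sd : injective (sg sd).
Proof. by move=> a b; rewrite /sg; case: sd; lia. Qed.

Lemma blockP ds d e : e \in block ds d -> e.1 = d.1 /\
  exists2 c, (x (cnt ds d) < c <= x (cnt ds d).+1)%N & e.2 = sg d.2 c.
Proof.
move=> /mapP[c]; rewrite mem_iota => hc ->; split => //; exists c => //.
by have := xS (cnt ds d); lia.
Qed.

Lemma mem_block ds ax sd c : (x (cnt ds (ax, sd)) < c <= x (cnt ds (ax, sd)).+1)%N ->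
  (ax, sg sd c) \in block ds (ax, sd).
Proof. by move=> h; apply/mapP; exists c; rewrite ?mem_iota//; lia. Qed.

Lemma sg_neq sd sd' c c' : (0 < c)%N -> sg sd c = sg sd' c' -> sd = sd' /\ c = c'.
Proof. by rewrite /sg; case: sd; case: sd'; lia. Qed.

Lemma linesP ds e : e \in lines ds -> exists sd c,
  [/\ e.2 = sg sd c, (x 0 < c)%N & (c <= x (cnt ds (e.1, sd)))%N].
Proof.
elim: ds => // d ds IH /=; rewrite mem_cat => /orP[/blockP[e1 [c hc e2]]|/IH[sd [c [h1 h2 h3]]]].
  exists d.2, c; split => //; first by have := @x_le 0 (cnt ds d) isT; lia.
  by rewrite e1 -surjective_pairing /cnt/= eqxx add1n -/(cnt _ _); lia.
exists sd, c; split => //; apply: leq_trans h3 _; apply: x_le.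
by rewrite /cnt /= leq_addl.
Qed.

Lemma block_disjoint ds d e : e \in block ds d -> e \notin lines ds.
Proof.
move=> /blockP[e1 [c hc e2]]; apply/negP => /linesP[sd [c' [h1 h2 h3]]].
rewrite h1 in e2; have [h4 h5] := sg_neq (leq_ltn_trans (leq0n _) h2) e2.
by move: h3; rewrite h4 h5 e1 -surjective_pairing; lia.
Qed.

Lemma lines_uniq ds : uniq (lines ds).
Proof.
elim: ds => //= d ds IH; rewrite cat_uniq IH andbT map_inj_uniq ?iota_uniq/=; last first.
  by move=> a b [/sg_inj].
by apply/hasPn => e eL; apply/negP => /block_disjoint; rewrite eL.
Qed.

Lemma inc_cons ds d z e : e \in lines ds -> inc (d :: ds) z e = inc ds z e.
Proof. by move=> eL /=; case: ifP => // /block_disjoint; rewrite eL. Qed.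

Lemma inc_lines ds z e : inc ds z e -> e \in lines ds.
Proof. by elim: ds => //= d ds IH; rewrite mem_cat; case: ifP => //= _ /IH. Qed.

Lemma inc_co ds z e : inc ds z e -> e.2 = co e.1 z.
Proof. by elim: ds => //= d ds IH; case: ifP => //= _ /andP[/eqP]. Qed.

Lemma crossed_congr ds f f' : {in lines ds, f =1 f'} -> crossed ds f = crossed ds f'.
Proof.
elim: ds => //= d ds IH h; congr (norun k 0 _ && _).
  by apply/eq_in_map => e eb; apply: h; rewrite mem_cat eb.
by apply: IH => e eL; apply: h; rewrite mem_cat eL orbT.
Qed.

Lemma crossed_mono ds f f' : (forall e, f e -> f' e) -> crossed ds f -> crossed ds f'.
Proof.
move=> h; elim: ds => //= d ds IH /andP[h1 h2]; rewrite IH// andbT.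
apply: norun_mono h1; rewrite ?size_map// => n.
have [nb|nb] := ltnP n (size (block ds d)); last first.
  by move=> _; have -> : nth true [seq f' i | i <- block ds d] n = true
    by apply: nth_default; rewrite size_map.
by rewrite !(nth_map (true, 0))//; apply: h.
Qed.

Definition box (B : nat) : seq site :=
  [seq (a%:Z - B%:Z, b%:Z - B%:Z) | a <- iota 0 B.*2.+1, b <- iota 0 B.*2.+1].

Lemma mem_box B z : (z \in box B) = (`|z.1|%N <= B)%N && (`|z.2|%N <= B)%N.
Proof.
apply/allpairsP/idP => [[[a b] [ha hb ->]]|h].
  by rewrite !mem_iota /= in ha hb *; lia.
exists (`|(z.1 + B%:Z)%R|%N, `|(z.2 + B%:Z)%R|%N); split; rewrite ?mem_iota /=; try lia.
case: z h => z1 z2 /= h; apply/pair_equal_spec; lia.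
Qed.

Lemma box_uniq B : uniq (box B).
Proof.
apply: allpairs_uniq; rewrite ?iota_uniq// => -[a b] [a' b'] _ _ /= [h1 h2].
by congr pair; lia.
Qed.

Lemma cnt_size ds d : (cnt ds d <= size ds)%N.
Proof. exact: count_size. Qed.

Hypothesis k0 : (0 < k)%N.

(** If each of the four next blocks had [k] consecutive missed lines, take the rectangle that ends
    just before these four runs. Its margin has an occupied site, which lies on a line of one of the
    runs and within the range of that line, a contradiction. *)
Lemma unblocked_crossed B w n : unblocked k w -> (x n <= B)%N ->
  exists2 ds, size ds = n & crossed ds (hit (inc ds) (box B) w).
Proof.
move=> ub; elim: n => [|n IH] xB; first by exists [::].
have [|ds sz hds] := IH; first by apply: leq_trans xB; apply: ltnW.
suff [d hd] : exists d, norun k 0 (map (hit (inc (d :: ds)) (box B) w) (block ds d)).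
  exists (d :: ds); first by rewrite /= sz.
  apply/andP; split; first exact: hd.
  have e2 : crossed ds (hit (inc (d :: ds)) (box B) w) = crossed ds (hit (inc ds) (box B) w).
    by apply: crossed_congr => e eL; apply: eq_has => z; rewrite (inc_cons d z eL).
  by rewrite -e2 in hds; exact: hds.
apply: contrapT => no.
have run d : exists m, (m + k <= x (cnt ds d).+1 - x (cnt ds d))%N /\
    forall l, (l < k)%N -> ~~ hit (inc (d :: ds)) (box B) w (d.1, sg d.2 ((x (cnt ds d)).+1 + (m + l))).
  have /norunPn : ~~ norun k 0 (map (hit (inc (d :: ds)) (box B) w) (block ds d)).
    by apply/negP => h; apply: no; exists d.
  move=> /(_ k0 k0)[m]; rewrite !size_map size_iota add0n => mk h; exists m; split => // l lk.
  have := h l lk; rewrite cat0s /block -map_comp (nth_map 0) ?size_iota ?nth_iota//; lia.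
have [m hm] := choice run.
have cB d : (x (cnt ds d).+1 <= B)%N.
  by apply: leq_trans xB; apply: x_le; rewrite ltnS -sz cnt_size.
have [z [wz hz nz]] := ub (fun ax sd => x (cnt ds (ax, sd)) + m (ax, sd))%N.
pose E ax sd := (x (cnt ds (ax, sd)) + m (ax, sd))%N.
have Ek ax sd : (E ax sd + k <= x (cnt ds (ax, sd)).+1)%N.
  by have := (hm (ax, sd)).1; have := xS (cnt ds (ax, sd)); rewrite /E; lia.
have zr ax : - (E ax false + k)%N%:Z <= co ax z <= (E ax true + k)%N%:Z.
  by move: hz; rewrite /inrect /E /co; case: ax; lia.
have [ax [sd [c [cz hc]]]] : exists ax sd c, co ax z = sg sd c /\ (E ax sd < c <= E ax sd + k)%N.
  have [ax [sd hx]] : exists ax (sd : bool),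
      if sd then co ax z > (E ax true)%:Z else co ax z < - (E ax false)%:Z.
    move: nz; rewrite /inrect !negb_and -!ltNge !addn0 => /or4P[] h.
    - by exists false, false.
    - by exists false, true.
    - by exists true, false.
    - by exists true, true.
  exists ax, sd, `|co ax z|%N; have := zr ax; rewrite /sg.
  by case: sd hx; lia.
have c1 : (x (cnt ds (ax, sd)) < c)%N by move: hc; rewrite /E; lia.
have := (hm (ax, sd)).2 (c - (E ax sd).+1)%N ltac:(lia).
have -> : ((x (cnt ds (ax, sd))).+1 + (m (ax, sd) + (c - (E ax sd).+1)) = c)%N.
  by move: hc; rewrite /E; lia.
move=> /negP; apply; apply/hasP; exists z.
  rewrite mem_box; have := zr true; have := zr false; rewrite /co.
  have h ax' sd' := leq_trans (Ek ax' sd') (cB (ax', sd')).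
  by have := h true true; have := h true false; have := h false true; have := h false false; lia.
rewrite wz /= mem_block; last by have := Ek ax sd; lia.
rewrite /inc_at /= cz eqxx /=.
have := zr (~~ ax); have := Ek (~~ ax) false; have := Ek (~~ ax) true.
by rewrite /lo /hi; lia.
Qed.

End Paths.

(** * Sites that lie on two lines *)

Section Shared.
Variables (k : nat) (x : nat -> nat).
Hypothesis xS : forall i, (x i < x i.+1)%N.
Implicit Types (ds : seq dir) (d : dir) (z : site) (e : line).

Definition cellix := (dir * nat * (bool * nat))%type.

Definition in_cell (c : cellix) z := exists c1 c2,
  [/\ co c.1.1.1 z = sg c.1.1.2 c1, (x c.1.2 < c1 <= x c.1.2.+1)%N,
      co (~~ c.1.1.1) z = sg c.2.1 c2 & (x c.2.2 < c2 <= x c.2.2.+1)%N].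

Definition cell (c : cellix) : seq site :=
  [seq (if c.1.1.1 then (sg c.2.1 c2, sg c.1.1.2 c1) else (sg c.1.1.2 c1, sg c.2.1 c2))
   | c1 <- iota (x c.1.2).+1 (x c.1.2.+1 - x c.1.2), c2 <- iota (x c.2.2).+1 (x c.2.2.+1 - x c.2.2)].

Lemma mem_cell c z : in_cell c z -> z \in cell c.
Proof.
move=> [c1 [c2 [h1 r1 h2 r2]]]; apply/allpairsP; exists (c1, c2); rewrite !mem_iota /=.
split; try lia.
by move: h1 h2; rewrite /co; case: z => z1 z2; case: (c.1.1.1) => /= -> ->.
Qed.

Lemma size_cell c : size (cell c) =
  ((x c.1.2.+1 - x c.1.2) * (x c.2.2.+1 - x c.2.2))%N.
Proof. by rewrite size_allpairs !size_iota. Qed.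

(* A site on two lines lies in a cell given by the last of the two steps and by the next
   step, at that time, of one of the two orthogonal sides. *)
Fixpoint cells ds : seq cellix :=
  if ds is d :: ds' then
    (d, cnt ds' d, (true, cnt ds' (~~ d.1, true))) ::
    (d, cnt ds' d, (false, cnt ds' (~~ d.1, false))) :: cells ds'
  else [::].

Lemma size_cells ds : size (cells ds) = (size ds).*2.
Proof. by elim: ds => //= d ds ->. Qed.

(** The line [e] was searched only up to the next orthogonal grid position of its time, so a
    coordinate in a block not yet crossed on that side can only be in the very next block. *)
Lemma older_cell ds z e sd j c : inc x ds z e -> (cnt ds (~~ e.1, sd) <= j)%N ->
  co (~~ e.1) z = sg sd c -> (x j < c <= x j.+1)%N -> exists2 cl, cl \in cells ds & in_cell cl z.
Proof.
elim: ds => //= d ds IH; case: ifP => [eb|_] he hj hc cj; last first.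
  have [|cl h1 h2] := IH he _ hc cj; last by exists cl => //; rewrite !inE h1 !orbT.
  by apply: leq_trans hj; rewrite /cnt /= leq_addl.
have [e1 [b hb e2]] := blockP xS eb.
have /andP[/eqP h1 h2] := he.
rewrite e1 in hj hc h2.
have hle : (cnt ds (~~ d.1, sd) <= j)%N by apply: leq_trans hj; rewrite /cnt /= leq_addl.
have hj' : (j < (cnt ds (~~ d.1, sd)).+1)%N.
  apply: (x_lt_inv xS).
  move: h2; rewrite /lo /hi hc /sg => h2; move: cj h2; clear; case: sd => cj h2; lia.
have ej : j = cnt ds (~~ d.1, sd) by lia.
exists (d, cnt ds d, (sd, cnt ds (~~ d.1, sd))).
  by case: (sd); rewrite !inE eqxx ?orbT.
exists b, c; split => //=; last by rewrite -ej.
by rewrite -e1 h1.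
Qed.

Lemma shared_cell ds z e e' : inc x ds z e -> inc x ds z e' -> e.1 != e'.1 ->
  exists2 cl, cl \in cells ds & in_cell cl z.
Proof.
move=> + + ne; elim: ds => //= d ds IH.
have wk : (exists2 cl, cl \in cells ds & in_cell cl z) -> exists2 cl,
    cl \in [:: (d, cnt ds d, (true, cnt ds (~~ d.1, true))),
      (d, cnt ds d, (false, cnt ds (~~ d.1, false))) & cells ds] & in_cell cl z.
  by move=> [cl h1 h2]; exists cl => //; rewrite !inE h1 !orbT.
have half e1 e2 : e1 \in block x ds d -> inc_at (lo x ds d.1) (hi x ds d.1) z e1 -> inc x ds z e2 ->
    e1.1 != e2.1 -> exists2 cl, cl \in cells ds & in_cell cl z.
  move=> /(blockP xS)[a1 [b hb a2]] /andP[/eqP h1 _] h2 n12.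
  have e12 : ~~ e2.1 = d.1 by move: n12; rewrite a1; case: (d.1); case: (e2.1).
  apply: (@older_cell _ _ _ d.2 (cnt ds d) b h2) => //.
    by rewrite e12 -surjective_pairing.
  by rewrite e12 -a1 h1.
case: ifP => eb; case: ifP => eb' he he'.
- have [a _] := blockP xS eb; have [a' _] := blockP xS eb'.
  by rewrite a a' eqxx in ne.
- by apply: wk; apply: half eb he he' ne.
- by apply: wk; apply: half eb' he' he _; rewrite eq_sym.
- by apply: wk; apply: IH.
Qed.

End Shared.

(** Each point is charged to one cell containing it; a cell of [c] points, each of weight at most
    [K / c], is charged at most [K]. *)
Lemma sum_covered (R : realType) (I C : eqType) (l : seq I) (cs : seq C) (cell : C -> seq I)
    (f : I -> R) (K : R) :
  uniq l -> 0 <= K -> (forall z, z \in l -> 0 <= f z) ->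
  (forall z, z \in l -> exists2 c, c \in cs & z \in cell c) ->
  (forall c z, z \in l -> z \in cell c -> (size (cell c))%:R * f z <= K) ->
  \sum_(z <- l) f z <= K * (size cs)%:R.
Proof.
move=> ul K0 f0 hc hK; elim: cs l ul f0 hc hK => [|c cs IH] l ul f0 hc hK.
  rewrite big1_seq ?mulr0// => z /andP[_ zl]; by have [] := hc z zl.
rewrite (bigID (mem (cell c)))/= -natr1 mulrDr mulr1 addrC; apply: lerD.
  rewrite -big_filter; apply: IH.
  - exact: filter_uniq.
  - by move=> z; rewrite mem_filter => /andP[_]; apply: f0.
  - move=> z; rewrite mem_filter => /andP[zc zl]; have [c' h1 h2] := hc z zl.
    by exists c' => //; move: h1; rewrite inE => /orP[/eqP e|//]; rewrite e in h2; rewrite /= h2 in zc.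
  - by move=> c' z; rewrite mem_filter => /andP[_]; apply: hK.
rewrite -big_filter; set lf := [seq i <- l | _].
have sz : (size lf <= size (cell c))%N.
  by apply: uniq_leq_size; [exact: filter_uniq|move=> z; rewrite mem_filter => /andP[]].
have [s0|s0] := posnP (size lf); first by rewrite (size0nil s0) big_nil.
have c0 : 0 < (size (cell c))%:R :> R by rewrite ltr0n; apply: leq_trans sz.
apply: (@le_trans _ _ (\sum_(z <- lf) (K / (size (cell c))%:R))).
  rewrite big_seq [leRHS]big_seq; apply: ler_sum => z; rewrite mem_filter => /andP[zc zl].
  by rewrite ler_pdivlMr// mulrC; apply: hK.
rewrite big_const_seq count_predT iter_addr_0 -[leLHS]mulr_natl mulrCA ler_piMr//.
by rewrite ler_pdivrMr// mul1r ler_nat.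
Qed.

Lemma sg_abs sd (m n : nat) : (m < n)%N -> (m <= `|sg sd n|)%N.
Proof. by rewrite /sg; case: sd; lia. Qed.

(** * Probability that a list of directions is crossed *)

Section CrossedProb.
Variables (R : realType) (k : nat) (x : nat -> nat) (s : R).
Hypothesis k0 : (0 < k)%N.
Hypothesis xS : forall i, (x i < x i.+1)%N.
Hypothesis s0 : 0 < s.
Implicit Types (ds : seq dir) (d : dir) (z : site) (e : line).

Definition Hs ds ax := (lo x ds ax + hi x ds ax).+1.

Fixpoint bl ds e : R :=
  if ds is d :: ds' then
    if e \in block x ds' d then 1 - expR (- (s * (Hs ds' d.1)%:R)) else bl ds' e
  else 1.

Fixpoint cost ds : R :=
  if ds is d :: ds' then
    ((x (cnt ds' d).+1 - x (cnt ds' d))%N%:R - (k - 1)%N%:R) * g k (s * (Hs ds' d.1)%:R) + cost ds'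
  else 0.

Lemma sH_gt0 ds ax : 0 < s * (Hs ds ax)%:R.
Proof. by rewrite mulr_gt0// ltr0n. Qed.

Lemma bl_bounds ds e : 0 < bl ds e <= 1.
Proof.
elim: ds => [|d ds IH] /=; first by rewrite ltr01 lexx.
case: ifP => // _; rewrite gerBl expR_ge0 andbT subr_gt0 expR_lt1 oppr_lt0.
exact: sH_gt0.
Qed.

Lemma inc_range ds z e : inc x ds z e -> exists l h,
  [/\ bl ds e = 1 - expR (- (s * (l + h).+1%:R)), - l%:Z <= co (~~ e.1) z, co (~~ e.1) z <= h%:Z &
    forall z', inc x ds z' e -> - l%:Z <= co (~~ e.1) z' <= h%:Z].
Proof.
elim: ds => //= d ds IH; case: ifP => [eb|_]; last exact: IH.
have [e1 _] := blockP xS eb.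
move=> /andP[_ /andP[h1 h2]]; exists (lo x ds d.1), (hi x ds d.1); split => //.
by move=> z' /andP[_ ->].
Qed.

Lemma lprob_bl ds l e : uniq l -> lprob (inc x ds) (1 - expR (- s)) l e <= bl ds e.
Proof.
move=> ul; rewrite /lprob -size_filter.
set lf := [seq z <- l | _]; have ulf : uniq lf by exact: filter_uniq.
have hl z : z \in lf -> inc x ds z e by rewrite mem_filter => /andP[].
case: lf ulf hl => [|z lf] ulf hl.
  by rewrite expr0 subrr; have /andP[/ltW] := bl_bounds ds e.
have [lw [h [-> _ _ hb]]] := inc_range (hl z (mem_head _ _)).
set lz := z :: lf in ulf hl *.
rewrite lerD2l lerN2 opprB addrC subrK -expRM_natr ler_expR mulNr lerN2 ler_pM2l// ler_nat.
have -> : (lw + h).+1 = size [seq n%:Z - lw%:Z | n <- iota 0 (lw + h).+1] by rewrite size_map size_iota.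
rewrite -(size_map (co (~~ e.1))); apply: uniq_leq_size.
  rewrite map_inj_in_uniq// => a b al bl cab.
  have := inc_co (hl a al); rewrite (inc_co (hl b bl)).
  by move: cab; clear; case: a b => a1 a2 [b1 b2]; rewrite /co; case: (e.1) => /= -> ->.
move=> c /mapP[a al ->]; have := hb a (hl a al) => /andP[h1 h2].
apply/mapP; exists `|(co (~~ e.1) a + lw%:Z)%R|%N; first by rewrite mem_iota /=; lia.
by lia.
Qed.

Lemma inc_bl ds z e : inc x ds z e ->
  1 - expR (- (s * (`|co (~~ e.1) z|%N)%:R)) <= bl ds e.
Proof.
move=> /inc_range[l [h [-> h1 h2 _]]].
rewrite lerD2l lerN2 ler_expR lerN2 ler_pM2l// ler_nat.
by lia.
Qed.

Lemma crossed_dep ds : dep_on (lines x ds) (fun v => (crossed k x ds v)%:R : R).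
Proof. by move=> v v' h; rewrite (crossed_congr _ h). Qed.

Lemma Ex_crossed ds w : Ex (bl ds) (lines x ds) (fun v => (crossed k x ds v)%:R) w <= expR (- cost ds).
Proof.
elim: ds w => [|d ds IH] w /=; first by rewrite oppr0 expR0.
rewrite (Ex_congr (b := bl (d :: ds)) (G := fun v =>
  (norun k 0 (map v (block x ds d)))%:R * (crossed k x ds v)%:R)) => [|//|v _]; last first.
  by rewrite -natrM mulnb.
rewrite Ex_indep; last 2 first.
- move=> v v' h; congr (_ (norun _ _ _))%:R; apply/eq_in_map => e eb; apply: h.
  exact: (block_disjoint xS eb).
- exact: crossed_dep.
rewrite opprD expRD; apply: ler_pM.
- apply: Ex_ge0 => [e _|v]; last by rewrite ler0n.
  by have /andP[/ltW-> ->] := bl_bounds (d :: ds) e.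
- apply: Ex_ge0 => [e _|v]; last by rewrite ler0n.
  by have /andP[/ltW-> ->] := bl_bounds (d :: ds) e.
- set z := s * (Hs ds d.1)%:R.
  have z0 : 0 < z by exact: sH_gt0.
  set i := (x (cnt ds d)).+1; set n := (x (cnt ds d).+1 - x (cnt ds d))%N.
  have -> : Ex (bl (d :: ds)) (block x ds d) (fun v => (norun k 0 (map v (block x ds d)))%:R) w =
      Zf k (fun=> 0) (fun=> 1 - expR (- z)) i 0 n.
    rewrite -(Ex_wt k (ln := fun c => (d.1, sg d.2 c)) (fun=> 1 - expR (- z)) _ _ _ _ w); last first.
      by move=> a b [/sg_inj].
    apply: Ex_congr => [e eb|v _]; first by rewrite /= eb.
    by rewrite wt_norun /block -map_comp.
  have := @Zf_upper R k k0 (expR (- z)) (expR (g k z)) i n.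
  rewrite expR_ge0 -expR0 !ler_expR oppr_le0 (ltW z0) (ltW (g_gt0 k0 z0)) expR0.
  move=> /(_ isT isT (g_char k0 z0)); rewrite -!expRM_natl => h.
  rewrite -(ler_pM2r (expR_gt0 (n%:R * g k z))); apply: le_trans h _.
  by rewrite -expRD ler_expR mulrBl; lra.
- apply: le_trans (IH w).
  rewrite le_eqVlt; apply/orP; left; apply/eqP; apply: Ex_congr => // e eL /=.
  by case: ifP => // /(block_disjoint xS); rewrite eL.
Qed.

Variables (A K : R).
Hypothesis hA : forall i, (x i.+1 - x i)%N%:R <= A * (1 - expR (- (s * (x i)%:R))).
Hypothesis hK : (1 - expR (- s)) * A ^+ 2 <= K.
Hypothesis x0 : (0 < x 0)%N.

(** Shared sites come first in the list, as [Ex_lines_shared] asks. With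
    [theta i = 1 - exp (- s x_i)], a cell of blocks [i] and [j] has at most [A^2 theta_i theta_j]
    sites, each costing at most [p / (theta_i theta_j)], so a cell costs at most [p A^2 <= K]; there
    are two cells per step. *)
Lemma Ex_crossed_shared ds (B : nat) : exists2 L, uniq L /\ L =i box B & forall w,
  Ex (fun=> 1 - expR (- s)) L (fun w => (crossed k x ds (hit (inc x ds) L w))%:R) w <=
  expR (K * (size ds).*2%:R - cost ds).
Proof.
pose sh z := inc x ds z (false, z.1) && inc x ds z (true, z.2).
pose lC := [seq z <- box B | sh z]; pose lN := [seq z <- box B | predC sh z].
have pm : perm_eq (lC ++ lN) (box B) by rewrite perm_filterC.
have uL : uniq (lC ++ lN) by rewrite (perm_uniq pm) box_uniq.
exists (lC ++ lN); first by split => //; exact: perm_mem.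
move=> w; set p := 1 - expR (- s).
have p01 : 0 <= p <= 1.
  by rewrite /p subr_ge0 gerBl expR_ge0 -expR0 ler_expR oppr_le0 ltW.
have /andP[p0 p1] := p01.
have K0 : 0 <= K by apply: le_trans hK; apply: mulr_ge0 => //; exact: sqr_ge0.
pose kap z := (bl ds (false, z.1))^-1 * (bl ds (true, z.2))^-1.
have b0 e : 0 < bl ds e by have /andP[] := bl_bounds ds e.
have kap0 z : 0 <= kap z by apply: mulr_ge0; rewrite invr_ge0 ltW.
have := @Ex_lines_shared R _ _ (inc x ds) p p01 lC lN (lines x ds)
  (fun v => (crossed k x ds v)%:R) (bl ds) kap (fun=> false) w (fun=> false) uL
  (lines_uniq xS ds) (@crossed_dep ds).
have step : \prod_(z <- lC) (1 + p * kap z) *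
   Ex (fun e => if false then 1 else bl ds e) (lines x ds) (fun v => (crossed k x ds v)%:R) (fun=> false)
   <= expR (K * (size ds).*2%:R - cost ds).
  rewrite expRD; apply: ler_pM => //.
  - by apply: prodr_ge0 => z _; apply: addr_ge0 => //; apply: mulr_ge0.
  - apply: Ex_ge0 => [e _|v]; last by rewrite ler0n.
    by have /andP[/ltW-> ->] := bl_bounds ds e.
  - apply: (@le_trans _ _ (expR (\sum_(z <- lC) p * kap z))).
      rewrite expR_sum; apply: ler_prod => z _; rewrite expR_ge1Dx andbT.
      by apply: addr_ge0 => //; apply: mulr_ge0.
    rewrite ler_expR -size_cells.
    apply: (@sum_covered _ _ _ _ _ (cell x)) => //.
    + by apply: filter_uniq; exact: box_uniq.
    + by move=> z _; apply: mulr_ge0.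
    + move=> z; rewrite mem_filter => /andP[/andP[i1 i2] _].
      have [c c1 c2] := shared_cell xS i1 i2 isT.
      by exists c => //; apply: mem_cell.
    + move=> c z; rewrite mem_filter => /andP[/andP[i1 i2] _] /allpairsP[[c1 c2]].
      rewrite !mem_iota /= => -[r1 r2 ez].
      rewrite size_cell natrM /kap.
      pose th i := 1 - expR (- (s * (x i)%:R)).
      have th0 i : 0 < th i.
        rewrite /th subr_gt0 expR_lt1 oppr_lt0 mulr_gt0// ltr0n.
        by apply: leq_trans x0 _; exact: x_le.
      have thb i e : inc x ds z e -> (x i <= `|co (~~ e.1) z|)%N -> (bl ds e)^-1 <= (th i)^-1.
        move=> ie hi; rewrite lef_pV2 ?posrE//; apply: le_trans (inc_bl ie).
        by rewrite lerD2l lerN2 ler_expR lerN2 ler_pM2l// ler_nat.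
      have /andP[l1 _] := r1; have /andP[l2 _] := r2.
      have [i [j [ei ej es]]] : exists i j, [/\ (bl ds (false, z.1))^-1 <= (th i)^-1,
          (bl ds (true, z.2))^-1 <= (th j)^-1 &
          ((x c.1.2.+1 - x c.1.2)%N%:R * (x c.2.2.+1 - x c.2.2)%N%:R : R) =
          (x i.+1 - x i)%N%:R * (x j.+1 - x j)%N%:R].
        case e1 : (c.1.1.1) ez => ez.
          by exists c.1.2, c.2.2; split => //; apply: thb => //; rewrite ez /co; exact: sg_abs.
        exists c.2.2, c.1.2; split; last by rewrite mulrC.
          by apply: thb => //; rewrite ez /co; exact: sg_abs.
        by apply: thb => //; rewrite ez /co; exact: sg_abs.
      rewrite es.
      have st : (x i.+1 - x i)%N%:R * (x j.+1 - x j)%N%:R <= A ^+ 2 * (th i * th j).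
        have -> : A ^+ 2 * (th i * th j) = (A * th i) * (A * th j) by ring.
        by apply: ler_pM => //; apply: hA.
      apply: (@le_trans _ _ (A ^+ 2 * (th i * th j) * (p * ((th i)^-1 * (th j)^-1)))).
        have pk : 0 <= p * kap z := mulr_ge0 p0 (kap0 z).
        apply: ler_pM => //.
        apply: ler_wpM2l => //; apply: ler_pM => //; rewrite invr_ge0 ltW//; exact: b0.
      have -> : A ^+ 2 * (th i * th j) * (p * ((th i)^-1 * (th j)^-1)) = p * A ^+ 2.
        have ti := lt0r_neq0 (th0 i); have tj := lt0r_neq0 (th0 j).
        by field; rewrite ti tj.
      exact: hK.
  - exact: Ex_crossed.
move=> h; apply: le_trans step; apply: h.
- by move=> v v' h; rewrite ler_nat; case e : (crossed _ _ _ v) => //; rewrite (crossed_mono h e).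
- by move=> v; rewrite ler0n.
- move=> z; rewrite mem_filter => /andP[nz _] e e' _ _ he he'.
  have h1 := inc_co he; have h2 := inc_co he'.
  case: e e' he he' h1 h2 => [a c] [a' c'] /= he he' h1 h2.
  subst c c'; case: a a' he he' => -[]//= he he'; exfalso; move/negP: nz; apply;
    by rewrite /sh; apply/andP.
- by move=> e _; exact: bl_bounds.
- move=> e _; apply: lprob_bl; exact/filter_uniq/box_uniq.
- move=> z; rewrite mem_filter => /andP[/andP[i1 i2] _]; rewrite -big_filter.
  have -> : \prod_(e <- [seq e <- lines x ds | inc x ds z e]) (bl ds e)^-1 = kap z => //.
  rewrite (perm_big [:: (false, z.1); (true, z.2)])/=; first by rewrite !big_cons big_nil mulr1.
  apply: uniq_perm => //; first exact/filter_uniq/lines_uniq.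
  move=> e; rewrite mem_filter !inE; apply/andP/orP => [[ie _]|].
    by have := inc_co ie; case: (e) => -[] c /= ->; rewrite /co /= eqxx; [right|left].
  have l1 := inc_lines i1; have l2 := inc_lines i2.
  by move=> [] /eqP ->.
Qed.

End CrossedProb.

(** * The grid *)

Section Grid.
Local Open Scope nat_scope.
Variable N : nat.
Hypothesis N0 : 0 < N.

(** [N] will be of order [s^(-1/2)], so that [N^2] is of order [1/s]: positions grow geometrically,
    with ratio about [1 + 1/N], up to [N^2], and by [N] per step afterwards. *)
Fixpoint grid i := if i is j.+1 then grid j + minn (grid j) (N ^ 2) %/ N else N.

Lemma grid_ge i : N <= grid i.
Proof. by elim: i => //= i IH; apply: leq_trans IH (leq_addr _ _). Qed.

Lemma grid_minge i : N <= minn (grid i) (N ^ 2).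
Proof. by rewrite leq_min grid_ge -{1}(expn1 N) leq_pexp2l. Qed.

Lemma gridS i : grid i < grid i.+1.
Proof. by rewrite /= -[ltnLHS]addn0 ltn_add2l divn_gt0// grid_minge. Qed.

Lemma grid_step_le i : (grid i.+1 - grid i) * N <= minn (grid i) (N ^ 2).
Proof. by rewrite /= addKn leq_divM. Qed.

Lemma grid_far_step i j : N ^ 2 <= grid i -> grid i + j * N <= grid (i + j).
Proof.
move=> h; elim: j => [|j IH]; first by rewrite addn0 mul0n addn0.
rewrite addnS /= (minn_idPr _); last by apply: leq_trans h _; apply: leq_trans IH; apply: leq_addr.
by rewrite expnS expn1 mulnK// mulSn; move: IH; lia.
Qed.

(** The quotient by [N] is rounded down, possibly to about half of its exact value; hence [2 * N]
    steps for a doubling instead of [N]. *)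
Lemma grid_double i : minn (2 * grid i) (N ^ 2) <= grid (i + 2 * N).
Proof.
have mono a b : a <= b -> grid a <= grid b := @x_le _ gridS a b.
have st j : minn (grid i + j * (grid i %/ N)) (N ^ 2) <= grid (i + j).
  elim: j => [|j IH]; first by rewrite mul0n !addn0 geq_minl.
  have [h|h] := leqP (N ^ 2) (grid (i + j)).
    by apply: leq_trans (geq_minr _ _) _; apply: leq_trans h (mono _ _ _); rewrite addnS.
  rewrite addnS /= (minn_idPl (ltnW h)).
  have q : grid i %/ N <= grid (i + j) %/ N by apply: leq_div2r; apply: mono; apply: leq_addr.
  by move: IH q; rewrite mulSn; move: (j * _); move: (N ^ 2) (grid _ %/ N) (grid _ %/ N); lia.
apply: leq_trans (st _); rewrite leq_min geq_minr andbT.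
apply: leq_trans (geq_minl _ _) _.
rewrite mul2n -addnn leq_add2l.
have := divn_eq (grid i) N; have := ltn_pmod (grid i) N0.
have : 0 < grid i %/ N by rewrite divn_gt0// grid_ge.
by move: (grid i) (grid i %/ N) (grid i %% N); nia.
Qed.

(** Half of the [4 N m] steps make [m] doublings from [N] to [N^2]; the other [2 N m] steps add [N]
    each. *)
Lemma grid_far m : N <= 2 ^ m -> N ^ 2 * (1 + 2 * m) <= grid (4 * N * m).
Proof.
move=> h.
have st j : minn (2 ^ j * N) (N ^ 2) <= grid (2 * N * j).
  elim: j => [|j IH]; first by rewrite mul1n muln0 geq_minl.
  rewrite mulnS addnC; apply: leq_trans (grid_double _).
  by rewrite expnS -mulnA; move: IH; move: (2 ^ j * N) (N ^ 2) (grid _); lia.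
have h2 : N ^ 2 <= grid (2 * N * m).
  apply: leq_trans (st m); rewrite leq_min leqnn andbT expnS expn1.
  by rewrite leq_mul2r h orbT.
have -> : 4 * N * m = 2 * N * m + 2 * N * m by lia.
apply: leq_trans (grid_far_step _ h2); move: h2; move: (grid _) => G; lia.
Qed.

End Grid.

Lemma grid_exists N m : (0 < N)%N -> (N <= 2 ^ m)%N -> exists x : nat -> nat,
  [/\ forall i, (x i < x i.+1)%N, x 0 = N, forall i, (N <= x i)%N,
      forall i, ((x i.+1 - x i) * N <= minn (x i) (N ^ 2))%N &
      (N ^ 2 * (1 + 2 * m) <= x (4 * N * m)%N)%N].
Proof.
move=> N0 h; exists (grid N); split=> //.
- exact: gridS.
- exact: grid_ge.
- exact: grid_step_le.
- exact: grid_far.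
Qed.

Lemma cnt_pigeon (ds : seq dir) q : size ds = (4 * q)%N -> exists d, (q <= cnt ds d)%N.
Proof.
move=> sz; apply: contrapT => h.
have hd d : (cnt ds d < q)%N by rewrite ltnNge; apply/negP => ?; apply: h; exists d.
have : (cnt ds (false, false) + cnt ds (false, true) + cnt ds (true, false) + cnt ds (true, true))%N = size ds.
  by clear; elim: ds => //= -[[] []] ds; rewrite /cnt /=; lia.
have := hd (false, false); have := hd (false, true); have := hd (true, false); have := hd (true, true).
rewrite sz; lia.
Qed.

(** * A potential that bounds the cost of a path *)

Section Potential.
Variables (R : realType) (k : nat).
Hypothesis k0 : (0 < k)%N.
Implicit Types a b : R.

(* The integral of [g] along the cheapest monotone path from [(a, b)]: first along the
   shorter side up to the diagonal, then along the diagonal. *)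
Definition pot a b : R :=
  2 * GG k (Num.max a b) - (Num.max a b - Num.min a b) * g k (Num.max a b).

Lemma potC a b : pot a b = pot b a.
Proof. by rewrite /pot maxC minC. Qed.

(** Equality as long as [a] is the shorter side. Otherwise the trapezoid bound on [GG] reduces the
    claim to the convexity of [g] at [b <= a <= a']. *)
Lemma pot_step a a' b : 0 < a -> 0 < b -> a <= a' -> pot a' b - pot a b <= (a' - a) * g k b.
Proof.
have low c c' : 0 < c -> c <= c' -> c' <= b -> pot c' b - pot c b <= (c' - c) * g k b.
  move=> c0 cc cb; rewrite /pot !max_r ?min_l//; try exact: le_trans cc cb.
  by rewrite le_eqVlt; apply/orP; left; apply/eqP; ring.
have high c c' : b <= c -> 0 < b -> c <= c' -> pot c' b - pot c b <= (c' - c) * g k b.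
  move=> bc b0 cc; have bc' := le_trans bc cc; have c0 := lt_le_trans b0 bc.
  rewrite /pot !max_l ?min_r//.
  have h1 := GG_trapezoid k0 c0 cc.
  have h2 : (c' - b) * g k c <= (c' - c) * g k b + (c - b) * g k c'.
    by apply: (g_convex k0 b0); rewrite bc cc.
  move: h1 h2; clear; set G1 := GG k c; set G2 := GG k c'; set g1 := g k c; set g2 := g k c'; set g3 := g k b.
  by move=> h1 h2; lra.
move=> a0 b0 aa.
have [ba|ab] := leP b a; first exact: high.
have [ab'|ba'] := leP a' b; first exact: low.
have h1 := low a b a0 (ltW ab) (lexx _); have h2 := high b a' (lexx _) b0 (ltW ba').
by move: h1 h2; clear; set p1 := pot a b; set p2 := pot b b; set p3 := pot a' b; set gg := g k b => h1 h2; lra.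
Qed.

Lemma expR_half_le2 : expR (1 / 2) <= 2 :> R.
Proof.
have h := @expR_ge1Dx R (- (1 / 2)); rewrite -[1 / 2]opprK expRN invf_ple ?posrE ?expR_gt0//.
by apply: le_trans h; lra.
Qed.

(** With [m] the longer side and [v = exp (- m / 2)], the tail of [GG] loses at most [8 v], and the
    term with [g] at most [4 v], since [m v <= 2]. *)
Lemma pot_far a b (M : R) : 1 <= M -> 0 < a -> 0 < b -> M <= Num.max a b ->
  2 * lam R k - 12 * expR (- (M / 2)) <= pot a b.
Proof.
move=> M1 a0 b0; rewrite /pot.
have mn0 : 0 < Num.min a b by rewrite lt_min a0.
have mnm : Num.min a b <= Num.max a b by rewrite le_max ge_min lexx.
move: (Num.min a b) mn0 mnm => mn mn0; move: (Num.max a b) => m mnm Mm.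
have m1 := le_trans M1 Mm; have m0 : 0 < m by lra.
have gm := g_le_ln k0 m0; have gm0 := g_gt0 k0 m0.
have h1 := GG_tail k0 m1.
have eM : expR (- (m / 2)) <= expR (- (M / 2)) by rewrite ler_expR; lra.
set v := expR (- (m / 2)) in eM.
have v0 : 0 < v by exact: expR_gt0.
have e1 : expR (1 - m) <= 2 * v.
  have -> : expR (1 - m) = expR (1 - m / 2) * v by rewrite /v -!expRD; congr expR; lra.
  rewrite ler_pM2r//; apply: le_trans expR_half_le2; rewrite ler_expR; lra.
have mv : m * v <= 2.
  have := @expR_ge1Dx R (m / 2); rewrite /v expRN => h.
  rewrite ler_pdivrMr ?expR_gt0//; lra.
have u2 : expR (- m) = v * v by rewrite /v -expRD; congr expR; lra.
have uh : expR (- m) <= 1 / 2.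
  have := @expR_ge1Dx R m; rewrite expRN => h.
  by rewrite -[leRHS]invf_div divr1 lef_pV2 ?posrE ?expR_gt0//; lra.
have g2 : g k m <= 2 * (v * v).
  apply: le_trans gm _; rewrite -u2.
  have p0 : 0 < 1 - expR (- m) by lra.
  rewrite -lnV ?posrE//.
  have : ln (1 - expR (- m))^-1 <= (1 - expR (- m))^-1 - 1.
    have i0 : 0 < (1 - expR (- m))^-1 by rewrite invr_gt0.
    move: (_^-1) i0 => i i0; have := @le_ln1Dx R (i - 1).
    by rewrite (_ : 1 + (i - 1) = i) => [h|]; [apply: h|]; lra.
  move/le_trans; apply; rewrite lerBlDr -div1r ler_pdivrMr//.
  move: uh (expR_ge0 (- m)); move: (expR _) => u; nra.
have mg : (m - mn) * g k m <= 4 * v.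
  apply: (@le_trans _ _ (m * (2 * (v * v)))).
    by apply: ler_pM; rewrite ?(ltW gm0)//; lra.
  have := ler_wpM2r (ltW v0) mv; lra.
lra.
Qed.

End Potential.

Section CostBound.
Variables (R : realType) (k : nat) (x : nat -> nat) (s kap : R).
Hypothesis k0 : (0 < k)%N.
Hypothesis xS : forall i, (x i < x i.+1)%N.
Hypothesis x0 : (0 < x 0)%N.
Hypothesis s0 : 0 < s.
Hypothesis hkap : forall i j, (x i.+1 + x j.+1).+1%:R <= kap * (x i + x j)%:R.
Implicit Types (ds : seq dir) (d : dir).

Definition len ds (ax : bool) := (x (cnt ds (ax, false)) + x (cnt ds (ax, true)))%N.

Let kap0 : 0 < kap.
Proof.
have h := hkap 0 0; have p : 0 < (x 0 + x 0)%:R :> R by rewrite ltr0n addn_gt0 x0.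
have q : 0 < (x 1 + x 1).+1%:R :> R by rewrite ltr0n.
by rewrite -(pmulr_lgt0 _ p); apply: lt_le_trans h.
Qed.

Let pl ds := pot k (kap * s * (len ds false)%:R) (kap * s * (len ds true)%:R).

(** A telescoping sum of [pot_step]. Lines of a block have at most [kap] times as many sites as the
    current extent, so the slope of the potential at lengths enlarged by [kap] is at most the rate
    in [cost]. The [k - 1] lines lost per step are charged at the largest rate, that of [x 0]. *)
Lemma cost_ge ds :
  pl ds - pl [::] <= kap * s * (cost k x s ds + (k - 1)%N%:R * (size ds)%:R * g k (s * (x 0)%:R)).
Proof.
have ks0 : 0 < kap * s by rewrite mulr_gt0.
have plax ax ds' : pl ds' = pot k (kap * s * (len ds' ax)%:R) (kap * s * (len ds' (~~ ax))%:R).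
  by rewrite /pl; case: ax; [exact: potC|reflexivity].
have xge i : (x 0 <= x i)%N by exact: x_le.
have len0 ds' ax : 0 < kap * s * (len ds' ax)%:R.
  by rewrite mulr_gt0// ltr0n addn_gt0 (leq_trans x0 (xge _)).
elim: ds => [|d ds IH]; first by rewrite /= subrr add0r mulr0 mul0r mulr0.
have c1 : cnt (d :: ds) d = (cnt ds d).+1 by rewrite /cnt /= eqxx.
have c2 d' : d != d' -> cnt (d :: ds) d' = cnt ds d' by rewrite /cnt /= => /negbTE ->.
have xS' i : (x i.+1 = x i + (x i.+1 - x i))%N by rewrite subnKC// ltnW.
have len1 : len (d :: ds) d.1 = (len ds d.1 + (x (cnt ds d).+1 - x (cnt ds d)))%N.
  case: d c1 c2 => ax sd c1 c2; rewrite /len [(_, _).1]/=; case: sd c1 c2 => c1 c2.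
    by rewrite c1 (c2 (ax, false)) ?xpair_eqE ?andbF// -addnA -xS'.
  by rewrite c1 (c2 (ax, true)) ?xpair_eqE ?andbF// addnAC -xS'.
have len2 : len (d :: ds) (~~ d.1) = len ds (~~ d.1).
  by rewrite /len !c2//; apply/eqP => /(congr1 fst) /=; case: (d.1).
have := @pot_step R k k0 (kap * s * (len ds d.1)%:R) (kap * s * (len (d :: ds) d.1)%:R)
  (kap * s * (len ds (~~ d.1))%:R) (len0 _ _) (len0 _ _).
rewrite -{1}len2 -!plax => /(_ _)/wrap[|st].
  by rewrite ler_pM2l// ler_nat len1 leq_addr.
have e1 : kap * s * (len (d :: ds) d.1)%:R - kap * s * (len ds d.1)%:R =
    kap * s * (x (cnt ds d).+1 - x (cnt ds d))%N%:R.
  by rewrite len1; move: (len ds d.1) (x _ - x _)%N => u v; ring.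
rewrite e1 in st.
move: IH st; rewrite /=.
set dl := (x _ - x _)%N%:R; set c := cost k x s ds; set g0 := g k (s * (x 0)%:R).
set gH := g k (s * (Hs x ds d.1)%:R); set gl := g k (kap * s * _).
have sx0 : 0 < s * (x 0)%:R by rewrite mulr_gt0// ltr0n.
have sH := @sH_gt0 R x s s0 ds d.1.
have g1 : gH <= g0.
  apply: (g_decr k0 sx0); rewrite ler_pM2l// ler_nat.
  apply: leqW; apply: leq_trans (leq_addr _ _); exact: xge.
have g2 : gl <= gH.
  apply: (g_decr k0 sH); rewrite mulrAC [leRHS]mulrC ler_pM2l//.
  apply: le_trans (hkap _ _) _; rewrite ler_pM2l// ler_nat.
have dl0 : 0 <= dl by rewrite ler0n.
rewrite -(natr1 (size ds)).
have k1 : 0 <= (k - 1)%N%:R :> R by rewrite ler0n.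
move: (pl (d :: ds)) (pl ds) (pl [::]) (size ds)%:R => p1 p2 p3 n h1 h2.
have h3 : kap * s * dl * gl <= kap * s * dl * gH by apply: ler_wpM2l => //; apply: mulr_ge0 => //; exact: ltW.
have h4 : kap * s * ((k - 1)%N%:R * gH) <= kap * s * ((k - 1)%N%:R * g0).
  by apply: ler_wpM2l; [exact: ltW|apply: ler_wpM2l].
have aux (e q : R) : p2 - p3 <= e * (c + q * n * g0) -> p1 - p2 <= e * dl * gl ->
    e * dl * gl <= e * dl * gH -> e * (q * gH) <= e * (q * g0) ->
    p1 - p3 <= e * ((dl - q) * gH + c + q * (n + 1) * g0).
  by clearbody dl c g0 gH gl; move=> *; lra.
exact: aux.
Qed.

End CostBound.

Lemma prob_union (R : realType) d (T : measurableType d) (P : probability T R) (C : eqType)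
    (cs : seq C) (A : C -> set T) (E : set T) (e : R) : 0 <= e -> measurable E ->
  {in cs, forall c, measurable (A c) /\ (P (A c) <= e%:E)%E} ->
  E `<=` [set t | exists2 c, c \in cs & A c t] -> (P E <= ((size cs)%:R * e)%:E)%E.
Proof.
move=> e0; elim: cs E => [|c cs IH] E mE hA hE.
  suff -> : E = set0 by rewrite measure0 mul0r.
  by apply/seteqP; split => // t /hE[].
have [mA PA] := hA c (mem_head _ _).
have mEA : measurable (E `\` A c) by exact: measurableD.
apply: (@le_trans _ _ (P (A c) + P (E `\` A c))%E).
  apply: le_trans (measureU2 _ mA mEA); apply: le_measure; rewrite ?inE//.
    exact: measurableU.
  by move=> t Et; have [|] := pselect (A c t); [left|right].
rewrite /= -natr1 mulrDl mul1r addrC EFinD; apply: leeD => //.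
apply: IH => // [c' c'cs|t [Et nA]]; first by apply: hA; rewrite inE c'cs orbT.
 have [c' + h] := hE t Et.
by rewrite inE => /orP[/eqP e1|h']; [rewrite e1 in h|exists c'].
Qed.

(** * Choice of the scales, and the union bound *)

Section UpperBound.
Variables (R : realType) (k : nat).
Hypothesis k0 : (0 < k)%N.

Lemma one_minus_expRN_ge (y : R) : 0 <= y -> y <= 1 -> y / 2 <= 1 - expR (- y).
Proof.
move=> y0 y1; have := @expR_ge1Dx R y; rewrite expRN => h.
have p : 0 < 1 + y by lra.
have : (expR y)^-1 <= (1 + y)^-1 by rewrite lef_pV2 ?posrE ?expR_gt0.
have : (1 + y)^-1 * (1 + y) = 1 by rewrite mulVf// lt0r_neq0.
have i0 : 0 < (1 + y)^-1 by rewrite invr_gt0.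
move: (_^-1) i0 (_^-1) => i i0 j h1 h2; nra.
Qed.


Section Scale.
Variables (s : R) (N mm : nat) (x : nat -> nat).
Let r := Num.sqrt s.
Let L := ln s^-1.
Hypotheses (s0 : 0 < s) (s3 : s < expR (- 3)) (s200 : s < 1 / 200).
Hypotheses (N0 : (0 < N)%N) (rN1 : 1 < r * N%:R) (rN2 : r * N%:R <= 2).
Hypotheses (m1 : (2 ^ mm.-1 < N)%N) (m2 : (N <= 2 ^ mm)%N).
Hypotheses (xS : forall i, (x i < x i.+1)%N) (x0N : x 0 = N) (xN : forall i, (N <= x i)%N).
Hypothesis xstep : forall i, ((x i.+1 - x i) * N <= minn (x i) (N ^ 2))%N.
Hypothesis xfar : (N ^ 2 * (1 + 2 * mm) <= x (4 * N * mm)%N)%N.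
Let kap : R := 1 + 2 / N%:R.
Let n := (4 * (4 * N * mm))%N.

Let r0 : 0 < r. Proof. by rewrite sqrtr_gt0. Qed.
Let rr : r * r = s. Proof. by rewrite -expr2 sqr_sqrtr// ltW. Qed.
Let r12 : 12 * r < 1. Proof. have := rr; have := r0; have := s200; nra. Qed.
Let sL : s = expR (- L). Proof. by rewrite /L lnV ?posrE// opprK lnK ?posrE. Qed.
Let L3 : 3 < L. Proof. by have := s3; rewrite [in X in X -> _]sL ltr_expR; lra. Qed.
Let rL : r = expR (- (L / 2)).
Proof.
have : s = expR (- (L / 2)) ^+ 2 by rewrite -expRM_natl [LHS]sL; congr expR; lra.
by rewrite /r => ->; rewrite sqrtr_sqr ger0_norm ?expR_ge0.
Qed.
Let N0r : 0 < N%:R :> R. Proof. by rewrite ltr0n. Qed.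
Let Ng : 12 < N%:R :> R. Proof. have := rN1; have := r12; have := r0; have := N0r; nra. Qed.
Let sN : s * N%:R <= 2 * r.
Proof. by rewrite -rr -mulrA; have := ler_wpM2l (ltW r0) rN2; lra. Qed.
Let sNN : s * (N%:R * N%:R) <= 4.
Proof.
have -> : s * (N%:R * N%:R) = (r * N%:R) * (r * N%:R) by rewrite -rr; ring.
by have := rN1; have := rN2; move: (r * N%:R) => y; nra.
Qed.
Let sNN1 : 1 <= s * (N%:R * N%:R).
Proof.
have -> : s * (N%:R * N%:R) = (r * N%:R) * (r * N%:R) by rewrite -rr; ring.
by have := rN1; have := rN2; move: (r * N%:R) => y; nra.
Qed.
Let kap1 : 1 <= kap. Proof. by rewrite /kap lerDl divr_ge0. Qed.
Let kap3 : kap <= 3.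
Proof.
have : 2 / N%:R <= 2 :> R by rewrite ler_pdivrMr//; have := Ng; lra.
by rewrite /kap; lra.
Qed.

(** In [kap = 1 + 2 / N], one [1 / N] is the relative size of a grid step and the other absorbs the
    added 1, as [x i >= N]. *)
Let kap_ok i j : (x i.+1 + x j.+1).+1%:R <= kap * (x i + x j)%:R.
Proof.
have st q : (x q.+1)%:R <= (1 + N%:R^-1) * (x q)%:R :> R.
  have := xstep q; rewrite leq_min => /andP[h _].
  have : ((x q.+1 - x q) * N)%:R <= (x q)%:R :> R by rewrite ler_nat.
  rewrite natrM natrB ?(ltnW (xS q))// => h'.
  by rewrite mulrDl mul1r -lerBlDl [_^-1 * _]mulrC ler_pdivlMr.
rewrite /kap -natr1 !natrD; have := st i; have := st j.
have hg q : 1 <= (x q)%:R * N%:R^-1 :> R by rewrite ler_pdivlMr// mul1r ler_nat; exact: xN.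
have aux (a b c d y : R) : 1 <= a * y -> 1 <= b * y -> d <= (1 + y) * b -> c <= (1 + y) * a ->
  c + d + 1 <= (1 + 2 * y) * (a + b) by move=> *; lra.
by move=> h1 h2; apply: aux.
Qed.

(** Split at [s x_i = 1]. Below it, the step is at most [x_i / N] and the right factor at least
    [s x_i / 2]; above it, the step is at most [N], where [s N^2 <= 4], and the right factor is at
    least [1/2]. *)
Lemma grid_step_theta i :
  (x i.+1 - x i)%N%:R <= 8 / (s * N%:R) * (1 - expR (- (s * (x i)%:R))).
Proof.
have := xstep i; rewrite leq_min => /andP[h1 h2].
have g1 : (x i.+1 - x i)%N%:R * N%:R <= (x i)%:R :> R by rewrite -natrM ler_nat.
have g2 : (x i.+1 - x i)%N%:R * N%:R <= N%:R * N%:R :> R by rewrite -!natrM ler_nat mulnn.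
rewrite mulrAC ler_pdivlMr ?mulr_gt0//.
have e1 : (x i.+1 - x i)%N%:R * (s * N%:R) <= s * (x i)%:R by rewrite mulrCA ler_pM2l.
have e2 : (x i.+1 - x i)%N%:R * (s * N%:R) <= 4.
  by rewrite mulrCA; apply: le_trans sNN; rewrite ler_pM2l.
have [y1|y1] := leP (s * (x i)%:R) 1.
  have y0 : 0 <= s * (x i)%:R by rewrite mulr_ge0// ltW.
  have aux (a b c : R) : 0 <= b -> a <= b -> b / 2 <= 1 - c -> a <= 8 * (1 - c) by move=> *; lra.
  by apply: (aux _ _ _ y0 e1); apply: one_minus_expRN_ge.
have : expR (- (s * (x i)%:R)) <= expR (- 1) by rewrite ler_expR lerN2 ltW.
have := one_minus_expRN_ge ler01 (lexx 1).
have aux (a b c : R) : a <= 4 -> 1 / 2 <= 1 - b -> c <= b -> a <= 8 * (1 - c) by move=> *; lra.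
exact: (aux _ _ _ e2).
Qed.

Lemma p_theta_bound : (1 - expR (- s)) * (8 / (s * N%:R)) ^+ 2 <= 64.
Proof.
have h : 1 - expR (- s) <= s by have := @expR_ge1Dx R (- s); lra.
rewrite exprMn exprVn; have q0 : 0 < (s * N%:R) ^+ 2 by rewrite exprn_gt0// mulr_gt0.
rewrite mulrA ler_pdivrMr//.
apply: (@le_trans _ _ (s * (s * (N%:R * N%:R)) * 64)); last by rewrite exprMn !expr2; lra.
have -> : 8 ^+ 2 = 64 :> R by ring.
apply: ler_wpM2r => //; apply: le_trans h _.
by rewrite -[leLHS]mulr1 ler_pM2l.
Qed.

Let g0L : g k (s * (x 0)%:R) <= L.
Proof.
have r1 : r <= 1 by have := r12; have := r0; lra.
have r01 : r / 2 <= 1 - expR (- r) by apply: one_minus_expRN_ge => //; exact: ltW.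
have rx : r <= s * (x 0)%:R by rewrite x0N -[in leRHS]rr -mulrA -[leLHS]mulr1 ler_pM2l// ltW.
apply: le_trans (g_decr k0 r0 rx) _; apply: le_trans (g_le_ln k0 r0) _.
have p0 : 0 < 1 - expR (- r) by apply: lt_le_trans r01; have := r0; lra.
rewrite lerNl -ler_expR (lnK p0); apply: le_trans r01; rewrite [in leRHS]rL.
have -> : - L = - (L / 2) + - (L / 2) by lra.
by rewrite expRD; apply: ler_wpM2l; rewrite ?expR_ge0// -rL; have := r12; lra.
Qed.

Let mL : L <= 1 + 2 * mm%:R.
Proof.
suff : L <= 2 * mm%:R by lra.
rewrite -ler_expR; have -> : expR L = s^-1 by rewrite /L lnK// posrE invr_gt0.
apply: (@le_trans _ _ (N%:R * N%:R)); first by rewrite -div1r ler_pdivrMr// mulrC.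
apply: (@le_trans _ _ (2 ^+ mm * 2 ^+ mm)).
  by rewrite -natrX; apply: ler_pM => //; rewrite ler_nat.
rewrite expRM_natr -exprMn; apply: lerXn2r; rewrite ?nnegrE ?expR_ge0//.
have h1 := @expR_ge1Dx R 1; have -> : 2%:R = 1 + 1 :> R by ring.
by rewrite expRD; apply: ler_pM => //; lra.
Qed.

(** One of the four directions takes at least a quarter of the steps, so its side exceeds
    [N^2 (1 + 2 mm) >= L / s]. At scaled length [L] the potential is within
    [O (exp (- L / 2)) = O (r)] of its limit [2 lam]. *)
Let Mub ds : size ds = n ->
  L <= Num.max (kap * s * (len x ds false)%:R) (kap * s * (len x ds true)%:R).
Proof.
move=> /cnt_pigeon[[ax sd] hd].
have lx : (N ^ 2 * (1 + 2 * mm) <= len x ds ax)%N.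
  apply: leq_trans xfar _; have := x_le xS hd.
  by rewrite /len; case: sd {hd} => h; apply: leq_trans h _; rewrite ?leq_addl ?leq_addr.
suff : L <= kap * s * (len x ds ax)%:R.
  by case: (ax) => h; rewrite le_max h ?orbT.
have y0 : 0 <= 1 + 2 * mm%:R :> R by apply: addr_ge0 => //; apply: mulr_ge0.
apply: (le_trans mL); apply: (@le_trans _ _ (s * (N%:R * N%:R) * (1 + 2 * mm%:R))).
  by rewrite -[leLHS]mul1r; apply: ler_wpM2r.
rewrite -mulrA -[leRHS]mulrA -[leLHS]mul1r; apply: ler_pM => //.
  by apply: mulr_ge0; [exact: ltW|apply: mulr_ge0 => //; exact: mulr_ge0].
rewrite ler_pM2l//; have : (N ^ 2 * (1 + 2 * mm))%N%:R <= (len x ds ax)%:R :> R by rewrite ler_nat.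
by rewrite natrM natrD natrM natrX expr2.
Qed.

Variable C : R.
Hypothesis C0 : 0 < C.
Hypothesis hC : forall z : R, 0 < z < 1 -> GG k z <= C * z + z * - ln z.

Let kslen0 ds ax : 0 < kap * s * (len x ds ax)%:R.
Proof.
rewrite !mulr_gt0//; first by have := kap1; lra.
by rewrite ltr0n /len addn_gt0 (leq_trans N0 (xN _)).
Qed.

(** The starting square has scaled side [O (r)], so by [GG_small] its potential, which is given
    away, is [O (r L)]. *)
Let start_ub : 2 * GG k (kap * s * (len x [::] false)%:R) <= 24 * r * C + 12 * r * L.
Proof.
have z1 : kap * s * (len x [::] false)%:R <= 12 * r.
  have -> : kap * s * (len x [::] false)%:R = 2 * (kap * (s * N%:R)).
    by rewrite /len /cnt /= x0N; ring.
  have : kap * (s * N%:R) <= 3 * (2 * r).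
    apply: ler_pM => //; first by have := kap1; lra.
    by rewrite mulr_ge0// ltW.
  lra.
have h1 := GG_mono k0 (kslen0 [::] false) z1.
have h2 := hC (_ : 0 < 12 * r < 1).
have h3 : - ln (12 * r) <= L / 2.
  rewrite lerNl -[leLHS](expRK (R := R)) -rL ler_ln ?posrE ?mulr_gt0 ?r0//.
  by rewrite ler_peMl ?(ltW r0)// ler1n.
have h4 : 12 * r * - ln (12 * r) <= 12 * r * (L / 2).
  by apply: ler_wpM2l => //; rewrite mulr_ge0// ltW.
have h5 : 0 < 12 * r < 1 by rewrite r12 andbT mulr_gt0.
by move: (h2 h5) h1 h4; lra.
Qed.

Lemma scaled_cost_ge ds : size ds = n ->
  2 * lam R k / s - (4 * lam R k + 24 + 24 * C) * L / r - (k - 1)%N%:R * n%:R * L <= cost k x s ds.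
Proof.
move=> sz; have x0 : (0 < x 0)%N by rewrite x0N.
have := @cost_ge R k x s kap k0 xS x0 s0 kap_ok ds; rewrite sz.
have := pot_far (M := L) k0 _ (kslen0 ds false) (kslen0 ds true) (Mub sz).
move=> /(_ (_ : 1 <= L))/wrap[|]; first by have := L3; lra.
rewrite -rL => hV.
have lenTF : len x [::] true = len x [::] false by [].
rewrite [pot k _ _ in X in _ - X]/pot lenTF maxxx minxx subrr mul0r subr0.
move: start_ub hV; move: (pot _ _ _) (2 * GG k _) => V V0 hV0 hV hc.
have lam0 : 0 <= lam R k.
  by rewrite lamE//; apply: divr_ge0; [exact: sqr_ge0|rewrite !mulr_ge0//; lra].
have k1 : 0 <= (k - 1)%N%:R :> R by [].
have n0 : 0 <= n%:R :> R by [].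
have h1 : (k - 1)%N%:R * n%:R * g k (s * (x 0)%:R) <= (k - 1)%N%:R * n%:R * L.
  by apply: ler_wpM2l => //; exact: mulr_ge0.
set c := cost _ _ _ _ in hc *; set Q := (k - 1)%N%:R * n%:R * L in h1 *.
have h2 : V - V0 <= kap * s * (c + Q).
  by apply: le_trans hc _; rewrite ler_pM2l ?lerD2l//; rewrite mulr_gt0//; have := kap1; lra.
(* It remains to divide by [kap * s], where [1 / kap >= 1 - 2 * r] and [s = r ^+ 2]. *)
rewrite lerBlDr.
have sr : s = r * r by [].
have kr : kap * (1 - 2 * r) <= 1.
  have : 1 / N%:R <= r by rewrite ler_pdivrMr// ltW.
  have aux (a b : R) : 0 <= a -> a <= b -> 12 * b < 1 -> (1 + 2 * a) * (1 - 2 * b) <= 1.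
    by move=> *; nra.
  by rewrite div1r => h; apply: aux => //; rewrite invr_ge0.
have -> : 2 * lam R k / s - (4 * lam R k + 24 + 24 * C) * L / r =
  (2 * lam R k - (4 * lam R k + 24 + 24 * C) * L * r) / s.
  by rewrite sr; field; rewrite lt0r_neq0.
rewrite ler_pdivrMr//.
set W := 2 * lam R k - _.
have hW : W <= (1 - 2 * r) * (2 * lam R k) - (12 * r + 24 * r * C + 12 * r * L).
  have L1 : 0 <= L - 1 by have := L3; lra.
  have a1 := mulr_ge0 (mulr_ge0 lam0 (ltW r0)) L1; have a2 := mulr_ge0 (ltW r0) L1.
  have a3 := mulr_ge0 (mulr_ge0 (ltW r0) (ltW C0)) L1.
  have aux (l b y e : R) : 0 <= l * b * (y - 1) -> 0 <= b * (y - 1) -> 0 <= b * e * (y - 1) ->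
    2 * l - (4 * l + 24 + 24 * e) * y * b <= (1 - 2 * b) * (2 * l) - (12 * b + 24 * b * e + 12 * b * y).
    by move=> *; lra.
  exact: aux.
set Y := 12 * r + _ + _ in hW.
have Y0 : 0 <= Y.
  have := L3; have := ltW r0; rewrite /Y => q1 q2.
  have q3 : 0 <= r * C by rewrite mulr_ge0// ltW.
  have q4 : 0 <= r * L by rewrite mulr_ge0//; lra.
  by lra.
have hZ : 2 * lam R k - Y <= kap * ((c + Q) * s).
  have -> : kap * ((c + Q) * s) = kap * s * (c + Q) by ring.
  by apply: le_trans h2; rewrite /Y; lra.
have := ltW r0; move: r12 hW hZ lam0 Y0 kr kap1; move: (lam R k) W Y ((c + Q) * s) kap r.
have aux (l w y e K b : R) : 12 * b < 1 -> w <= (1 - 2 * b) * (2 * l) - y -> 2 * l - y <= K * e ->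
    0 <= l -> 0 <= y -> K * (1 - 2 * b) <= 1 -> 1 <= K -> 0 <= b -> w <= e.
  move=> b1 hw hz l0 y0 hK K1 b0.
  have bl0 := mulr_ge0 b0 l0; have by0 := mulr_ge0 b0 y0.
  have [e0|e0] := leP 0 e.
    have : K * (1 - 2 * b) * e <= 1 * e by apply: ler_wpM2r.
    have : (1 - 2 * b) * (2 * l - y) <= (1 - 2 * b) * (K * e) by apply: ler_wpM2l => //; lra.
    by move=> *; lra.
  have : 1 * (- e) <= K * (- e) by apply: ler_wpM2r => //; lra.
  by move=> *; lra.
exact: aux.
Qed.

Lemma scaled_steps_le : n%:R <= 64 * L / r.
Proof.
have h : expR (mm.-1%:R / 2) <= expR (1 + L / 2) :> R.
  apply: (@le_trans _ _ (2 ^+ mm.-1)).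
    rewrite mulrC -[2^-1]div1r mulrC expRM_natl; apply: lerXn2r; rewrite ?nnegrE ?expR_ge0//.
    exact: expR_half_le2.
  have le2 : 2 <= expR 1 :> R by have := @expR_ge1Dx R 1; lra.
  apply: (@le_trans _ _ N%:R); first by rewrite -natrX ler_nat ltnW.
  rewrite expRD; apply: (@le_trans _ _ (2 * expR (L / 2))); last by rewrite ler_pM2r ?expR_gt0.
  rewrite -(ler_pM2l r0); apply: le_trans rN2 _.
  by rewrite [in leRHS]rL mulrCA -expRD addNr expR0; lra.
rewrite ler_expR in h.
have h2 : mm%:R <= mm.-1%:R + 1 :> R by rewrite natr1 ler_nat; case: (mm).
have mL2 : mm%:R <= 2 * L by have := L3; lra.
rewrite ler_pdivlMr// /n !natrM.
have m0 : 0 <= mm%:R :> R by [].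
have := L3; move: m0 mL2 rN2 (ltW r0) N0r; move: (mm%:R) (N%:R) r L.
have aux (a b c e : R) : 0 <= a -> a <= 2 * e -> c * b <= 2 -> 0 <= c -> 0 < b -> 3 < e ->
    4 * (4 * b * a) * c <= 64 * e.
  move=> a0 ae cb c0 b0 e3; have := ler_wpM2r a0 cb; lra.
by move=> a b c e *; apply: aux.
Qed.

End Scale.
Lemma upper_prob (m : model) : valid_model m -> model_k m = k ->
  exists s0 c : R, [/\ 0 < s0, 0 < c & forall s, 0 < s < s0 ->
    forall (d : measure_display) (T : measurableType d) (P : probability T R) (X : T -> config),
    iid_bernoulli_field P X (1 - expR (- s)) ->
    (P [set t | indefinite_growth m (X t)] <=
     (expR (- (2 * lam R k) / s + c * ln s^-1 / Num.sqrt s * (1 + (k - 1)%N%:R * ln s^-1)))%:E)%E].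
Proof.
move=> vm mk; have [C C0 hC] := GG_small R k0.
have lam0 : 0 <= lam R k.
  by rewrite lamE//; apply: divr_ge0; [exact: sqr_ge0|rewrite !mulr_ge0//; lra].
(* [8320 = 64 * 130]: there are [n <= 64 L / r] steps, the [4^n] lists cost at most [2 n] in the
   exponent and the [2 n] cells cost [64] each. The last [64] pays for the [k - 1] lines lost per
   step, and the terms in [lam] and [C] come from [scaled_cost_ge]. The bound [1 / 200] gives
   [12 r < 1]. *)
exists (Num.min (expR (- 3)) (1 / 200)), (8320 + 4 * lam R k + 24 + 24 * C + 64); split.
- by rewrite lt_min expR_gt0; lra.
- lra.
move=> s /andP[s0]; rewrite lt_min => /andP[s3 s200] d T P X iid.
set r := Num.sqrt s; set L := ln s^-1.
have r0 : 0 < r by rewrite sqrtr_gt0.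
have rr : r * r = s by rewrite -expr2 sqr_sqrtr// ltW.
have r1 : r <= 1 by nra.
have L3 : 3 < L.
  by rewrite /L lnV ?posrE// ltrNr -(ltr_expR) lnK ?posrE.
have /andP[N1 N2] := @truncn_itv R r^-1 ltac:(by rewrite invr_ge0 ltW).
set N := (Num.truncn r^-1).+1 in N2.
have N1' : N%:R <= r^-1 + 1 by rewrite -natr1 lerD2r.
have ri : r^-1 * r = 1 by rewrite mulVf// lt0r_neq0.
have rN1 : 1 < r * N%:R by rewrite mulrC -ltr_pdivrMr// div1r.
have rN2 : r * N%:R <= 2.
  have := ler_wpM2l (ltW r0) N1'; rewrite mulrDr [r * _^-1]mulrC ri; lra.
have N0 : (0 < N)%N by [].
have Nn : (1 < N)%N.
  rewrite -(ltr_nat R) -(ltr_pM2l r0); apply: le_lt_trans rN1; lra.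
have /andP[m1 m2] := @up_log_bounds 2 N isT Nn.
set mm := up_log 2 N in m1 m2.
have [x [xS x0N xN xstep xfar]] := grid_exists N0 m2.
pose n := (4 * (4 * N * mm))%N.
have n_ub : n%:R <= 64 * L / r by apply: scaled_steps_le.
have cst := scaled_cost_ge s0 s3 s200 N0 rN1 rN2 m2 xS x0N xN xstep xfar C0 hC.
pose A (ds : seq dir) := [set t | crossed k x ds (hit (inc x ds) (box (x n)) (X t))].
pose cs : seq (seq dir) := [seq tval u | u <- enum {: n.-tuple dir}].
have szcs : size cs = (4 ^ n)%N by rewrite size_map -cardE card_tuple card_prod card_bool.
pose E := 2 * lam R k / s - (4 * lam R k + 24 + 24 * C) * L / r - (k - 1)%N%:R * n%:R * L.
have := @prob_union R d T P _ cs A [set t | indefinite_growth m (X t)] (expR (64 * n.*2%:R - E))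
  (expR_ge0 _) (measurable_indefinite_growth iid m).
apply: apply3.
- move=> ds /mapP[u _ ->]; have sz : size u = n by rewrite size_tuple.
  have x0 : (0 < x 0)%N by rewrite x0N.
  have hA : forall i, (x i.+1 - x i)%N%:R <= 8 / (s * N%:R) * (1 - expR (- (s * (x i)%:R))).
    by move=> i; apply: grid_step_theta.
  have hK : (1 - expR (- s)) * (8 / (s * N%:R)) ^+ 2 <= 64 by apply: p_theta_bound.
  have [L' [uL' mL'] hL'] := Ex_crossed_shared k0 xS s0 hA hK x0 u (x n).
  have -> : A u = [set t | crossed k x u (hit (inc x u) L' (X t))].
    apply/seteqP; split => t; rewrite /A /= => h;
      by apply: crossed_mono h => e; rewrite /hit (eq_has_r mL').
  have det : determined L' (fun w => crossed k x u (hit (inc x u) L' w)).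
    move=> w w' h; apply: crossed_congr => e _; rewrite /hit; apply: eq_in_has => z zL.
    by rewrite h.
  have [mA ->] := prob_Ex iid (fun=> false) uL' det; split=> //.
  rewrite lee_fin; apply: le_trans (hL' _) _; rewrite ler_expR sz lerD2l lerN2.
  exact: cst.
- move=> t /(growth_unblocked vm); rewrite mk => /(unblocked_crossed xS k0)/(_ (leqnn (x n))).
  move=> [ds sz hds]; exists ds => //.
  apply/mapP; exists (@Tuple n _ ds (introT eqP sz)) => //; exact: mem_enum.
move=> /le_trans; apply; rewrite lee_fin szcs.
have h4 : (4 ^ n)%N%:R <= expR (n%:R * 2) :> R.
  rewrite expRM_natl natrX; apply: lerXn2r; rewrite ?nnegrE ?expR_ge0//.
  have -> : 2 = 1 + 1 :> R by lra.
  have h1 := @expR_ge1Dx R 1; rewrite expRD.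
  have : (1 + 1) * (1 + 1) <= expR 1 * expR 1 :> R by apply: ler_pM => //; lra.
  lra.
apply: le_trans (ler_wpM2r (expR_ge0 _) h4) _; rewrite -expRD ler_expR /E -muln2 natrM.
have k1 : 0 <= (k - 1)%N%:R :> R by [].
have Lr0 : 0 <= L / r by rewrite divr_ge0// ltW//; lra.
have kL0 : 0 <= (k - 1)%N%:R * L by rewrite mulr_ge0//; lra.
have aux (l c q nn a b L0 : R) : nn <= 64 * a -> 0 <= q * L0 -> 0 <= l -> 0 <= c -> 0 <= a ->
  nn * 2 + (64 * (nn * 2) - (b - (4 * l + 24 + 24 * c) * a - q * nn * L0)) <=
  - b + (8320 + 4 * l + 24 + 24 * c + 64) * a * (1 + q * L0).
  move=> h1 h2 l0 c0 a0; have h3 := ler_wpM2l h2 h1.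
  have i4 := mulr_ge0 h2 a0; have i5 := mulr_ge0 l0 i4; have i6 := mulr_ge0 c0 i4.
  by move: h1 h3 i4 i5 i6 a0; clear; lra.
rewrite mulNr -[_ * L / r]mulrA -[X in _ <= _ + X * _]mulrA; apply: aux => //; last exact: ltW.
by rewrite mulrA.
Qed.

End UpperBound.

(** * Lower bound *)

Definition swp (z : site) : site := (z.2, z.1).
Definition ngx (z : site) : site := (- z.1, z.2).

(** With [closed_ngx], this reduces growth in all directions to growth towards the right. *)
Lemma closed_swp m w S : closed_set m w S -> closed_set m (w \o swp) (S \o swp).
Proof.
move=> [h1 [h2 h3]]; split; [|split].
- by move=> x [-> w0]; apply: h1.
- move=> x wx hx; apply: h2 => //; case: m hx {h3} => [k||] [y [Sy hy]]; exists (swp y);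
    split => //; move: hy; rewrite /l1dist /linfdist /swp /=; case: x {wx} y {Sy} => x1 x2 [y1 y2] /=; lia.
- move=> x wx hx; apply: h3 => //; case: m hx {h2} => [k||] /=.
  + move=> [l [ul sl hl Sl]]; exists (map swp l); split.
    * by rewrite map_inj_uniq// => -[a b] [a' b'] [-> ->].
    * by rewrite size_map.
    * move=> _ /mapP[y yl ->]; have := hl y yl.
      by rewrite /inNk /swp; case: x {wx hl} y {yl} => x1 x2 [y1 y2] /= [[-> h]|[-> h]]; [right|left].
    * by move=> _ /mapP[y yl ->]; exact: Sl.
  + by case=> a b; split.
  + by move=> [e [d [he [hd [a [b c]]]]]]; exists d, e; split => //; split.
Qed.

Lemma closed_ngx m w S : closed_set m w S -> closed_set m (w \o ngx) (S \o ngx).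
Proof.
move=> [h1 [h2 h3]]; split; [|split].
- by move=> x [-> w0]; apply: h1.
- move=> x wx hx; apply: h2 => //; case: m hx {h3} => [k||] [y [Sy hy]]; exists (ngx y);
    split => //; move: hy; rewrite /l1dist /linfdist /ngx /=; case: x {wx} y {Sy} => x1 x2 [y1 y2] /=; lia.
- move=> x wx hx; apply: h3 => //; case: m hx {h2} => [k||] /=.
  + move=> [l [ul sl hl Sl]]; exists (map ngx l); split.
    * by rewrite map_inj_uniq// => -[a b] [a' b'] [/oppr_inj-> ->].
    * by rewrite size_map.
    * move=> _ /mapP[y yl ->]; have := hl y yl.
      by rewrite /inNk /ngx; case: x {wx hl} y {yl} => x1 x2 [y1 y2] /= [[-> h]|[-> h]]; [left|right]; split => //; lia.
    * by move=> _ /mapP[y yl ->]; exact: Sl.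
  + have e1 : - (x.1 + 1) = - x.1 - 1 by lia.
    have e2 : - (x.1 - 1) = - x.1 + 1 by lia.
    by rewrite /ngx /= e1 e2 => -[a b]; split=> //; case: b; [right|left].
  + rewrite /ngx /= => -[e [d [he [hd [a [b c]]]]]]; exists (- e), d.
    rewrite !opprD in a c; split; first by case: he => ->; [right|left].
    by split.
Qed.

(** * Filling columns, rows and half-planes *)

Section Fill.
Variables (m : model) (w : config) (S : set site).
Hypothesis vm : valid_model m.
Hypothesis cl : closed_set m w S.
Let k := model_k m.

Let adjacent_occupied x y : w x -> S y -> l1dist x y <= 1 -> S x.
Proof.
move=> wx Sy h; apply: cl.2.1 => //; case: m vm => [j||] /=; exists y; split => //.
- by apply: le_trans h _; lia.
- by move: h; rewrite /l1dist /linfdist; lia.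
Qed.

(** Next to [k] active columns, an active site spreads along its own column. For [k >= 2] an empty
    neighbour sees [k - 1] active sites on its left and one above or below; for [k = 1] the left
    site, and in the Frobse model also the left corner, are in the active column. *)
Lemma fill_column (J : int -> Prop) (b y0 : int) :
  (forall y1 y2 y, J y1 -> J y2 -> y1 <= y <= y2 -> J y) ->
  (forall (v : nat) y, (0 < v <= k)%N -> J y -> S (b - v%:Z, y)) ->
  J y0 -> S (b, y0) -> forall y, J y -> S (b, y).
Proof.
move=> cJ hs J0 S0 y.
have k1 : (0 < k)%N by move: vm; rewrite /k; case: m => //= j; lia.
have [n en] : exists n, `|y - y0|%N = n by eexists.
elim: n y en => [|n IH] y en Jy; first by have -> : y = y0 by lia.
have [y' [d [ey hd e'']]] : exists y' d, [/\ y' = y + d, d = 1 \/ d = -1 & `|y' - y0|%N = n].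
  have [lt|lt] := leP y y0.
    by exists (y + 1), 1; split => //; [left|lia].
  by exists (y - 1), (-1); split => //; [right|lia].
have Jy' : J y'.
  have [lt|lt] := leP y y0; [apply: (cJ y y0)|apply: (cJ y0 y)] => //; case: hd => e1; subst y'; lia.
have Sy' := IH y' e'' Jy'.
have Sb := hs 1 y k1 Jy.
case wb : (w (b, y)).
  by apply: adjacent_occupied wb Sy' _; rewrite /l1dist /=; case: hd => e1; subst y'; lia.
apply: cl.2.2 => //; rewrite /k in hs k1; case: m vm hs Sb Sy' {IH k1} => [j||] /= vj hs Sb Sy'.
- exists ((b, y') :: [seq (b - v%:Z, y) | v <- iota 1 j.-1]); split.
  + rewrite /= map_inj_uniq ?iota_uniq ?andbT; last by move=> u v [e1]; lia.
    by apply/negP => /mapP[v]; rewrite mem_iota => hv [e1 _]; lia.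
  + by rewrite /= size_map size_iota; lia.
  + move=> z; rewrite inE => /orP[/eqP ->|/mapP[v]].
      by right; split => //=; case: hd => e1; subst y'; lia.
    by rewrite mem_iota => hv ->; left; split => //=; lia.
  + move=> z; rewrite inE => /orP[/eqP ->//|/mapP[v]].
    by rewrite mem_iota => hv ->; apply: hs => //; lia.
- by split; [case: hd ey => -> <-; [left|right]|right].
- exists (-1), d; split; [by right|split => //]; split=> //; rewrite -ey; split => //.
  exact: (hs 1 y').
Qed.

(** The occupied site at [(a + i, y0)] is within [k] of column [a - 1], hence active. In each column
    between, it is the [k]-th active site seen from height [y0] if that site is empty; then
    [fill_column] completes the column. *)
Lemma advance (J : int -> Prop) (a y0 : int) (i : nat) :
  (forall y1 y2 y, J y1 -> J y2 -> y1 <= y <= y2 -> J y) ->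
  (forall (v : nat) y, (0 < v <= k)%N -> J y -> S (a - v%:Z, y)) ->
  (i < k)%N -> J y0 -> w (a + i%:Z, y0) ->
  forall (j : nat) y, (j <= i)%N -> J y -> S (a + j%:Z, y).
Proof.
move=> cJ hs ik J0 wi.
have k1 : (0 < k)%N by lia.
have Si : S (a + i%:Z, y0).
  have S1 := hs 1 y0 k1 J0.
  apply: cl.2.1 => //; rewrite /k in ik; case: m vm ik S1 => [j||] /= vj ik S1;
    exists (a - 1, y0); split => //; rewrite /l1dist /linfdist /=; lia.
elim/ltn_ind => j IH y ji.
have strip (v : nat) y' : (0 < v <= k)%N -> J y' -> S (a + j%:Z - v%:Z, y').
  move=> hv Jy'; have [vj|vj] := leqP v j.
    have -> : a + j%:Z - v%:Z = a + (j - v)%N%:Z by lia.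
    by apply: IH => //; lia.
  have -> : a + j%:Z - v%:Z = a - (v - j)%N%:Z by lia.
  by apply: hs => //; lia.
apply: (fill_column cJ strip J0) => //.
have [->//|nij] := eqVneq j i.
have ji' : (j < i)%N by rewrite ltn_neqAle nij.
have S1 := strip 1 y0 k1 J0.
case wj : (w (a + j%:Z, y0)).
  by apply: adjacent_occupied wj S1 _; rewrite /l1dist /=; lia.
apply: cl.2.2 => //; rewrite /k in ik k1 strip; case: m vm ik strip {k1 hs} => [l||] /= vl ik strip; try by lia.
exists ((a + i%:Z, y0) :: [seq (a + j%:Z - v%:Z, y0) | v <- iota 1 l.-1]); split.
+ rewrite /= map_inj_uniq ?iota_uniq ?andbT; last by move=> u v [e1]; lia.
  by apply/negP => /mapP[v]; rewrite mem_iota => hv [e1]; lia.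
+ by rewrite /= size_map size_iota; lia.
+ move=> z; rewrite inE => /orP[/eqP ->|/mapP[v]].
    by left; split => //=; lia.
  by rewrite mem_iota => hv ->; left; split => //=; lia.
+ move=> z; rewrite inE => /orP[/eqP ->//|/mapP[v]].
  by rewrite mem_iota => hv ->; apply: strip => //; lia.
Qed.

Lemma half_plane_fill (J : int -> Prop) :
  (forall y1 y2 y, J y1 -> J y2 -> y1 <= y <= y2 -> J y) ->
  (forall x y, x <= 0 -> J y -> S (x, y)) ->
  (forall x, exists2 y, J y & w (x, y)) -> forall x y, J y -> S (x, y).
Proof.
move=> cJ h0 hw.
have k1 : (0 < k)%N by move: vm; rewrite /k; case: m => //= j; lia.
suff H (n : nat) : forall x y, x <= n%:Z -> J y -> S (x, y).
  by move=> x y; apply: (H `|x|%N); lia.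
elim: n => [|n IH]; first exact: h0.
move=> x y xn Jy; have [xn'|xn'] := leP x n%:Z; first exact: IH.
have [y0 J0 w0] := hw n.+1%:Z.
have -> : x = n.+1%:Z + 0%N%:Z by lia.
by apply: (@advance J n.+1%:Z y0 0) => //; [move=> v y' hv Jy'; apply: IH => //; lia|rewrite addr0].
Qed.

Definition filled (A B : nat) := forall i j : nat, (i < A)%N -> (j < B)%N -> S (i%:Z, j%:Z).

Lemma filled_column A B x y : filled A B -> (k <= A)%N -> (A <= x < A + k)%N -> (y < B)%N ->
  w (x%:Z, y%:Z) -> filled x.+1 B.
Proof.
move=> fAB kA xA yB wxy i j ix jB.
have [iA|iA] := ltnP i A; first exact: fAB.
have -> : i%:Z = A%:Z + (i - A)%N%:Z by lia.
apply: (@advance (fun y => 0 <= y < B%:Z) A%:Z y%:Z (x - A)) => //; try by lia.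
- move=> v [y'|y'] hv hy'; last by lia.
  have -> : A%:Z - v%:Z = (A - v)%N%:Z by lia.
  by apply: fAB; lia.
- by have -> : A%:Z + (x - A)%N%:Z = x%:Z by lia.
Qed.

Lemma filled_start n0 : (0 < n0)%N ->
  (forall i j : nat, (i < n0)%N -> (j < n0)%N -> w (i%:Z, j%:Z)) -> filled n0 n0.
Proof.
move=> n00 h.
have H0 j : (j < n0)%N -> S (0, j%:Z).
  elim: j => [|j IH] jn; first by apply: cl.1; split => //; apply: h.
  by apply: adjacent_occupied (h 0 j.+1 n00 jn) (IH (ltnW jn)) _; rewrite /l1dist /=; lia.
move=> i j ij jn; elim: i ij => [|i IH] ij; first exact: H0.
by apply: adjacent_occupied (h i.+1 j ij jn) (IH (ltnW ij)) _; rewrite /l1dist /=; lia.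
Qed.

End Fill.

Lemma filled_row m w S A B x y : valid_model m -> closed_set m w S -> filled S A B ->
  (model_k m <= B)%N -> (B <= y < B + model_k m)%N -> (x < A)%N -> w (x%:Z, y%:Z) -> filled S A y.+1.
Proof.
move=> vm cl fAB kB yB xA wxy.
have := @filled_column m (w \o swp) (S \o swp) vm (closed_swp cl) B A y x.
by move=> h i j iA jy; apply: (h _ kB yB xA wxy j i jy iA) => a b aB bA; apply: fAB.
Qed.

(** The quadrant is first extended leftwards to a half-plane, then downwards; each new column or row
    needs one occupied site in the part already spanned. *)
Lemma quadrant_fill m w S : valid_model m -> closed_set m w S ->
  (forall i j : nat, S (i%:Z, j%:Z)) ->
  (forall x : int, exists j : nat, w (x, j%:Z)) -> (forall y : int, exists i : nat, w (i%:Z, y)) ->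
  S = setT.
Proof.
move=> vm cl q hx hy.
have up x y : 0 <= y -> S (x, y).
  move=> y0; have := @half_plane_fill m (w \o ngx) (S \o ngx) vm (closed_ngx cl) (fun y => 0 <= y).
  move=> h; have := h _ _ _ (- x) y y0; rewrite /ngx /= opprK; apply.
  - by move=> y1 y2 y' h1 h2 /andP[]; lia.
  - move=> x' y' hx' hy'; rewrite /ngx /=.
    have -> : (- x', y') = (`|x'|%N%:Z, `|y'|%N%:Z) by congr pair; lia.
    exact: q.
  - by move=> x'; have [j hj] := hx (- x'); exists j%:Z.
apply/seteqP; split => // -[x y] _.
have := @half_plane_fill m (w \o swp \o ngx) (S \o swp \o ngx) vm
  (closed_ngx (closed_swp cl)) (fun=> True).
move=> h; have := h _ _ _ (- y) x I; rewrite /ngx /swp /= opprK; apply=> //.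
- by move=> y' x' hy' _; rewrite /ngx /swp /=; apply: up; lia.
- by move=> y'; have [i hi] := hy (- y'); exists i%:Z.
Qed.

(** * The event that fills the quadrant *)

Section Construction.
Variables (k dl : nat) (mid : pred nat).
Hypothesis k0 : (0 < k)%N.
Implicit Types (w : config) (n x y : nat) (ms : seq nat).

(** With [3 * k], the length [m - 2 * k] used in the estimates is positive for every [m >= n0]. *)
Definition n0 := (3 * k)%N.
Definition cseg x : seq site := [seq (x%:Z, j%:Z) | j <- iota 0 (x - k)].
(* The part of column [x] above its nominal range; it is asked for when the column ends a
   run of [k] columns without occupied site in their nominal ranges. *)
Definition useg x : seq site := [seq (x%:Z, j%:Z) | j <- iota (x - k) (dl + k)].
(* Row [y] is searched on a shorter range near the forgiven columns [ms]. *)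
Definition width ms y :=
  if has (fun x => (y <= x + dl + k)%N && (x < y)%N) ms then (y - (2 * k + dl))%N else (y - k)%N.
Definition rseg ms y : seq site := [seq (i%:Z, y%:Z) | i <- iota 0 (width ms y)].
Definition cbits w n : seq bool := [seq has w (cseg x) | x <- iota n0 n].
Definition mods w n := resets k n0 0 (cbits w n).
Definition start : seq site := [seq (i%:Z, j%:Z) | i <- iota 0 n0, j <- iota 0 n0].
Definition grow n w : bool := all w start &&
  (all (fun x => mid x && has w (useg x)) (mods w n) &&
   norun k 0 [seq has w (rseg (mods w n) y) | y <- iota n0 n]).

Lemma norun_cat j bs bs' : norun k j (bs ++ bs') -> norun k j bs.
Proof. by elim: bs j => //= b bs IH j; case: b; [exact: IH|move=> /andP[-> /IH]]. Qed.

Lemma norun_resets j bs i : norun k j bs -> resets k i j bs = [::].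
Proof.
elim: bs i j => //= b bs IH i j; case: b; first exact: IH.
by move=> /andP[-> /IH].
Qed.

Lemma cbitsS w n m : cbits w (n + m) = cbits w n ++ [seq has w (cseg x) | x <- iota (n0 + n) m].
Proof. by rewrite /cbits iotaD map_cat. Qed.

Lemma mods_prefix w n m x : (x < n0 + n)%N -> (x \in mods w (n + m)) = (x \in mods w n).
Proof.
move=> xn; rewrite /mods cbitsS; apply/idP/idP; last exact: resets_cat.
by move=> h; apply: (resets_catP k0 h); rewrite size_map size_iota.
Qed.

Lemma width_prefix w n m y : (y <= n0 + n)%N -> width (mods w (n + m)) y = width (mods w n) y.
Proof.
move=> yn; rewrite /width; congr (if _ then _ else _).
by apply/hasP/hasP => -[x xm /andP[h1 h2]]; exists x; rewrite ?h1 ?h2//; move: xm;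
  rewrite mods_prefix//; apply: leq_trans yn.
Qed.

Lemma grow_prefix w n m : grow (n + m) w -> grow n w.
Proof.
move=> /andP[h1 /andP[/allP h2 h3]]; apply/andP; split=> //; apply/andP; split.
  apply/allP => x xm; apply: h2; rewrite mods_prefix//.
  by have := resets_bounds k0 xm; rewrite size_map size_iota => /andP[].
move: h3; rewrite iotaD map_cat => /norun_cat.
congr (is_true (norun k 0 _)); apply/eq_in_map => y; rewrite mem_iota => hy.
by rewrite /rseg width_prefix//; lia.
Qed.

Lemma column_station w n a : (n0 <= a)%N -> (a + k <= n0 + n)%N ->
  exists2 x, (a <= x < a + k)%N & has w (cseg x) \/ x \in mods w n.
Proof.
move=> na an; have [|l hl [h|[_ h]]] := @resets_window k k0 n0 0 (cbits w n) (a - n0) k0.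
- by rewrite size_map size_iota; lia.
- exists (n0 + l)%N; first by lia.
  left; move: h; rewrite cat0s /cbits.
  have [ln|ln] := ltnP l n; last by rewrite nth_default// size_map size_iota.
  by rewrite (nth_map 0) ?size_iota// nth_iota.
- by exists (n0 + l)%N; [lia|right; rewrite subn0 in h].
Qed.

Lemma row_station w n b : (n0 <= b)%N -> (b + k <= n0 + n)%N -> grow n w ->
  exists2 y, (b <= y < b + k)%N & has w (rseg (mods w n) y).
Proof.
move=> nb bn /andP[_ /andP[_ nr]].
have [|l hl [h|[_]]] := @resets_window k k0 n0 0 _ (b - n0) k0 (_ : (_ <= 0 + size
    [seq has w (rseg (mods w n) y) | y <- iota n0 n])%N).
- by rewrite size_map size_iota; lia.
- exists (n0 + l)%N; first by lia.
  move: h; rewrite cat0s.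
  have [ln|ln] := ltnP l n; last by rewrite nth_default// size_map size_iota.
  by rewrite (nth_map 0) ?size_iota// nth_iota.
- by rewrite norun_resets.
Qed.

(** The row station [y] is used unless its range exceeds [A]. In that case [y > A + k], so [B] is
    larger than [A] and column [x] is used, provided that its occupied site is below [B]. *)
Lemma grow_step m w S A B : valid_model m -> model_k m = k -> closed_set m w S ->
  (forall n, grow n w) -> (n0 <= A)%N -> (n0 <= B)%N -> filled S A B ->
  (exists x, [/\ (A < x)%N, (x <= B + k + 1)%N & filled S x B]) \/
  (exists y, [/\ (B < y)%N, (y <= A + (2 * k + dl) + 1)%N & filled S A y]).
Proof.
move=> vm mk cl hg nA nB fAB; pose n := (A + B + k)%N.
have kA : (model_k m <= A)%N by rewrite mk; move: nA; rewrite /n0; lia.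
have kB : (model_k m <= B)%N by rewrite mk; move: nB; rewrite /n0; lia.
have [|x hx stx] := @column_station w n A nA; first by rewrite /n; lia.
have [|y hy /hasP[_ /mapP[i hi ->] wr]] := @row_station w n B nB _ (hg n); first by rewrite /n; lia.
rewrite mem_iota add0n /= in hi.
have rowmove : (width (mods w n) y <= A)%N -> (y <= A + (2 * k + dl))%N -> exists y0,
    [/\ (B < y0)%N, (y0 <= A + (2 * k + dl) + 1)%N & filled S A y0].
  move=> hw hy2; exists y.+1; split; [lia|lia|].
  by apply: (filled_row vm cl fAB kB _ _ wr); [rewrite mk|lia].
have colmove j : (j < B)%N -> (x <= B + k)%N -> w (x%:Z, j%:Z) -> exists x0,
    [/\ (A < x0)%N, (x0 <= B + k + 1)%N & filled S x0 B].
  move=> jB xB wj; exists x.+1; split; [lia|lia|].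
  by apply: (filled_column vm cl fAB kA _ jB wj); rewrite mk.
have wy : (y <= width (mods w n) y + (2 * k + dl))%N by rewrite /width; case: ifP; lia.
have [hw|hw] := leqP (width (mods w n) y) A; first by right; apply: rowmove => //; lia.
have yA : (A + k < y)%N by move: hw; rewrite /width; case: ifP; lia.
case: stx => [/hasP[_ /mapP[j hj ->] wj]|xm].
  rewrite mem_iota /= in hj.
  by left; apply: (colmove j) => //; lia.
have /andP[_ /andP[/allP h2 _]] := hg n.
have /andP[_ /hasP[_ /mapP[j hj ->] wj]] := h2 x xm.
rewrite mem_iota in hj.
have [jB|jB] := ltnP j B; last first.
  (* The site of the forgiven column is too high. But [B <= j < x + dl] places [y] among the
     shortened rows, and [x < A + k] then gives [y - (2 * k + dl) <= A], against [hw]. This dictates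
     the amount of the shortening. *)
  have [] : (A < A)%N -> False by rewrite ltnn.
  apply: leq_trans hw _; rewrite /width ifT; first by lia.
  by apply/hasP; exists x => //; lia.
have [xB|xB] := leqP x (B + k); first by left; apply: (colmove j).
exfalso; move: hw; rewrite /width; case: ifP; lia.
Qed.

(** No move lets one side exceed the other by more than [D], so both sides tend to infinity. *)
Lemma grow_quadrant m w S : valid_model m -> model_k m = k -> closed_set m w S ->
  (forall n, grow n w) -> forall i j : nat, S (i%:Z, j%:Z).
Proof.
move=> vm mk cl hg.
pose D := (2 * k + dl + 1)%N.
have H N : exists A B, [/\ (n0 <= A)%N, (n0 <= B)%N, (A <= B + D)%N, (B <= A + D)%N &
    (N <= A + B)%N /\ filled S A B].
  elim: N => [|N [A [B [nA nB AB BA [NAB fAB]]]]].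
    exists n0, n0; split; rewrite ?leq_addr//; split=> //.
    apply: (filled_start vm cl); first by rewrite /n0; lia.
    have /andP[/allP h _] := hg 0.
    by move=> i j hi hj; apply: h; apply/allpairsP; exists (i, j); rewrite !mem_iota.
  case: (grow_step vm mk cl hg nA nB fAB) => [[x [h1 h2 h3]]|[y [h1 h2 h3]]].
    by exists x, B; rewrite /D; split; [lia|lia|lia|rewrite /D in BA; lia|split; [lia|]].
  by exists A, y; rewrite /D; split; [lia|lia|rewrite /D in AB; lia|lia|split; [lia|]].
move=> i j; have [A [B [_ _ AB BA [NAB fAB]]]] := H (2 * (i + j) + D + 2)%N.
by apply: fAB; lia.
Qed.

End Construction.

Lemma Ex_all (R : realType) (I : eqType) (a : I -> R) (L : seq I) w : uniq L ->
  Ex a L (fun v => (all v L)%:R) w = \prod_(x <- L) a x.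
Proof.
elim: L w => [|x L IH] w; first by rewrite big_nil.
move=> /andP[xL uL]; rewrite big_cons -(IH w uL).
rewrite (Ex_congr (b := a) (G := fun v => (v x)%:R * (all v L)%:R)) => [|//|v _]; last first.
  by rewrite -natrM mulnb.
rewrite -cat1s Ex_indep /=; first by rewrite /upd eqxx mulr1 mulr0 addr0.
- by move=> v v' h; rewrite h.
- by move=> v v' h; congr (_%:R); congr (nat_of_bool _); apply: eq_in_all => y yL; rewrite h.
Qed.

(** A row that could reach the extra segment of a forgiven column is shortened so as to stop before
    this column. So the two searches use different sites, and are independent. *)
Lemma useg_rseg_disjoint k dl (ms : seq nat) x y (z : site) :
  x \in ms -> z \in useg k dl x -> z \in rseg k dl ms y -> False.
Proof.
move=> xm /mapP[j + ->] /mapP[i + [e1 e2]]; rewrite !mem_iota -e1.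
have {}e2 : j = y by lia.
subst y; rewrite /width; case: ifP => [_|/negP h]; first by clear; lia.
move=> h1 h2; apply: h; apply/hasP; exists x => //; move: h1 h2; clear; lia.
Qed.

(** * Its probability in terms of chains of trials *)

Section GrowProb.
Variables (R : realType) (k dl : nat) (mid : pred nat) (p kap trow : R) (n : nat).
Hypothesis k0 : (0 < k)%N.
Hypothesis p01 : 0 <= p <= 1.
Hypothesis kap0 : 0 <= kap.
Hypothesis trow0 : 0 <= trow.
Implicit Types (w : config) (x y : nat) (ms : seq nat).
Local Notation n0 := (n0 k).

Let upr : R := 1 - (1 - p) ^+ (dl + k).
Let rho x : R := if mid x then kap * upr else 0.
Hypothesis hrow : forall ms, uniq ms -> all mid ms ->
  trow * kap ^+ size ms <= Zf k (fun=> 0) (fun y => 1 - (1 - p) ^+ width k dl ms y) n0 0 n.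

Let cols : seq site := flatten [seq cseg k x | x <- iota n0 n].
Let rest : seq site := [seq z <- box (n0 + n + dl + k) | z \notin start k ++ cols].

Let mem_cols z : (z \in cols) = [&& n0%:Z <= z.1, z.1 < (n0 + n)%N%:Z, 0 <= z.2 & z.2 + k%:Z < z.1].
Proof.
apply/flattenP/idP => [[_ /mapP[x hx ->] /mapP[j hj ->]]|].
  by rewrite !mem_iota in hx hj; rewrite /=; lia.
move=> /and4P[z1 z2 z3 z4]; exists (cseg k `|z.1|%N).
  by apply: map_f; rewrite mem_iota; lia.
apply/mapP; exists `|z.2|%N; first by rewrite mem_iota; lia.
by case: z z1 z2 z3 z4 => /= a b *; congr pair; lia.
Qed.

Let mem_start z : z \in start k -> z.1 < n0%:Z /\ z.2 < n0%:Z.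
Proof. by move=> /allpairsP[[a b] /= [+ + ->]]; rewrite !mem_iota /=; lia. Qed.

Let cols_ge z : z \in cols -> n0%:Z <= z.1.
Proof. by rewrite mem_cols => /andP[]. Qed.

Let uniq_all : uniq (start k ++ (cols ++ rest)).
Proof.
rewrite catA cat_uniq; apply/and3P; split.
- rewrite cat_uniq; apply/and3P; split.
  + by apply: allpairs_uniq; rewrite ?iota_uniq// => -[a b] [a' b'] _ _ [] -> ->.
  + apply/hasPn => z /cols_ge h; apply/negP => /mem_start[]; lia.
  + rewrite /cols; elim: (iota _ _) (iota_uniq n0 n) => //= x l IH /andP[xl ul].
    rewrite cat_uniq IH// andbT map_inj_uniq ?iota_uniq/=; last by move=> a b [].
    apply/hasPn => z /flattenP[_ /mapP[x' x'l ->] /mapP[j _ ->]]; apply/negP => /mapP[j' _ [e _]].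
    by rewrite -e x'l in xl.
- by apply/hasPn => z; rewrite mem_filter => /andP[].
- by apply: filter_uniq; exact: box_uniq.
Qed.

Let seg ms (e : bool * nat) : seq site := if e.1 then useg k dl e.2 else rseg k dl ms e.2.

Let width_le ms y : (width k dl ms y <= y - k)%N.
Proof. by rewrite /width; case: ifP; lia. Qed.

Let seg_rest ms e : (n0 <= e.2 < n0 + n)%N -> {subset seg ms e <= rest}.
Proof.
move=> he z hz; rewrite mem_filter mem_cat negb_or mem_box mem_cols.
have ns : n0%:Z <= z.1 \/ n0%:Z <= z.2 -> z \notin start k.
  by move=> h; apply/negP => /mem_start[]; lia.
case: e he hz => -[] x /= hx /mapP[j]; rewrite mem_iota /= => hj ez.
  by rewrite ns ?ez/=; [lia|left; lia].
have wl := width_le ms x.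
by rewrite ns ?ez/=; [lia|right; lia].
Qed.

Let seg_uniq ms e : uniq (seg ms e).
Proof. by rewrite /seg; case: ifP => _; rewrite map_inj_uniq ?iota_uniq// => a b []. Qed.

Let hit_seg ms e w : (n0 <= e.2 < n0 + n)%N ->
  hit (fun z e => z \in seg ms e) rest w e = has w (seg ms e).
Proof.
move=> he; apply/hasP/hasP => [[z _ /andP[wz ze]]|[z ze wz]]; first by exists z.
by exists z; [exact: seg_rest ze|rewrite wz].
Qed.

Let lprob_seg ms e : (n0 <= e.2 < n0 + n)%N ->
  lprob (fun z e => z \in seg ms e) p rest e = 1 - (1 - p) ^+ size (seg ms e).
Proof.
move=> he; rewrite /lprob -size_filter; congr (1 - _ ^+ _); apply: perm_size.
apply: uniq_perm; rewrite ?filter_uniq ?seg_uniq//; first exact: box_uniq.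
move=> z; rewrite mem_filter; case ze : (z \in _) => //=; exact: (seg_rest he ze).
Qed.

(** Once the column segments are revealed, the set [ms] of forgiven columns is fixed. The extra
    segments and the rows use disjoint sites of [rest], so the conditional probability is
    [upr^(size ms)] times that of the row chain, for which [hrow] is available. *)
Let rest_Ex w1 : (all mid (mods k w1 n))%:R * (trow * (kap * upr) ^+ size (mods k w1 n)) <=
  Ex (fun=> p) rest (fun w => (all (fun x => mid x && has w (useg k dl x)) (mods k w n) &&
   norun k 0 [seq has w (rseg k dl (mods k w n) y) | y <- iota n0 n])%:R) w1.
Proof.
set ms := mods k w1 n.
have ums : uniq ms by exact: resets_uniq.
have hms x : x \in ms -> (n0 <= x < n0 + n)%N.
  by move=> /(resets_bounds k0); rewrite size_map size_iota.
case: (boolP (all mid ms)) => [am|_]; last first.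
  rewrite mul0r; apply: Ex_ge0 => [//|v]; exact: ler0n.
rewrite mul1r.
pose LL := [seq (true, x) | x <- ms] ++ [seq (false, y) | y <- iota n0 n].
pose F1 (v : bool * nat -> bool) : R := (all (fun x => v (true, x)) ms)%:R.
pose F2 (v : bool * nat -> bool) : R := (norun k 0 [seq v (false, y) | y <- iota n0 n])%:R.
pose inc (z : site) e := z \in seg ms e.
pose F v := F1 v * F2 v.
have hLL e : e \in LL -> (n0 <= e.2 < n0 + n)%N.
  by rewrite mem_cat => /orP[] /mapP[x + ->] /=; [exact: hms|rewrite mem_iota].
have uLL : uniq LL.
  rewrite cat_uniq !map_inj_uniq ?ums ?iota_uniq ?andbT; try by move=> a b [].
  by apply/hasPn => _ /mapP[y _ ->]; apply/negP => /mapP[].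
have dF : dep_on LL F.
  move=> v v' h; rewrite /F /F1 /F2; congr (_%:R * _%:R).
    by congr (nat_of_bool _); apply: eq_in_all => x xm; apply: h; rewrite mem_cat map_f.
  congr (nat_of_bool (norun _ _ _)); apply/eq_in_map => y yi; apply: h.
  by rewrite mem_cat [X in _ || X]map_f ?orbT.
have -> : Ex (fun=> p) rest (fun w => (all (fun x => mid x && has w (useg k dl x)) (mods k w n) &&
   norun k 0 [seq has w (rseg k dl (mods k w n) y) | y <- iota n0 n])%:R) w1 =
  Ex (fun=> p) rest (fun w => F (fun e => false || hit inc rest w e)) w1.
  apply: Ex_congr => // w hw.
  have -> : mods k w n = ms.
    congr (resets _ _ _ _); apply/eq_in_map => x xi; apply: eq_in_has => z zx; apply: hw.
    rewrite mem_filter negb_and negbK mem_cat; apply/orP; left; apply/orP; right.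
    by apply/flattenP; exists (cseg k x) => //; exact: map_f.
  rewrite /F /F1 /F2 -natrM mulnb; congr (nat_of_bool (_ && norun _ _ _))%:R.
    apply: eq_in_all => x xm; rewrite (allP am)//= hit_seg//; exact: hms.
  by apply/eq_in_map => y; rewrite mem_iota => hy; rewrite /= hit_seg.
have hT x : (true, x) \in LL -> x \in ms.
  by rewrite mem_cat => /orP[/mapP[x' xm [->]]//|/mapP[]].
rewrite (@Ex_lines R _ _ inc p rest LL F (fun=> false) w1 (fun=> false))//; last 2 first.
- by apply: filter_uniq; exact: box_uniq.
- move=> z _ e e' eL e'L; have he := hLL e eL; have he' := hLL e' e'L; rewrite /inc /seg.
  have mix x y : (true, x) \in LL -> z \in useg k dl x -> z \in rseg k dl ms y -> False.
    by move=> xL; apply: useg_rseg_disjoint; exact: hT.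
  case: e e' eL e'L he he' => -[] x [[] y] /= eL e'L hx hy.
  + by move=> /mapP[j _ ->] /mapP[i _ [->]].
  + by move=> h1 h2; case: (mix x y eL h1 h2).
  + by move=> h1 h2; case: (mix y x e'L h2 h1).
  + by move=> /mapP[j _ ->] /mapP[i _ [_ ->]].
rewrite /F Ex_indep; last 2 first.
- move=> v v' h; rewrite /F1; congr (_%:R); congr (nat_of_bool _); apply: eq_in_all => x xm; apply: h.
  by apply/negP => /mapP[].
- move=> v v' h; rewrite /F2; congr (nat_of_bool (norun _ _ _))%:R; apply/eq_in_map => y yi; apply: h.
  exact: map_f.
have -> : Ex (lprob inc p rest) [seq (true, x) | x <- ms] F1 (fun=> false) = upr ^+ size ms.
  rewrite (Ex_congr (b := fun=> upr) (G := fun v => (all v [seq (true, x) | x <- ms])%:R)) => [||v _].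
  - by rewrite Ex_all ?big_map ?map_inj_uniq// => [|a b [->]//]; rewrite big_const_seq count_predT iter_mulr_1.
  - move=> _ /mapP[x xm ->]; rewrite /= lprob_seg/=; last exact: hms.
    by rewrite size_map size_iota.
  - by rewrite all_map.
have -> : Ex (lprob inc p rest) [seq (false, y) | y <- iota n0 n] F2 (fun=> false) =
    Zf k (fun=> 0) (fun y => 1 - (1 - p) ^+ width k dl ms y) n0 0 n.
  rewrite -(Ex_wt k (ln := pair false) (fun e => 1 - (1 - p) ^+ width k dl ms e.2) _ _ _ _ (fun=> false)).
    apply: Ex_congr => [_ /mapP[y + ->]|v _]; last by rewrite wt_norun.
    by rewrite mem_iota => hy; rewrite /= lprob_seg//= size_map size_iota.
  by move=> a b [].
rewrite exprMn mulrA [_ * upr ^+ _]mulrC; apply: ler_wpM2l; last exact: hrow.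
by rewrite exprn_ge0// /upr subr_ge0 exprn_ile1//; have /andP[] := p01; lra.
Qed.

(** Averaging [rest_Ex] over the columns turns the factor [kap * upr] of each forgiven column into
    the weight [rho] of the column chain. *)
Lemma grow_Ex : p ^+ (n0 * n0) * (trow * Zf k rho (fun x => 1 - (1 - p) ^+ (x - k)) n0 0 n) <=
  Ex (fun=> p) (start k ++ (cols ++ rest)) (fun w => (grow k dl mid n w)%:R) (fun=> false).
Proof.
have /andP[p0 p1] := p01.
pose G w : R := (all (fun x => mid x && has w (useg k dl x)) (mods k w n) &&
   norun k 0 [seq has w (rseg k dl (mods k w n) y) | y <- iota n0 n])%:R.
rewrite (Ex_congr (b := fun=> p) (G := fun w => (all w (start k))%:R * G w)) => [|//|w _]; last first.
  by rewrite /grow -natrM mulnb.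
have segL ms e z : (n0 <= e.2 < n0 + n)%N -> z \in seg ms e -> z \in cols ++ rest.
  by move=> he /(seg_rest he); rewrite mem_cat orbC => ->.
rewrite Ex_indep; last 2 first.
- move=> v v' h; congr (nat_of_bool _)%:R; apply: eq_in_all => z zs; apply: h.
  by have := uniq_all; rewrite cat_uniq => /and3P[_ /hasPn h' _]; apply/negP => /h'; rewrite zs.
- move=> v v' h; have em : mods k v n = mods k v' n.
    congr (resets _ _ _ _); apply/eq_in_map => x xi; apply: eq_in_has => z zx; apply: h.
    by rewrite mem_cat; apply/orP; left; apply/flattenP; exists (cseg k x) => //; exact: map_f.
  rewrite /G em; congr (nat_of_bool (_ && norun _ _ _))%:R.
    apply: eq_in_all => x xm; congr (_ && _); apply: eq_in_has => z zx; apply: h.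
    apply: (segL [::] (true, x)) => //=.
    by have := resets_bounds k0 xm; rewrite size_map size_iota.
  apply/eq_in_map => y; rewrite mem_iota => hy; apply: eq_in_has => z zy; apply: h.
  exact: (segL (mods k v' n) (false, y)).
rewrite Ex_all; last by have := uniq_all; rewrite cat_uniq => /andP[].
rewrite big_const_seq count_predT iter_mulr_1 size_allpairs !size_iota.
apply: ler_wpM2l; first exact: exprn_ge0.
rewrite Ex_cat.
have -> : Zf k rho (fun x => 1 - (1 - p) ^+ (x - k)) n0 0 n =
    Ex (fun=> p) cols (fun w => wt k rho n0 0 (cbits k w n)) (fun=> false).
  pose inc (z : site) x := z \in cseg k x.
  rewrite -(Ex_wt k (ln := id) (fun x => 1 - (1 - p) ^+ (x - k)) _ _ _ _ (fun=> false))// map_id.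
  pose F (v : nat -> bool) := wt k rho n0 0 [seq v x | x <- iota n0 n].
  have segc x z : x \in iota n0 n -> z \in cseg k x -> z \in cols.
    by move=> xi zx; apply/flattenP; exists (cseg k x) => //; exact: map_f.
  transitivity (Ex (lprob inc p cols) (iota n0 n) F (fun=> false)).
    apply: Ex_congr => // x xi; rewrite /lprob -size_filter; congr (1 - _ ^+ _).
    have -> : (x - k)%N = size (cseg k x) by rewrite size_map size_iota.
    apply: perm_size; apply: uniq_perm.
    - by rewrite map_inj_uniq ?iota_uniq// => a b [].
    - apply: filter_uniq; have := uniq_all; rewrite catA cat_uniq => /andP[+ _].
      by rewrite cat_uniq => /and3P[].
    - by move=> z; rewrite mem_filter; apply/idP/andP => [h|[]//]; split=> //; exact: segc h.
  rewrite -(@Ex_lines R _ _ inc p cols (iota n0 n) F (fun=> false) (fun=> false) (fun=> false)).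
  - apply: Ex_congr => // w _; rewrite /F /cbits; congr wt; apply/eq_in_map => x xi /=.
    apply/hasP/hasP => [[z _ /andP[wz zx]]|[z zx wz]]; exists z => //; last by rewrite wz.
    exact: segc zx.
  - by have := uniq_all; rewrite catA cat_uniq => /andP[+ _]; rewrite cat_uniq => /and3P[].
  - exact: iota_uniq.
  - by move=> v v' h; rewrite /F; congr wt; apply/eq_in_map.
  - by move=> z _ x y _ _ /mapP[j _ ->] /mapP[i _ []].
rewrite -Ex_scale; apply: Ex_le => [z _|w1 _]; first exact: p01.
apply: le_trans (rest_Ex w1); rewrite wt_resets -/(mods k w1 n).
case: (boolP (all mid (mods k w1 n))) => [/allP am|/allPn[x xm nx]]; last first.
  by rewrite mul0r (big_rem x)//= /rho (negbTE nx) mul0r mulr0.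
rewrite mul1r -(iter_mulr_1) -count_predT -big_const_seq big_seq [X in _ <= _ * X]big_seq.
by rewrite (eq_bigr (fun=> kap * upr))// => x xm; rewrite /rho am.
Qed.

Lemma grow_prob (d : measure_display) (T : measurableType d) (P : probability T R) (X : T -> config) :
  iid_bernoulli_field P X p ->
  measurable [set t | grow k dl mid n (X t)] /\
  ((p ^+ (n0 * n0) * (trow * Zf k rho (fun x => 1 - (1 - p) ^+ (x - k)) n0 0 n))%:E <=
   P [set t | grow k dl mid n (X t)])%E.
Proof.
move=> iid.
have det : determined (start k ++ (cols ++ rest)) (grow k dl mid n).
  move=> v v' h.
  have hc x z : x \in iota n0 n -> z \in cseg k x -> v z = v' z.
    move=> xi zx; apply: h; rewrite !mem_cat; apply/orP; right; apply/orP; left.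
    by apply/flattenP; exists (cseg k x) => //; exact: map_f.
  have hr ms e z : (n0 <= e.2 < n0 + n)%N -> z \in seg ms e -> v z = v' z.
    by move=> he /(seg_rest he) zr; apply: h; rewrite !mem_cat zr !orbT.
  have em : mods k v n = mods k v' n.
    by congr (resets _ _ _ _); apply/eq_in_map => x xi; apply: eq_in_has => z; exact: hc.
  rewrite /grow em; congr (_ && (_ && norun _ _ _)).
  - by apply: eq_in_all => z zs; apply: h; rewrite mem_cat zs.
  - apply: eq_in_all => x xm; congr (_ && _); apply: eq_in_has => z zx.
    apply: (hr [::] (true, x)) => //=.
    by have := resets_bounds k0 xm; rewrite size_map size_iota.
  - apply/eq_in_map => y; rewrite mem_iota => hy; apply: eq_in_has => z zy.
    exact: (hr (mods k v' n) (false, y)).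
have [mE ->] := prob_Ex iid (fun=> false) uniq_all det; split=> //.
by rewrite lee_fin grow_Ex.
Qed.

End GrowProb.

(** * Row and column chains bounded below by products *)

Section RowsColumns.
Variables (R : realType) (k : nat) (s : R).
Hypothesis k0 : (0 < k)%N.
Hypothesis s0 : 0 < s.
Local Notation n0 := (n0 k).
Implicit Types (m x y n : nat) (ms : seq nat).

(** By convexity the descent beyond [1/2] is no steeper than the chord from [1/4], whose steepness
    is at most [g (1/4) / (1/4)]. *)
Lemma g_lipschitz (z z' : R) : 1 / 2 <= z -> z <= z' -> g k z - g k z' <= 4 * g k (1 / 4) * (z' - z).
Proof.
move=> z2 zz; have q0 : 0 < 1 / 4 :> R by lra.
have q1 : 0 < z by lra.
have h := @g_convex R k k0 (1 / 4) z z' q0 ltac:(by apply/andP; split; lra).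
have gz := g_gt0 k0 q1; have ga := g_gt0 k0 q0.
have gzz := g_decr k0 q1 zz.
move: h gz ga gzz; move: (g k z) (g k z') (g k (1 / 4)) => a b c h a0 c0 ab.
have : (1 / 4) * (a - b) <= (z - 1 / 4) * (a - b) by apply: ler_wpM2r; lra.
have : 0 <= (z' - z) * a by apply: mulr_ge0; lra.
move=> *; lra.
Qed.

(** The shift by [2 * k] makes the factor of each line in a window of [k] lines starting at [y] at
    most the factor for [y - k] sites, the shortest nominal range in the window. *)
Definition tn m : R := if (m < n0)%N then 1 else expR (- g k (s * (m - 2 * k)%N%:R)).

Lemma tn_bounds m : 0 < tn m <= 1.
Proof.
rewrite /tn; case: ltnP => h; first by rewrite ltr01 lexx.
rewrite expR_gt0 expR_le1 oppr_le0 ltW//; apply: (g_gt0 k0); rewrite mulr_gt0// ltr0n.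
by move: h; rewrite /n0; lia.
Qed.

Let hitp (v : nat) : 1 - (1 - (1 - expR (- s))) ^+ v = 1 - expR (- (s * v%:R)).
Proof. by rewrite subKr -expRM_natr mulNr. Qed.

Let char_window (V : nat) : (0 < V)%N ->
  1 <= \sum_(m < k) (1 - expR (- (s * V%:R))) * expR (- (s * V%:R)) ^+ m /
     expR (- g k (s * V%:R)) ^+ m.+1.
Proof.
move=> V0; have z0 : 0 < s * V%:R by rewrite mulr_gt0// ltr0n.
rewrite -[leLHS](g_char k0 z0); apply: ler_sum => j _.
by rewrite [expR (- g k _)]expRN exprVn invrK.
Qed.

Section Rows.
Variables (dl M1 M2 : nat).
Let mid : pred nat := fun x => (M1 <= x < M2)%N.
Hypothesis sM1 : 1 <= s * M1%:R.
Hypothesis sdl : s * (4 * k + dl)%N%:R <= 1 / 2.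
Let beta : R := 4 * g k (1 / 4) * (s * (k + dl)%N%:R).

(** The condition of [width] widened by [k] at both ends, so that a shortened row flags every row
    that shares a window with it. *)
Let flag ms m := has (fun x => (m <= x + dl + 2 * k)%N && (x < m + k)%N) ms.
Let W' ms m := if flag ms m then (m - (3 * k + dl))%N else (m - 2 * k)%N.
Let T' ms m : R := if (m < n0)%N then 1 else expR (- g k (s * (W' ms m)%:R)).

Let flag_big ms m : all mid ms -> flag ms m -> 1 / 2 <= s * (m - (3 * k + dl))%N%:R.
Proof.
move=> /allP am /hasP[x /am /andP[h1 _] /andP[_ h2]].
have : s * (M1 - (4 * k + dl))%N%:R <= s * (m - (3 * k + dl))%N%:R.
  by rewrite ler_pM2l// ler_nat; lia.
apply: le_trans.
have [h|h] := leqP (4 * k + dl) M1; first by rewrite natrB// mulrBr; have := sM1; have := sdl; lra.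
have : s * M1%:R <= s * (4 * k + dl)%N%:R by rewrite ler_pM2l// ler_nat ltnW.
by have := sM1; have := sdl; lra.
Qed.

Let W'_gt0 ms m : all mid ms -> (n0 <= m)%N -> (0 < W' ms m)%N.
Proof.
move=> am nm; rewrite /W'; case: ifP => [/(flag_big am) h|_]; last by move: nm; rewrite /n0; lia.
by rewrite -(ltr0n R) -(pmulr_rgt0 _ s0); lra.
Qed.

Let count_flag ms n : (count (flag ms) (iota n0 n) <= size ms * (dl + 3 * k))%N.
Proof.
elim: ms => [|x ms IH]; first by rewrite (eq_count (a2 := pred0))// count_pred0.
rewrite mulSn; apply: leq_trans (leq_add _ IH); last first.
  instantiate (1 := count (fun m => (m <= x + dl + 2 * k)%N && (x < m + k)%N) (iota n0 n)).
  rewrite -size_filter; have -> : (dl + 3 * k)%N = size (iota (x.+1 - k) (dl + 3 * k)) by rewrite size_iota.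
  apply: uniq_leq_size; first by apply: filter_uniq; exact: iota_uniq.
  by move=> m; rewrite mem_filter !mem_iota; lia.
rewrite -count_predUI; apply: leq_trans (leq_addr _ _).
exact: sub_count.
Qed.

(** A forgiven column flags at most [dl + 3 * k] rows. Each has [k + dl] fewer sites in its bound
    and, as the column is beyond [1/s], a scaled length at least [1/2], where [g_lipschitz] limits
    its loss to [exp (- beta)]. *)
Lemma rows_bound ms n (kap : R) : all mid ms ->
  0 <= kap -> kap <= expR (- beta) ^+ (dl + 3 * k) ->
  (\prod_(n0 <= m < n0 + n) tn m) * kap ^+ size ms <=
  Zf k (fun=> 0) (fun y => 1 - (1 - (1 - expR (- s))) ^+ width k dl ms y) n0 0 n.
Proof.
move=> am kp0 kb.
apply: (@le_trans _ _ (\prod_(n0 <= m < n0 + n) T' ms m)).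
  have gq : 0 < g k (1 / 4 : R) by apply: (g_gt0 k0); lra.
  have b0 : 0 <= beta by rewrite /beta !mulr_ge0// ltW.
  have e01 : 0 <= expR (- beta) <= 1 by rewrite expR_ge0 expR_le1 oppr_le0.
  apply: (@le_trans _ _ (\prod_(n0 <= m < n0 + n) (tn m * (if flag ms m then expR (- beta) else 1)))).
    rewrite big_split /=; apply: ler_wpM2l.
      by apply: prodr_ge0 => m _; have /andP[/ltW] := tn_bounds m.
    rewrite -big_mkcond big_const_seq iter_mulr_1 /index_iota addKn.
    apply: (@le_trans _ _ ((expR (- beta) ^+ (dl + 3 * k)) ^+ size ms)).
      by apply: lerXn2r; rewrite ?nnegrE ?exprn_ge0 ?expR_ge0.
    by rewrite -exprM; apply: ler_wiXn2l; rewrite ?expR_ge0 ?expR_le1 ?oppr_le0// mulnC count_flag.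
  rewrite big_nat_cond [leRHS]big_nat_cond; apply: ler_prod => m /andP[/andP[nm _] _].
  have /andP[t0 t1] := tn_bounds m; apply/andP; split.
    by apply: mulr_ge0; [exact: ltW|case: ifP => _//; exact: expR_ge0].
  rewrite /tn /T' ltnNge nm /= /W'; case: ifP => [fm|_]; last by rewrite mulr1.
  rewrite -expRD ler_expR.
  have h1 := flag_big am fm.
  have h2 : s * (m - (3 * k + dl))%N%:R <= s * (m - 2 * k)%N%:R.
    by rewrite ler_pM2l// ler_nat; clear; lia.
  have h3 := g_lipschitz h1 h2.
  have h4 : s * (m - 2 * k)%N%:R - s * (m - (3 * k + dl))%N%:R <= s * (k + dl)%N%:R.
    by rewrite lerBlDl -mulrDr -natrD ler_pM2l// ler_nat; clear; lia.
  have h5 : 4 * g k (1 / 4) * (s * (m - 2 * k)%N%:R - s * (m - (3 * k + dl))%N%:R) <= beta.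
    by apply: ler_wpM2l => //; rewrite mulr_ge0// ltW.
  by rewrite -opprD lerN2 -lerBlDl; exact: le_trans h3 h5.
apply: (Zf_lower k0) => //.
- by move=> y; rewrite hitp gerBl expR_ge0 andbT subr_ge0 expR_le1 oppr_le0 mulr_ge0// ltW.
- by move=> y; rewrite lexx ler01.
- by move=> y; rewrite hitp subr_ge0 expR_le1 oppr_le0 mulr_ge0// ltW.
- move=> m; rewrite /T'; case: ltnP => h; first by rewrite ltr01 lexx.
  rewrite expR_gt0 expR_le1 oppr_le0 ltW//; apply: (g_gt0 k0); rewrite mulr_gt0// ltr0n.
  exact: W'_gt0.
- move=> y ny yn.
  pose fw y' := has (fun x => (y' <= x + dl + k)%N && (x < y')%N) ms.
  pose V := if has fw (iota y k) then (y - (2 * k + dl))%N else (y - k)%N.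
  have W'V z : (y <= z < y + k)%N -> (W' ms z <= V)%N.
    move=> hz; rewrite /V; case: ifP => [/hasP[y' + /hasP[x xm hx]]|_].
      rewrite mem_iota => hy'; rewrite /W' ifT; first by move: hz; clear; lia.
      by apply/hasP; exists x => //; move: hz hy' hx; clear; lia.
    by rewrite /W'; case: ifP => _; move: hz; clear; lia.
  have V0 : (0 < V)%N.
    apply: leq_trans (W'V y _); last by move: k0; clear; lia.
    exact: W'_gt0.
  exists (expR (- (s * V%:R))), (expR (- g k (s * V%:R))); split.
  + by rewrite expR_ge0 expR_le1 oppr_le0 mulr_ge0// ltW.
  + exact: expR_gt0.
  + move=> z hz; split.
      rewrite hitp lerD2l lerN2 ler_expR lerN2 ler_pM2l// ler_nat /V /width.
      case: ifP => [_|/negbT/hasPn h]; first by case: ifP => _; move: hz; clear; lia.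
      rewrite ifF; first by move: hz; clear; lia.
      by apply/negbTE; apply: h; rewrite mem_iota.
    have nz : (n0 <= z)%N by move: hz ny; clear; lia.
    rewrite /T' ltnNge nz /= ler_expR lerN2; apply: (g_decr k0).
      by rewrite mulr_gt0// ltr0n W'_gt0.
    by rewrite ler_pM2l// ler_nat W'V.
  + by rewrite mul0r mul0r addr0; exact: char_window.
Qed.

End Rows.

Section Columns.
Variables (M1 M2 : nat) (rho eps : R).
Let mid : pred nat := fun x => (M1 <= x < M2)%N.
Let mid' m := (M1 <= m)%N && (m + k <= M2)%N.
Hypothesis sM1 : 1 / 2 <= s * (M1 - k)%N%:R.
Hypothesis sM2 : s * M2%:R <= 3.
Hypothesis rho01 : 0 <= rho <= 1 / 4.
Hypothesis eps0 : 0 <= eps.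
Hypothesis eps_rho : k%:R * eps <= rho * expR (- 3) ^+ k.
Hypothesis eps3 : eps <= g k (3 : R).

Let Tc m : R := tn m * (if mid' m && (n0 <= m)%N then 1 + eps else 1).

Let eps_exp : 1 + eps <= expR (g k (3 : R)).
Proof. by apply: le_trans (expR_ge1Dx _) _; rewrite ler_expR. Qed.

(** A factor [1 + eps] on the middle columns lowers the renewal sum by at most [k * eps]. The reset
    term makes up for it, being at least [rho * exp (- 3)^k], since [u >= exp (- 3)] while the
    scaled length is at most 3. *)
Lemma columns_bound n :
  \prod_(n0 <= m < n0 + n) Tc m <=
  Zf k (fun x => if mid x then rho else 0) (fun x => 1 - (1 - (1 - expR (- s))) ^+ (x - k)) n0 0 n.
Proof.
have he0 := eps0; have e1 : 0 < 1 + eps by lra.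
have /andP[rho0 rho4] := rho01.
apply: (Zf_lower k0) => //.
- by move=> y; rewrite hitp gerBl expR_ge0 andbT subr_ge0 expR_le1 oppr_le0 mulr_ge0// ltW.
- by move=> y; case: ifP => _; rewrite ?lexx ?ler01// rho0; lra.
- move=> y; case: ifP => [/andP[h1 _]|_]; last by rewrite hitp subr_ge0 expR_le1 oppr_le0 mulr_ge0// ltW.
  rewrite hitp; have := @one_minus_expRN_ge R (1 / 2) ltac:(lra) ltac:(lra).
  have : expR (- (s * (y.+1 - k)%N%:R)) <= expR (- (1 / 2)).
    rewrite ler_expR lerN2; apply: le_trans sM1 _; rewrite ler_pM2l// ler_nat; move: h1; clear; lia.
  by lra.
- move=> m; rewrite /Tc /tn; case: ltnP => nm.
    by rewrite andbF mulr1 ltr01 lexx.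
  have z0 : 0 < s * (m - 2 * k)%N%:R.
    by rewrite mulr_gt0// ltr0n; move: nm k0; rewrite /n0; clear; lia.
  rewrite andbT; case: ifP => [/andP[_ mM]|_]; last first.
    by rewrite mulr1 expR_gt0 expR_le1 oppr_le0 ltW// (g_gt0 k0).
  rewrite mulr_gt0 ?expR_gt0//= expRN ler_pdivrMl ?expR_gt0// mulr1.
  apply: le_trans eps_exp _; rewrite ler_expR; apply: (g_decr k0) => //.
  by apply: le_trans sM2; rewrite ler_pM2l// ler_nat; move: mM; clear; lia.
- move=> y ny yn.
  have V0 : (0 < y - k)%N by move: ny k0; rewrite /n0; clear; lia.
  have z0 : 0 < s * (y - k)%N%:R by rewrite mulr_gt0// ltr0n.
  have tz z : (y <= z < y + k)%N -> tn z <= expR (- g k (s * (y - k)%N%:R)).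
    move=> hz; rewrite /tn ltnNge (_ : (n0 <= z)%N); last by move: hz ny; clear; lia.
    rewrite /= ler_expR lerN2; apply: (g_decr k0).
      by rewrite mulr_gt0// ltr0n; move: ny hz k0; rewrite /n0; clear; lia.
    by rewrite ler_pM2l// ler_nat; move: hz; clear; lia.
  have az z : (y <= z < y + k)%N -> 1 - expR (- (s * (y - k)%N%:R)) <= 1 - (1 - (1 - expR (- s))) ^+ (z - k).
    by move=> hz; rewrite hitp lerD2l lerN2 ler_expR lerN2 ler_pM2l// ler_nat; move: hz; clear; lia.
  set u := expR (- (s * (y - k)%N%:R)) in az *; set tau := expR (- g k _) in tz.
  have u0 : 0 <= u by exact: expR_ge0.
  have u1 : u <= 1 by rewrite expR_le1 oppr_le0 ltW.
  have tau0 : 0 < tau by exact: expR_gt0.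
  have tau1 : tau <= 1 by rewrite expR_le1 oppr_le0 ltW// (g_gt0 k0).
  have ch := char_window V0; rewrite -/u -/tau in ch.
  case: (boolP (mid (y + k).-1)) => hm; last first.
    exists u, tau; split; [by rewrite u0|exact: tau0| |by rewrite mul0r mul0r addr0].
    move=> z hz; split; first exact: az.
    rewrite /Tc (_ : mid' z = false) ?mulr1; first exact: tz.
    apply/negP => /andP[h1 h2]; move/negP: hm; apply; rewrite /mid.
    by move: hz h1 h2 k0; clear; lia.
  exists u, (tau * (1 + eps)); split.
  + by rewrite u0.
  + exact: mulr_gt0.
  + move=> z hz; split; first exact: az.
    apply: ler_pM; [by have /andP[/ltW] := tn_bounds z| |exact: tz|].
      by case: ifP => _; lra.
    by case: ifP => _; lra.
  + have yM : s * (y - k)%N%:R <= 3.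
      by apply: le_trans sM2; rewrite ler_pM2l// ler_nat; move: hm; rewrite /mid; clear; lia.
    have ie0 : 0 < (1 + eps)^-1 by rewrite invr_gt0.
    have ie1 : (1 + eps)^-1 <= 1 by rewrite invf_le1//; lra.
    have bern j : (j <= k)%N -> 1 - k%:R * eps <= (1 + eps)^-1 ^+ j.
      move=> jk; apply: (@le_trans _ _ (1 - j%:R * eps)).
        by rewrite lerD2l lerN2 ler_wpM2r// ler_nat.
      have ie : 1 - eps <= (1 + eps)^-1 by rewrite -div1r ler_pdivlMr//; nra.
      elim: j {jk} => [|j IH]; first by rewrite mul0r subr0 expr0.
      rewrite exprS -natr1; have [neg|pos] := leP (1 - j%:R * eps) 0.
        apply: (@le_trans _ _ 0); last by rewrite mulr_ge0 ?exprn_ge0// ltW.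
        by rewrite mulrDl mul1r; lra.
      have je : 0 <= j%:R * eps * eps by rewrite !mulr_ge0.
      have : (1 + eps)^-1 * (1 - j%:R * eps) <= (1 + eps)^-1 * (1 + eps)^-1 ^+ j.
        by apply: ler_wpM2l => //; exact: ltW.
      have : (1 - eps) * (1 - j%:R * eps) <= (1 + eps)^-1 * (1 - j%:R * eps).
        by apply: ler_wpM2r => //; exact: ltW.
      move=> h1 h2; apply: le_trans h2; apply: le_trans h1; lra.
    have step1 : 1 - k%:R * eps <=
        \sum_(m < k) (1 - u) * u ^+ m / (tau * (1 + eps)) ^+ m.+1.
      have [neg|pos] := leP (1 - k%:R * eps) 0.
        apply: le_trans neg _; apply: sumr_ge0 => j _.
        by rewrite divr_ge0 ?mulr_ge0 ?exprn_ge0 ?subr_ge0// ltW// mulr_gt0.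
      apply: (@le_trans _ _ ((1 - k%:R * eps) * \sum_(m < k) (1 - u) * u ^+ m / tau ^+ m.+1)).
        by rewrite -[leLHS]mulr1; apply: ler_wpM2l => //; exact: ltW.
      rewrite mulr_sumr; apply: ler_sum => j _.
      rewrite exprMn invfM [leRHS]mulrA [leRHS]mulrC; apply: ler_wpM2r; last by rewrite -exprVn; apply: bern.
      by rewrite divr_ge0 ?mulr_ge0 ?exprn_ge0 ?subr_ge0// ltW.
    have tt : tau * (1 + eps) <= 1.
      rewrite /tau expRN ler_pdivrMl ?expR_gt0// mulr1; apply: le_trans eps_exp _.
      by rewrite ler_expR; apply: (g_decr k0).
    have step2 : rho * expR (- 3) ^+ k <= rho * u ^+ k / (tau * (1 + eps)) ^+ k.
      have tk0 : 0 < (tau * (1 + eps)) ^+ k by rewrite exprn_gt0// mulr_gt0.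
      rewrite ler_pdivlMr//; apply: (@le_trans _ _ (rho * expR (- 3) ^+ k * 1)).
        apply: ler_wpM2l; first by rewrite mulr_ge0 ?exprn_ge0 ?expR_ge0.
        by apply: exprn_ile1 => //; rewrite ltW// mulr_gt0.
      rewrite mulr1; apply: ler_wpM2l => //; apply: lerXn2r; rewrite ?nnegrE ?expR_ge0//.
      by rewrite ler_expR; lra.
    have := eps_rho; move: step1 step2; lra.
Qed.

End Columns.
End RowsColumns.

(** * Choice of the constants in the lower bound *)

Section LowerGrow.
Variables (R : realType) (k : nat).
Hypothesis k0 : (0 < k)%N.
Local Notation n0 := (n0 k).

(** A Riemann sum of the decreasing [g]: [s * g (s (k + i + 1))] is at most the increment of [GG].
    The first factor is kept apart as [exp (- g s)]. *)
Lemma prod_tn_lower (s : R) n : 0 < s ->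
  expR (- g k s - lam R k / s) <= \prod_(n0 <= m < n0 + n) tn k s m.
Proof.
move=> s0.
have zk i : 0 < s * (k + i)%N%:R by rewrite mulr_gt0// ltr0n addn_gt0 k0.
have gs := g_gt0 k0 s0.
have lam0 : 0 <= lam R k by apply: le_trans (GG_ge0 k0 s0) (GG_le_lam k0 s0).
have tnE i : tn k s (n0 + i) = expR (- g k (s * (k + i)%N%:R)).
  rewrite /tn ltnNge leq_addr /=; congr (expR (- g k (s * _%:R))).
  by rewrite /n0; clear; lia.
case: n => [|n].
  rewrite addn0 big_geq// expR_le1; have : 0 <= lam R k / s by rewrite divr_ge0// ltW.
  by lra.
apply: (@le_trans _ _ (expR (- g k s - GG k (s * (k + n)%N%:R) / s))).
  by rewrite ler_expR lerD2l lerN2 ler_pM2r ?invr_gt0// GG_le_lam.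
elim: n => [|n IH].
  have e0 := tnE 0; have zk0 := zk 0; rewrite !addn0 in e0 zk0.
  rewrite addn0 addn1 big_nat1 e0 ler_expR.
  have : 0 <= GG k (s * k%:R) / s by rewrite divr_ge0 ?(ltW s0)// GG_ge0.
  have : g k (s * k%:R) <= g k s.
    by apply: (g_decr k0 s0); rewrite -[leLHS]mulr1 ler_pM2l// ler1n.
  by lra.
rewrite (addnS n0 n.+1) big_nat_recr ?leq_addr//= tnE.
apply: (@le_trans _ _ (expR (- g k s - GG k (s * (k + n)%N%:R) / s) * expR (- g k (s * (k + n.+1)%N%:R)))); last first.
  by apply: ler_wpM2r; [exact: expR_ge0|exact: IH].
rewrite -expRD ler_expR.
have zz : s * (k + n)%N%:R <= s * (k + n.+1)%N%:R by rewrite ler_pM2l// ler_nat addnS.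
have := GG_rectangle k0 (zk n) zz.
have -> : s * (k + n.+1)%N%:R - s * (k + n)%N%:R = s by rewrite addnS -natr1; ring.
move=> h; have : g k (s * (k + n.+1)%N%:R) <= (GG k (s * (k + n.+1)%N%:R) - GG k (s * (k + n)%N%:R)) / s.
  by rewrite ler_pdivlMr// mulrC.
by rewrite mulrBl => hd; rewrite -[leRHS]addrA lerD2l -opprD lerN2 -lerBrDl.
Qed.

Lemma count_mid M1 M2 n : (n0 <= M1)%N -> (M2 <= n0 + n)%N ->
  (M2 - M1 - k <= count (fun m => [&& M1 <= m, m + k <= M2 & n0 <= m]%N) (iota n0 n))%N.
Proof.
move=> h1 h2; rewrite -size_filter -(size_iota M1 (M2 - M1 - k)).
apply: uniq_leq_size; first exact: iota_uniq.
by move=> m; rewrite mem_filter !mem_iota; lia.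
Qed.

Lemma one_plus_ge_exp (e : R) : 0 <= e -> e <= 1 -> expR (e / 2) <= 1 + e.
Proof.
move=> h0 h1; have := @expR_ge1Dx R (- (e / 2)); rewrite expRN => h.
have p : 0 < 1 - e / 2 by lra.
have : expR (e / 2) * (1 - e / 2) <= 1.
  by rewrite -ler_pdivlMl ?expR_gt0// mulr1.
have := expR_gt0 (e / 2); move: (expR _) => y y0 hy.
have : 1 <= (1 + e) * (1 - e / 2) by nra.
by move=> hz; rewrite -(ler_pM2r p); apply: le_trans hy hz.
Qed.

Lemma exp_inv_large (a r : R) : 0 < a -> 0 < r -> r <= a ^+ 3 / 54 -> 2 / r ^+ 2 <= expR (a / r).
Proof.
move=> a0 r0 ra; have -> : expR (a / r) = expR (a / r / 3) ^+ 3.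
  by rewrite -expRM_natl; congr expR; lra.
apply: (@le_trans _ _ ((a / r / 3) ^+ 3)); last first.
  apply: lerXn2r; rewrite ?nnegrE ?expR_ge0//; first by rewrite !divr_ge0// ltW.
  by apply: le_trans (expR_ge1Dx _); lra.
have -> : (a / r / 3) ^+ 3 = a ^+ 3 / 27 / r / r ^+ 2.
  by field; rewrite lt0r_neq0.
by rewrite ler_pM2r ?invr_gt0 ?exprn_gt0// ler_pdivlMr//; lra.
Qed.

Let Lg : R := 4 * g k (1 / 4 : R).
(** A forgiven column affects at most [dl + 3 * k] rows, each losing at most [Lg * s * (k + dl)] in
    the exponent. The [4] is [2 * 2], as [r (dl + 3 k)] and [r (k + dl)] are at most 2. *)
Let kap : R := expR (- (Lg * 4)).
Let c0 : R := kap * expR (- 3) ^+ k / (2 * k%:R).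
(** Powers of [p] to be paid: [n0 * n0] for the starting square, and one for the first factor of
    each of the row and column products. By the choice of [dlt] they cost at most
    [exp (- c0 / 8 / r)], half of the gain [c0 / 4 / r] in the exponent. *)
Let K : nat := (n0 * n0 + 2)%N.
Let dlt : R := c0 / (8 * K%:R).

Lemma c0_gt0 : 0 < c0.
Proof. by rewrite /c0 divr_gt0 ?mulr_gt0 ?exprn_gt0 ?expR_gt0 ?ltr0n. Qed.

Lemma dlt_gt0 : 0 < dlt.
Proof. by rewrite /dlt divr_gt0 ?c0_gt0// mulr_gt0// ltr0n /K addn2. Qed.

Section Scale.
Variables (s : R).
Let r := Num.sqrt s.
Hypothesis s0 : 0 < s.
Hypotheses (r16 : r <= 1 / (16 * k%:R)) (rg : r <= g k (3 : R) / 2) (rd : r <= dlt ^+ 3 / 54).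
Let dl := Num.truncn r^-1.
Let M1 := (Num.truncn s^-1).+1.
Let M2 := (2 * M1)%N.
Let mid : pred nat := fun x => (M1 <= x < M2)%N.
Let p : R := 1 - expR (- s).
Let upr : R := 1 - (1 - p) ^+ (dl + k).
Let rho := kap * upr.
Let eps : R := rho * expR (- 3) ^+ k / k%:R.

Let r0 : 0 < r. Proof. by rewrite sqrtr_gt0. Qed.
Let rr : r * r = s. Proof. by rewrite -expr2 sqr_sqrtr// ltW. Qed.
Let k1 : 1 <= k%:R :> R. Proof. by rewrite ler1n. Qed.
Let kr : k%:R * r <= 1 / 16.
Proof.
have k00 : 0 < k%:R :> R by rewrite ltr0n.
have := r16; rewrite ler_pdivlMr ?mulr_gt0// => h; lra.
Qed.
Let r1 : r <= 1 / 16.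
Proof. by have := kr; have := k1; have := r0; nra. Qed.
Let ri : r^-1 * r = 1. Proof. by rewrite mulVf// lt0r_neq0. Qed.
Let dl_le : r * dl%:R <= 1.
Proof.
have /andP[h _] := @truncn_itv R r^-1 ltac:(by rewrite invr_ge0 ltW).
by have := ler_wpM2l (ltW r0) h; rewrite [r * _^-1]mulrC ri.
Qed.
Let dl_ge : 1 <= r * (dl + k)%N%:R.
Proof.
have /andP[_ h] := @truncn_itv R r^-1 ltac:(by rewrite invr_ge0 ltW).
have := ler_wpM2l (ltW r0) (ltW h); rewrite [r * _^-1]mulrC ri => /le_trans; apply.
by rewrite ler_pM2l// ler_nat -/dl; move: k0; clear; lia.
Qed.
Let si : s^-1 * s = 1. Proof. by rewrite mulVf// lt0r_neq0. Qed.
Let sM1 : 1 <= s * M1%:R.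
Proof.
have /andP[_ h] := @truncn_itv R s^-1 ltac:(by rewrite invr_ge0 ltW).
by have := ler_wpM2l (ltW s0) (ltW h); rewrite [s * _^-1]mulrC si.
Qed.
Let s256 : s <= 1 / 256. Proof. by rewrite -rr; have := r1; have := r0; nra. Qed.
Let sM1u : s * M1%:R <= 1 + s.
Proof.
have /andP[h _] := @truncn_itv R s^-1 ltac:(by rewrite invr_ge0 ltW).
by rewrite /M1 -natr1 mulrDr mulr1 lerD2r -[leRHS]si [leRHS]mulrC ler_pM2l.
Qed.
Let ks : k%:R * s <= 1 / 256.
Proof. by rewrite -rr; have := r1; have := r0; have := kr; have := k1; nra. Qed.
Let sdl : s * (4 * k + dl)%N%:R <= 1 / 2.
Proof.
rewrite natrD natrM mulrDr -[X in _ + X * _]rr -mulrA.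
have := ler_wpM2l (ltW r0) dl_le; have := r1; have := ks; lra.
Qed.
Let sM1k : 1 / 2 <= s * (M1 - k)%N%:R.
Proof.
have kM : (k <= M1)%N.
  by rewrite -(ler_nat R) -(ler_pM2l s0); have := ks; have := sM1; lra.
by rewrite natrB// mulrBr; have := ks; have := sM1; lra.
Qed.
Let sM2 : s * M2%:R <= 3.
Proof. by rewrite /M2 natrM; have := sM1u; have := s256; lra. Qed.
Let upE : upr = 1 - expR (- (s * (dl + k)%N%:R)).
Proof. by rewrite /upr /p subKr -expRM_natr mulNr. Qed.
Let upr_ge : r / 2 <= upr.
Proof.
have h := one_minus_expRN_ge (ltW r0) ltac:(have := r1; lra).
apply: le_trans h _; rewrite upE lerD2l lerN2 ler_expR lerN2 -[leLHS]mulr1 -rr -mulrA.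
by rewrite ler_pM2l.
Qed.
Let upr_le : upr <= 2 * r.
Proof.
have h := @expR_ge1Dx R (- (s * (dl + k)%N%:R)).
have h2 : s * (dl + k)%N%:R <= 2 * r.
  rewrite natrD mulrDr -[X in X * dl%:R]rr -mulrA.
  have := ler_wpM2l (ltW r0) dl_le; have := ks.
  have : k%:R * s <= r by rewrite -rr; have := kr; have := r0; nra.
  lra.
rewrite upE; lra.
Qed.
Let kap01 : 0 < kap <= 1.
Proof.
rewrite expR_gt0 expR_le1 oppr_le0 mulr_ge0// mulr_ge0// ltW//.
by apply: (g_gt0 k0); lra.
Qed.
Let rho_ge : kap * (r / 2) <= rho.
Proof. by apply: ler_wpM2l => //; apply: ltW; have /andP[] := kap01. Qed.
Let rho_le : rho <= 2 * r.
Proof.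
apply: le_trans upr_le; rewrite -[leRHS]mul1r; have /andP[h1 h2] := kap01.
apply: ler_wpM2r => //; have := upr_ge; have := r0; lra.
Qed.
Let rho0 : 0 <= rho.
Proof. by apply: le_trans rho_ge; rewrite mulr_ge0 ?expR_ge0//; have := r0; lra. Qed.
Let e3k : 0 < expR (- 3 : R) ^+ k <= 1.
Proof. by rewrite exprn_gt0 ?expR_gt0// exprn_ile1 ?expR_ge0// expR_le1; lra. Qed.
Let eps_ge : c0 * r <= eps.
Proof.
rewrite /eps /c0; have := rho_ge; have /andP[e0 _] := e3k; have k00 : 0 < k%:R :> R by rewrite ltr0n.
move=> h; rewrite ler_pdivlMr//.
have -> : kap * expR (- 3) ^+ k / (2 * k%:R) * r * k%:R = kap * (r / 2) * expR (- 3) ^+ k.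
  by field; rewrite lt0r_neq0.
by apply: ler_wpM2r => //; exact: ltW.
Qed.
Let eps_le : eps <= 2 * r.
Proof.
rewrite /eps; have k00 : 0 < k%:R :> R by rewrite ltr0n.
rewrite ler_pdivrMr//; apply: (@le_trans _ _ (2 * r * 1)); last first.
  by apply: ler_wpM2l => //; have := r0; lra.
have /andP[e0 e1] := e3k; apply: ler_pM => //; exact: ltW.
Qed.
Let eps0 : 0 <= eps.
Proof. by apply: le_trans eps_ge; rewrite mulr_ge0 ?(ltW c0_gt0)// ltW. Qed.
Let n0M1 : (n0 <= M1)%N.
Proof.
rewrite -(ler_nat R) -(ler_pM2l s0); apply: le_trans sM1.
by rewrite /n0 natrM; have := ks; lra.
Qed.
Let p_ge : s / 2 <= p.
Proof. by apply: one_minus_expRN_ge; [exact: ltW|have := s256; lra]. Qed.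
Let p_pow : expR (- (c0 / 8 / r)) <= p ^+ K.
Proof.
have h := exp_inv_large dlt_gt0 r0 rd.
have s2 : 0 < s / 2 by have := s0; lra.
apply: (@le_trans _ _ ((s / 2) ^+ K)); last first.
  by apply: lerXn2r => //; rewrite nnegrE; [exact: ltW|apply: le_trans p_ge; exact: ltW].
have -> : - (c0 / 8 / r) = K%:R * - (dlt / r).
  have K0 : K%:R != 0 :> R by rewrite pnatr_eq0 /K addn2.
  by rewrite /dlt; field; rewrite K0 lt0r_neq0.
rewrite expRM_natl; apply: lerXn2r; rewrite ?nnegrE ?expR_ge0 ?(ltW s2)//.
rewrite expRN -[leRHS]invrK lef_pV2 ?posrE ?expR_gt0 ?invr_gt0//.
by apply: le_trans h; rewrite invf_div -rr expr2.
Qed.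

Lemma grow_lower n (d : measure_display) (T : measurableType d) (P : probability T R) (X : T -> config) :
  iid_bernoulli_field P X p ->
  measurable [set t | grow k dl mid n (X t)] /\
  ((expR (- (2 * lam R k) / s + c0 / 8 / r))%:E <= P [set t | grow k dl mid n (X t)])%E.
Proof.
move=> iid.
have p01 : 0 <= p <= 1 by rewrite /p subr_ge0 gerBl expR_ge0 expR_le1 oppr_le0 ltW.
have /andP[p0 p1] := p01; have /andP[kp0 kp1] := kap01.
have tn0 N : 0 <= \prod_(n0 <= m < n0 + N) tn k s m.
  by apply: prodr_ge0 => m _; have /andP[/ltW] := tn_bounds k0 s0 m.
have kapb : kap <= expR (- (Lg * (s * (k + dl)%N%:R))) ^+ (dl + 3 * k).
  rewrite -expRM_natl ler_expR mulrN lerN2.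
  have g0 : 0 <= Lg by rewrite /Lg mulr_ge0// ltW// (g_gt0 k0)//; lra.
  rewrite mulrCA; apply: ler_wpM2l => //.
  rewrite -[X in _ * (X * _)]rr mulrCA -mulrA.
  have e1 : r * (k + dl)%N%:R <= 2 by rewrite natrD mulrDr; have := kr; have := dl_le; lra.
  have e2 : r * (dl + 3 * k)%N%:R <= 2 by rewrite natrD natrM mulrDr; have := kr; have := dl_le; lra.
  have e3 : 0 <= r * (k + dl)%N%:R by rewrite mulr_ge0// ltW.
  have e4 : 0 <= r * (dl + 3 * k)%N%:R by rewrite mulr_ge0// ltW.
  apply: (@le_trans _ _ ((r * (k + dl)%N%:R) * (r * (dl + 3 * k)%N%:R))); first by lra.
  have -> : 4 = 2 * 2 :> R by lra.
  exact: ler_pM.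
have pr N := @grow_prob R k dl mid p kap _ N k0 p01 (ltW kp0) (tn0 N)
  (fun ms _ am => @rows_bound R k s k0 s0 dl M1 M2 sM1 sdl ms N kap am (ltW kp0) kapb) d T P X iid.
have rho01 : 0 <= rho <= 1 / 4 by rewrite rho0 (le_trans rho_le)//; have := r1; lra.
have eps_rho : k%:R * eps <= rho * expR (- 3) ^+ k.
  by rewrite /eps mulrC divfK// lt0r_neq0// ltr0n.
have eps3 : eps <= g k (3 : R) by apply: le_trans eps_le _; have := rg; lra.
have cb N := @columns_bound R k s k0 s0 M1 M2 rho eps sM1k sM2 rho01 eps0 eps_rho eps3 N.
have main N : (M2 <= n0 + N)%N -> expR (- (2 * lam R k) / s + c0 / 8 / r) <=
    p ^+ (n0 * n0) * ((\prod_(n0 <= m < n0 + N) tn k s m) *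
    Zf k (fun x => if mid x then kap * (1 - (1 - p) ^+ (dl + k)) else 0)
      (fun x => 1 - (1 - p) ^+ (x - k)) n0 0 N).
  move=> MN; set tr := \prod_(_ <= m < _) _.
  have trp : p * expR (- (lam R k / s)) <= tr.
    apply: le_trans (prod_tn_lower N s0); rewrite expRD; apply: ler_wpM2r; first exact: expR_ge0.
    have pp : 0 < p by apply: lt_le_trans p_ge; have := s0; lra.
    by rewrite -[leLHS](lnK pp) ler_expR lerNr; apply: g_le_ln.
  have pe0 : 0 <= p * expR (- (lam R k / s)) by rewrite mulr_ge0// expR_ge0.
  (* At least [1 / (2 s)] middle columns contribute a factor [1 + eps >= exp (eps / 2)] each, where
     [eps >= c0 * r] and [s = r^2]. *)
  have gain : expR (c0 / 4 / r) <= (1 + eps) ^+ count (fun m => [&& M1 <= m, m + k <= M2 & n0 <= m]%N) (iota n0 N).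
    have cm := count_mid n0M1 MN.
    have e1 : expR (eps / 2) <= 1 + eps.
      by apply: one_plus_ge_exp => //; apply: le_trans eps_le _; have := r1; lra.
    apply: (@le_trans _ _ ((1 + eps) ^+ (M2 - M1 - k))); last first.
      by apply: ler_weXn2l => //; rewrite lerDl.
    apply: (@le_trans _ _ (expR (eps / 2) ^+ (M2 - M1 - k))); last first.
      by apply: lerXn2r; rewrite ?nnegrE ?expR_ge0//; have := eps0; lra.
    rewrite -expRM_natl ler_expR.
    have -> : (M2 - M1 - k = M1 - k)%N by rewrite /M2; clear; lia.
    apply: (@le_trans _ _ ((M1 - k)%N%:R * (c0 * r / 2))); last first.
      by apply: ler_wpM2l => //; have := eps_ge; lra.
    have h : 1 / 2 / s <= (M1 - k)%N%:R by rewrite ler_pdivrMr// [leRHS]mulrC; exact: sM1k.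
    have c0r : 0 <= c0 * r / 2 by rewrite divr_ge0// mulr_ge0// ltW// c0_gt0.
    apply: le_trans (ler_wpM2r c0r h); rewrite le_eqVlt; apply/orP; left; apply/eqP.
    by rewrite -rr; field; rewrite lt0r_neq0.
  have zb : tr * expR (c0 / 4 / r) <= Zf k (fun x => if mid x then kap * (1 - (1 - p) ^+ (dl + k)) else 0)
      (fun x => 1 - (1 - p) ^+ (x - k)) n0 0 N.
    apply: le_trans (cb N); rewrite big_split /=; apply: ler_wpM2l; first exact: tn0.
    rewrite -big_mkcond big_const_seq iter_mulr_1 /index_iota addKn.
    apply: le_trans gain _; rewrite le_eqVlt; apply/orP; left; apply/eqP.
    by congr (_ ^+ _); apply: eq_count => m; rewrite andbA.
  apply: (@le_trans _ _ (p ^+ (n0 * n0) * (tr * (tr * expR (c0 / 4 / r))))); last first.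
    by apply: ler_wpM2l; [exact: exprn_ge0|apply: ler_wpM2l => //; exact: tn0].
  apply: (@le_trans _ _ (p ^+ K * (expR (- (2 * lam R k) / s) * expR (c0 / 4 / r)))).
    apply: (@le_trans _ _ (expR (- (c0 / 8 / r)) * (expR (- (2 * lam R k) / s) * expR (c0 / 4 / r)))).
      by rewrite -!expRD ler_expR; lra.
    by apply: ler_wpM2r; [rewrite mulr_ge0// expR_ge0|exact: p_pow].
  have -> : p ^+ K * (expR (- (2 * lam R k) / s) * expR (c0 / 4 / r)) =
      p ^+ (n0 * n0) * ((p * expR (- (lam R k / s))) * ((p * expR (- (lam R k / s))) * expR (c0 / 4 / r))).
    have -> : - (2 * lam R k) / s = - (lam R k / s) + - (lam R k / s) by ring.
    by rewrite expRD /K exprD; ring.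
  apply: ler_wpM2l; first exact: exprn_ge0.
  apply: ler_pM => //; first by rewrite mulr_ge0// expR_ge0.
  by apply: ler_wpM2r; [exact: expR_ge0|].
have [mn _] := pr n; split=> //.
(* The gain requires the range of columns to reach [M2]; smaller [n] follow as the events
   decrease. *)
have [mN PN] := pr (n + M2)%N.
apply: (@le_trans _ _ (P [set t | grow k dl mid (n + M2) (X t)])).
  apply: le_trans PN; rewrite lee_fin; apply: main; exact: leq_trans (leq_addl _ _) (leq_addl _ _).
apply: le_measure; rewrite ?inE// => t /=.
exact: grow_prefix.
Qed.

End Scale.

Lemma grow_lower_prob : exists s0 c : R, [/\ 0 < s0, 0 < c & forall s, 0 < s < s0 ->
  exists dl mid, forall n (d : measure_display) (T : measurableType d) (P : probability T R) (X : T -> config),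
  iid_bernoulli_field P X (1 - expR (- s)) ->
  measurable [set t | grow k dl mid n (X t)] /\
  ((expR (- (2 * lam R k) / s + c / Num.sqrt s))%:E <= P [set t | grow k dl mid n (X t)])%E].
Proof.
have g3 : 0 < g k (3 : R) by apply: (g_gt0 k0); lra.
have d0 := dlt_gt0; have k00 : 0 < k%:R :> R by rewrite ltr0n.
pose rm := Num.min (1 / (16 * k%:R)) (Num.min (g k (3 : R) / 2) (dlt ^+ 3 / 54)).
have rm0 : 0 < rm.
  by rewrite !lt_min; apply/and3P; split; apply: divr_gt0 => //; [rewrite mulr_gt0|exact: exprn_gt0].
exists (rm ^+ 2), (c0 / 8); split; [exact: exprn_gt0|by rewrite divr_gt0// c0_gt0|].
move=> s /andP[s0 srm].
have rs : Num.sqrt s <= rm.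
  rewrite -(ler_pXn2r (n := 2)) ?nnegrE ?sqrtr_ge0 ?(ltW rm0)//.
  by rewrite sqr_sqrtr ltW.
move: rs; rewrite !le_min => /and3P[r16 rg rd].
eexists; eexists => n d T P X iid.
exact: (@grow_lower s s0 r16 rg rd n d T P X iid).
Qed.

End LowerGrow.

(** * From the quadrant to the whole plane *)

Section Lines.
Variables (R : realType) (d : measure_display) (T : measurableType d).
Variables (P : probability T R) (X : T -> config) (p : R).
Hypothesis iid : iid_bernoulli_field P X p.
Hypothesis p01 : 0 < p <= 1.

Lemma empty_sequence_null (h : nat -> site) : injective h ->
  measurable [set t | forall j, X t (h j) = false] /\ P [set t | forall j, X t (h j) = false] = 0%E.
Proof.
move=> ih; set A := [set t | _].
have mA : measurable A.
  have -> : A = \bigcap_j [set t | X t (h j) = false].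
    by apply/seteqP; split => t /=; [move=> Ht j _; exact: Ht|move=> Ht j; exact: (Ht j I)].
  by apply: bigcapT_measurable => j; exact: (measurable_site iid).
split=> //; apply/eqP; rewrite eq_le measure_ge0 andbT.
have bound n : (P A <= ((1 - p) ^+ n)%:E)%E.
  have u : uniq (map h (iota 0 n)) by rewrite map_inj_uniq ?iota_uniq.
  have := iid.2 (map h (iota 0 n)) (fun=> false) u.
  rewrite big_const_seq count_predT size_map size_iota iter_mulr_1 => <-.
  apply: le_measure; rewrite ?inE//; first exact: (measurable_agree iid (map h (iota 0 n)) (fun=> false)).
  by move=> t At x /mapP[j _ ->]; exact: At.
have /andP[p0 p1] := p01.
apply/lee_addgt0Pr => e e0; rewrite add0e.
have [|n hn] := @pow_small R (1 - p) e _ e0; first by apply/andP; split; lra.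
by apply: le_trans (bound n) _; rewrite lee_fin hn.
Qed.

Lemma lines_occupied : exists2 B : set T, measurable B /\ P B = 0%E &
  forall t, ~ B t -> (forall x : int, exists j : nat, X t (x, j%:Z)) /\
    (forall y : int, exists i : nat, X t (i%:Z, y)).
Proof.
pose h (e : bool * int) (j : nat) : site := if e.1 then (j%:Z, e.2) else (e.2, j%:Z).
have ih e : injective (h e) by move=> a b; rewrite /h; case: (e.1) => -[].
pose F i : set T := if unpickle i is Some e then [set t | forall j, X t (h e j) = false] else set0.
have mF i : measurable (F i).
  by rewrite /F; case: unpickle => [e|]; [exact: (empty_sequence_null (ih e)).1|exact: measurable0].
have PF i : P (F i) = 0%E.
  by rewrite /F; case: unpickle => [e|]; [exact: (empty_sequence_null (ih e)).2|exact: measure0].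
exists (\bigcup_i F i).
  have mU : measurable (\bigcup_i F i) by exact: bigcupT_measurable.
  split=> //; apply: measure_negligible => //; apply: negligible_bigcup => i.
  by exists (F i); split => //; exact: PF.
move=> t nB.
have H e : exists j, X t (h e j).
  apply: contrapT => no; apply: nB; exists (pickle e) => //.
  rewrite /F pickleK => j; apply/negbTE/negP => hj; apply: no; by exists j.
by split=> [x|y]; [exact: (H (false, x))|exact: (H (true, y))].
Qed.

End Lines.

(** The events [grow n] decrease, so their intersection keeps the bound. It fills the quadrant, and
    outside a null set every line has an occupied site on its nonnegative half, which extends the
    growth to the plane. *)
Lemma growth_ge (R : realType) (d : measure_display) (T : measurableType d)
    (P : probability T R) (X : T -> config) (p e : R) m dl mid :
  valid_model m -> 0 < p <= 1 -> iid_bernoulli_field P X p ->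
  (forall n, measurable [set t | grow (model_k m) dl mid n (X t)] /\
    (e%:E <= P [set t | grow (model_k m) dl mid n (X t)])%E) ->
  (e%:E <= P [set t | indefinite_growth m (X t)])%E.
Proof.
move=> vm p01 iid hg; set k := model_k m in hg.
have k0 : (0 < k)%N by move: vm; rewrite /k; case: (m) => //= j; lia.
pose F n := [set t | grow k dl mid n (X t)].
have mF n : measurable (F n) := (hg n).1.
have mI : measurable (\bigcap_n F n) by exact: bigcapT_measurable.
have niF : nonincreasing_seq F.
  move=> n n' nn; apply/subsetPset => t; rewrite /F /= -(subnKC nn).
  exact: grow_prefix.
have PI : (e%:E <= P (\bigcap_n F n))%E.
  have cv : (P \o F) n @[n --> \oo] --> P (\bigcap_n F n).
    by apply: nonincreasing_cvg_mu => //; apply: le_lt_trans (probability_le1 _ _) (ltry _).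
  rewrite -(cvg_lim _ cv)//; apply: lime_ge; first by apply/cvg_ex; eexists; exact: cv.
  by near=> n; exact: (hg n).2.
have [B [mB PB] hB] := lines_occupied iid p01.
have mG := measurable_indefinite_growth iid m.
apply: le_trans PI _; rewrite -[leRHS]adde0 -PB.
apply: le_trans (measureU2 _ mG mB); apply: le_measure; rewrite ?inE//; first exact: measurableU.
move=> t It; have [Bt|nBt] := pselect (B t); [by right|left].
have [hx hy] := hB t nBt.
have cl := final_active_closed m (X t).
apply: (quadrant_fill vm cl _ hx hy).
by apply: (@grow_quadrant k dl mid k0 m (X t)) => // n; exact: (It n I).
Unshelve. all: by end_near.
Qed.

Theorem theorem1 (R : realType) :
  (forall m : model, valid_model m ->
   exists s0 c1 c2 : R, [/\ 0 < s0, 0 < c1, 0 < c2 &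
     forall s : R, 0 < s < s0 ->
     forall (d : measure_display) (T : measurableType d)
            (P : probability T R) (X : T -> config),
       iid_bernoulli_field P X (1 - expR (- s)) ->
       ((expR (- (2 * lambda_k R (model_k m)) / s + c1 * (Num.sqrt s)^-1))%:E
         <= P [set t | indefinite_growth m (X t)])%E
       /\ (P [set t | indefinite_growth m (X t)]
         <= (expR (- (2 * lambda_k R (model_k m)) / s
                   + c2 * (Num.sqrt s)^-1 * (ln s^-1) `^ (5 / 2)))%:E)%E]) /\
  (exists s0 c2 : R, [/\ 0 < s0, 0 < c2 &
     forall s : R, 0 < s < s0 ->
     forall (d : measure_display) (T : measurableType d)
            (P : probability T R) (X : T -> config),
       iid_bernoulli_field P X (1 - expR (- s)) ->
       (P [set t | indefinite_growth Frobse1 (X t)]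
         <= (expR (- (2 * lambda_k R 1) / s
                   + c2 * (Num.sqrt s)^-1 * ln s^-1))%:E)%E]).
Proof.
split; last first.
  have [s0 [c [s00 c0 h]]] := @upper_prob R 1 isT Frobse1 I erefl.
  exists s0, c; split=> // s hs d T P X iid.
  have := h s hs d T P X iid; rewrite subnn mul0r addr0 mulr1 lamE// /lambda_k.
  by rewrite [c / _ * _]mulrAC.
move=> m vm; have k0 : (0 < model_k m)%N by case: m vm => //= j; lia.
have [su [cu [su0 cu0 hu]]] := @upper_prob R (model_k m) k0 m vm erefl.
have [sl [cl [sl0 cl0 hl]]] := @grow_lower_prob R (model_k m) k0.
have kr0 : 0 < (model_k m)%:R :> R by rewrite ltr0n.
exists (Num.min (Num.min su sl) (expR (- 1))), cl, (cu * (model_k m)%:R); split=> //.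
- by rewrite !lt_min su0 sl0 expR_gt0.
- exact: mulr_gt0.
move=> s /andP[s0]; rewrite !lt_min => /andP[/andP[ssu ssl] s1] d T P X iid.
have lE : lambda_k R (model_k m) = lam R (model_k m) by rewrite lamE.
split.
  have [dl [mid hg]] := hl s ltac:(by rewrite s0).
  rewrite lE; apply: (@growth_ge R d T P X (1 - expR (- s)) _ m dl mid vm _ iid).
    by rewrite gerBl expR_ge0 andbT subr_gt0 expR_lt1 oppr_lt0.
  by move=> n; exact: hg.
apply: le_trans (hu s _ d T P X iid) _; first by rewrite s0.
rewrite lE lee_fin ler_expR lerD2l.
set L := ln s^-1.
have L1 : 1 <= L.
  by rewrite /L lnV ?posrE// lerNr -ler_expR lnK ?posrE// ltW.
have q0 : 0 <= (Num.sqrt s)^-1 by rewrite invr_ge0 sqrtr_ge0.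
have k1 : 1 + (model_k m - 1)%N%:R * L <= (model_k m)%:R * L.
  rewrite natrB// mulrBl mul1r; lra.
(* The bound obtained has [L^2], and [s < exp (- 1)] ensures [L >= 1]. *)
have L2 : L ^+ 2 <= L `^ (5 / 2).
  by rewrite -powR_mulrn ?(le_trans ler01 L1)//; apply: ler_powR => //; lra.
apply: (@le_trans _ _ (cu * L * (Num.sqrt s)^-1 * ((model_k m)%:R * L))).
  by apply: ler_wpM2l => //; rewrite !mulr_ge0// ?(ltW cu0)// (le_trans ler01).
have -> : cu * L * (Num.sqrt s)^-1 * ((model_k m)%:R * L) =
  cu * (model_k m)%:R * (Num.sqrt s)^-1 * L ^+ 2 by rewrite expr2; ring.
by apply: ler_wpM2l => //; rewrite !mulr_ge0// ltW.
Qed.
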